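(* Let $d\ge1$, let $a\in L^2(\mathbb R^{2d})$, and let $U:L^2(\mathbb R^d)\to L^2(\mathbb R^d)$ be the unitary operator of reflection, $(Uf)(x)=f(-x)$. Then $$\mathrm{Op}^{\rm w}(a)\,U=\mathrm{Op}^{\rm w}(a^* ),$$ where $a^*$ is the dual symbol of $a$, $a^*(x,\xi)=2^d(\mathcal F a)(2\xi,-2x)$.
   Context: For a complex-valued $a=a(x,\xi)$, $x,\xi\in\mathbb R^d$, the Weyl pseudodifferential operator is $$(\mathrm{Op}^{\rm w}(a)u)(x)=\frac1{(2\pi)^d}\iint e^{i(x-y)\cdot\xi}a\Big(\frac{x+y}2,\xi\Big)u(y)\,dy\,d\xi .$$ For $a\in L^2(\mathbb R^{2d})$ it is understood as the Hilbert-Schmidt operator on $L^2(\mathbb R^d)$ with integral kernel $(2\pi)^{-d/2}(\mathcal F_2a)\big(\frac{x+y}2,y-x\big)$, where $(\mathcal F_2a)(x,y)=(2\pi)^{-d/2}\int e^{-iy\cdot\xi}a(x,\xi)\,d\xi$. The Fourier transform $\mathcal F$ on $L^2(\mathbb R^{2d})$ is $$(\mathcal Fa)(\eta,y)=\frac1{(2\pi)^d}\iint_{\mathbb R^{2d}}e^{-iy\cdot\xi-i\eta\cdot x}a(x,\xi)\,d\xi\,dx .$$ *)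

(* Defs.v *)
From HB Require Import structures.
From mathcomp Require Import all_boot all_order all_algebra.
From mathcomp Require Import complex.
From mathcomp Require Import all_classical all_reals all_analysis.
Import Order.TTheory GRing.Theory Num.Theory.
Import numFieldNormedType.Exports.

Set Implicit Arguments.
Unset Strict Implicit.
Unset Printing Implicit Defensive.

Local Open Scope classical_set_scope.
Local Open Scope ring_scope.

(* R^n as the library's measurable type of n-tuples of reals; its sigma-algebra
   is generated by the coordinates, hence is the Borel one. *)
Notation RR R n := (n.-tuple (measurableTypeR R)).

Section lebesgue_measure_cons.
Local Open Scope ereal_scope.
Context {R : realType} {n : nat}.
Variable mu : {sigma_finite_measure set (RR R n) -> \bar R}.

Definition tuple_cons (p : measurableTypeR R * RR R n) : RR R n.+1 :=
  [tuple of p.1 :: p.2].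

Lemma measurable_tuple_cons : measurable_fun setT tuple_cons.
Proof. exact: measurable_cons. Qed.

Definition lebesgue_cons : set (RR R n.+1) -> \bar R :=
  pushforward (lebesgue_measure \x mu) tuple_cons.

Let lebesgue_cons0 : lebesgue_cons set0 = 0.
Proof. by rewrite /lebesgue_cons /pushforward preimage_set0 measure0. Qed.

Let lebesgue_cons_ge0 A : 0 <= lebesgue_cons A.
Proof. by rewrite /lebesgue_cons /pushforward measure_ge0. Qed.

Let lebesgue_cons_sigma_additive : semi_sigma_additive lebesgue_cons.
Proof.
apply: (@measure_semi_sigma_additive _ _ _ (pushforward _ _)).
exact: measurable_tuple_cons.
Qed.

HB.instance Definition _ := isMeasure.Build _ _ _ lebesgue_cons
  lebesgue_cons0 lebesgue_cons_ge0 lebesgue_cons_sigma_additive.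

Let lebesgue_cons_sigma_finite : sigma_finite setT lebesgue_cons.
Proof.
have /sigma_finiteP[F [UF ndF Foo]] := sigma_finiteT (@lebesgue_measure R).
have /sigma_finiteP[G [UG ndG Goo]] := sigma_finiteT mu.
pose g (t : RR R n.+1) : measurableTypeR R * RR R n :=
  (thead t, [tuple of behead t]).
have mg : measurable_fun setT g.
  apply/measurable_fun_pairP; split; last exact: measurable_behead.
  exact: measurable_tnth.
have gK p : g (tuple_cons p) = p.
  by case: p => x t; rewrite /g theadE; congr pair; apply: val_inj.
exists (fun k => g @^-1` (F k `*` G k)).
  rewrite -preimage_bigcup (_ : \bigcup_i _ = setT) ?preimage_setT//.
  rewrite -setXTT UF UG; apply/seteqP; split => -[x y].
    by move=> [k _ []/= ? ?]; split; exists k.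
  move=> [/= [k _ Fkx] [l _ Gly]]; exists (maxn k l) => //; split.
  - by move: x Fkx; exact/subsetPset/ndF/leq_maxl.
  - by move: y Gly; exact/subsetPset/ndG/leq_maxr.
move=> k; have [mF Fk] := Foo k; have [mG Gk] := Goo k; split.
  by rewrite -[X in measurable X]setTI; apply: mg => //; exact: measurableX.
rewrite /lebesgue_cons /pushforward (_ : _ @^-1` _ = F k `*` G k).
  by rewrite product_measure1E// lte_mul_pinfty// ge0_fin_numE.
by apply/funext => p; rewrite /preimage /mkset gK.
Qed.

HB.instance Definition _ := Measure_isSigmaFinite.Build _ _ _ lebesgue_cons
  lebesgue_cons_sigma_finite.

End lebesgue_measure_cons.

(* Lebesgue measure on R^n: the unit mass for n = 0, and the image of the
   product measure of R x R^n under (t, x) |-> t :: x for n.+1. *)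
Fixpoint lebesgue {R : realType} (n : nat) :
    {sigma_finite_measure set (RR R n) -> \bar R} :=
  match n with
  | 0%N => dirac [tuple]
  | m.+1 => lebesgue_cons (lebesgue m)
  end.

Section complex_integration.
Context {R : realType} d {T : measurableType d}.
Variable mu : {measure set T -> \bar R}.
Implicit Types (f g : T -> R[i]) (p : R).

Definition cintegral f : R[i] :=
  Complex (\int[mu]_x complex.Re (f x))%R (\int[mu]_x complex.Im (f x))%R.

Definition cLnorm p f : \bar R := ('N[mu]_(p%:E)[EFin \o @Normc.normc R \o f])%E.

(* f represents an element of L^p(mu); elements of L^p(mu) are equal when their
   representatives are almost everywhere equal. *)
Definition cLfun p f : Prop :=
  [/\ measurable_fun setT (fun x => complex.Re (f x)),
      measurable_fun setT (fun x => complex.Im (f x)) &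
      (cLnorm p f < +oo)%E].

(* Value at f in L^2(mu) of the continuous extension to L^2(mu) of an operator F
   given on L^1(mu) \cap L^2(mu): the L^2-limit of F (f_k) for every sequence
   f_k of L^1 \cap L^2 functions converging to f in L^2. It is determined up to
   almost everywhere equality, and is 0 by convention if there is no such
   limit. *)
Definition L2_extension (F : (T -> R[i]) -> T -> R[i]) f : T -> R[i] :=
  xget (cst 0) [set g | cLfun 2 g /\
    forall f_ : nat -> T -> R[i],
      (forall k, cLfun 1 (f_ k) /\ cLfun 2 (f_ k)) ->
      cLnorm 2 (f_ k \- f) @[k --> \oo] --> 0%E ->
      cLnorm 2 (F (f_ k) \- g) @[k --> \oo] --> 0%E].

(* Equality of operators on L^2(mu). *)
Definition L2_op_eq (A B : (T -> R[i]) -> T -> R[i]) : Prop :=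
  forall f, cLfun 2 f -> {ae mu, forall x, A f x = B f x}.

End complex_integration.

Section weyl.
Context {R : realType} {d : nat}.
Implicit Types (x y : RR R d) (c : R).
Local Open Scope complex_scope.

Definition tadd x y : RR R d := [tuple tnth x i + tnth y i | i < d].
Definition tscale c x : RR R d := [tuple c * tnth x i | i < d].
Definition topp x : RR R d := [tuple - tnth x i | i < d].
Definition dotp x y : R := \sum_(i < d) tnth x i * tnth y i.

Definition expi (t : R) : R[i] := cos t +i* sin t.

Definition lebesgue2 : {measure set (RR R d * RR R d) -> \bar R} :=
  (lebesgue d \x lebesgue d)%E.

Implicit Types a : RR R d * RR R d -> R[i].

(* (F a)(eta, y) for a in L^1(R^{2d}) *)
Definition fourierL1 a (p : RR R d * RR R d) : R[i] :=
  (((2 * pi) ^+ d)^-1)%:C *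
  cintegral lebesgue2
    (fun q => expi (- dotp p.2 q.2 - dotp p.1 q.1) * a q).

(* (F_2 a)(x, y) for a in L^1(R^{2d}), defined for almost every x *)
Definition fourier2L1 a (p : RR R d * RR R d) : R[i] :=
  ((2 * pi) `^ (- (d%:R / 2)))%:C *
  cintegral (lebesgue d) (fun xi => expi (- dotp p.2 xi) * a (p.1, xi)).

Definition fourier a := L2_extension lebesgue2 fourierL1 a.

Definition fourier2 a := L2_extension lebesgue2 fourier2L1 a.

(* Integral kernel of the Hilbert-Schmidt operator Op^w(a), a in L^2(R^{2d}) *)
Definition weyl_kernel a x y : R[i] :=
  ((2 * pi) `^ (- (d%:R / 2)))%:C *
  fourier2 a (tscale 2^-1 (tadd x y), tadd y (topp x)).

Definition Opw a (u : RR R d -> R[i]) x : R[i] :=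
  cintegral (lebesgue d) (fun y => weyl_kernel a x y * u y).

Definition reflection (u : RR R d -> R[i]) x : R[i] := u (topp x).

Definition dual_symbol a (p : RR R d * RR R d) : R[i] :=
  (2 ^+ d)%:C * fourier a (tscale 2 p.2, tscale (- 2) p.1).

End weyl.

(* Main.v *)
Require Import Defs.
From HB Require Import structures.
From mathcomp Require Import all_boot all_order all_algebra.
From mathcomp Require Import complex.
From mathcomp Require Import all_classical all_reals all_analysis.
From mathcomp Require Import measurable_realfun ring lra.
Import Order.TTheory GRing.Theory Num.Theory.
Import numFieldNormedType.Exports.

Set Implicit Arguments.
Unset Strict Implicit.
Unset Printing Implicit Defensive.

Local Open Scope classical_set_scope.
Local Open Scope ring_scope.

(** The kernel of Op^w(a) depends on a only through F_2 a, and composing with U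
    flips the sign of y in the kernel. In terms of F_2 the claim is
    F_2 a^* = (F_2 a) o L with L(x, y) = (- y / 2, - 2 x): F is a partial
    Fourier transform in both variables and F_2 undoes one of them. For
    a = u (x) v one has F a = Fu (x) Fv and F_2 a = u (x) Fv, and the identity is
    Fourier inversion for u. It extends to L^2 because both sides are
    L^2-continuous in a and indicators of rectangles are total.

    The needed boundedness and inversion come from Abel summation on the line:
    inserting exp(- eps |y|) in the composition of the transform with its adjoint
    produces a Poisson kernel, which is positive of constant mass, so that Schur's
    test gives a bound, uniform in eps, on the transform (its constant is
    irrelevant). Fourier pairs are stable under products, whence R^n. *)

(** * Square-integrable complex functions *)

(** The transform of a function of $L^1\cap L^2$ need not be integrable, so $\mathcal F_2a^*$ cannot
    be computed by composing integrals. Every composition is therefore stated in the form: some [w]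
    in $L^1\cap L^2$ is close to the inner value and its outer image is close to the expected
    result. This one form serves inversion on the line, its passage to products and the duality on
    tensors; [bop_approx] carries it from indicators to $L^2$. The extensions [fourier] and
    [fourier2] are picked by [xget] and are used only through [L2_extensionP], an estimate valid for
    any admissible choice. Norms are handled squared, as [L2sq]: the triangle inequality becomes the
    parallelogram bound with factors 2, squared moduli are polynomials, and no root is taken.
    Constants such as [4 * C] come from iterating that bound. The changes of variable on phase space
    multiply [L2sq] by a constant, which gives at once boundedness and preservation of null sets. *)

Section sqnorm.
Context {R : realType}.
Implicit Types z w : R[i].
Local Open Scope complex_scope.

Definition sqnorm z : R := complex.Re z ^+ 2 + complex.Im z ^+ 2.

Lemma sqnorm_ge0 z : 0 <= sqnorm z.
Proof. by rewrite /sqnorm addr_ge0 ?sqr_ge0. Qed.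

Lemma sqnormM z w : sqnorm (z * w) = sqnorm z * sqnorm w.
Proof. by case: z w => [a b] [c e]; rewrite /sqnorm /=; ring. Qed.

Lemma sqnormN z : sqnorm (- z) = sqnorm z.
Proof. by case: z => [a b]; rewrite /sqnorm /=; ring. Qed.

Lemma sqnormBC z w : sqnorm (z - w) = sqnorm (w - z).
Proof. by rewrite -sqnormN opprB. Qed.

Lemma sqnorm_conjc z : sqnorm (conjc z) = sqnorm z.
Proof. by case: z => [a b]; rewrite /sqnorm /=; ring. Qed.

Lemma sqnorm_real (x : R) : sqnorm x%:C = x ^+ 2.
Proof. by rewrite /sqnorm /=; ring. Qed.

Lemma sqnorm0 : sqnorm 0 = 0.
Proof. by rewrite /sqnorm /= expr0n addr0. Qed.

Lemma sqnorm_eq0 z : sqnorm z = 0 -> z = 0.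
Proof.
case: z => a b /eqP; rewrite /sqnorm /= paddr_eq0 ?sqr_ge0// !sqrf_eq0.
by move=> /andP[/eqP -> /eqP ->].
Qed.

(** The parallelogram law: the right side exceeds the left one by $|z-w|^2$. *)
Lemma sqnormD z w : sqnorm (z + w) <= 2 * sqnorm z + 2 * sqnorm w.
Proof.
case: z w => [a b] [c e]; rewrite /sqnorm /= -subr_ge0.
rewrite (_ : _ - _ = (a - c) ^+ 2 + (b - e) ^+ 2); last by ring.
by rewrite addr_ge0 ?sqr_ge0.
Qed.

Lemma normc_sqr z : Normc.normc z ^+ 2 = sqnorm z.
Proof.
by case: z => a b; rewrite /sqnorm /Normc.normc sqr_sqrtr// addr_ge0 ?sqr_ge0.
Qed.

Lemma normc_sqrt z : Normc.normc z = Num.sqrt (sqnorm z).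
Proof. by case: z. Qed.

Lemma normc_ge0 z : 0 <= Normc.normc z.
Proof. by rewrite normc_sqrt sqrtr_ge0. Qed.

Lemma normr_Re_le z : `|complex.Re z| <= Normc.normc z.
Proof.
rewrite normc_sqrt -sqrtr_sqr ler_wsqrtr// /sqnorm lerDl sqr_ge0//.
Qed.

Lemma normr_Im_le z : `|complex.Im z| <= Normc.normc z.
Proof.
rewrite normc_sqrt -sqrtr_sqr ler_wsqrtr// /sqnorm lerDr sqr_ge0//.
Qed.

Lemma normc_le z : Normc.normc z <= `|complex.Re z| + `|complex.Im z|.
Proof.
rewrite normc_sqrt -[leRHS]ger0_norm ?addr_ge0// -sqrtr_sqr ler_wsqrtr//.
rewrite sqrrD /sqnorm !real_normK ?num_real// -addrA lerD2l lerDr.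
by rewrite mulrn_wge0// mulr_ge0.
Qed.

Lemma ReD z w : complex.Re (z + w) = complex.Re z + complex.Re w.
Proof. by case: z w => [? ?] []. Qed.
Lemma ImD z w : complex.Im (z + w) = complex.Im z + complex.Im w.
Proof. by case: z w => [? ?] []. Qed.
Lemma ReN z : complex.Re (- z) = - complex.Re z.
Proof. by case: z. Qed.
Lemma ImN z : complex.Im (- z) = - complex.Im z.
Proof. by case: z. Qed.
Lemma ReM z w : complex.Re (z * w) =
  complex.Re z * complex.Re w - complex.Im z * complex.Im w.
Proof. by case: z w => [? ?] []. Qed.
Lemma ImM z w : complex.Im (z * w) =
  complex.Re z * complex.Im w + complex.Im z * complex.Re w.
Proof. by case: z w => [? ?] []. Qed.
Lemma ReJ z : complex.Re (conjc z) = complex.Re z.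
Proof. by case: z. Qed.
Lemma ImJ z : complex.Im (conjc z) = - complex.Im z.
Proof. by case: z. Qed.

Lemma conjcM z w : conjc (z * w) = conjc z * conjc w.
Proof. exact: rmorphM. Qed.

Lemma eq_ReIm z w :
  complex.Re z = complex.Re w -> complex.Im z = complex.Im w -> z = w.
Proof. by case: z w => [? ?] [? ?] /= -> ->. Qed.

End sqnorm.

Definition ReImE := (@ReD, @ImD, @ReN, @ImN, @ReM, @ImM, @ReJ, @ImJ).

Section cmeasurable.
Context {R : realType} d {T : measurableType d}.
Implicit Types f g : T -> R[i].
Local Open Scope complex_scope.

(** Measurability by components, the shape in which [cLfun] asks for it. *)
Definition cmeasurable f :=
  measurable_fun setT (fun x => complex.Re (f x)) /\
  measurable_fun setT (fun x => complex.Im (f x)).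

Lemma cmeasurable_cst (c : R[i]) : cmeasurable (fun=> c).
Proof. by split. Qed.

Lemma cmeasurable_real (f : T -> R) :
  measurable_fun setT f -> cmeasurable (fun x => (f x)%:C).
Proof. by split. Qed.

Lemma cmeasurableD f g : cmeasurable f -> cmeasurable g -> cmeasurable (f \+ g).
Proof.
move=> [f1 f2] [g1 g2]; split.
  by under eq_fun do rewrite ReD; exact: measurable_funD.
by under eq_fun do rewrite ImD; exact: measurable_funD.
Qed.

Lemma cmeasurableN f : cmeasurable f -> cmeasurable (fun x => - f x).
Proof.
move=> [f1 f2]; split.
  by under eq_fun do rewrite ReN; exact: measurable_funN.
by under eq_fun do rewrite ImN; exact: measurable_funN.
Qed.

Lemma cmeasurableB f g : cmeasurable f -> cmeasurable g -> cmeasurable (f \- g).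
Proof. by move=> mf mg; apply: cmeasurableD => //; exact: cmeasurableN. Qed.

Lemma cmeasurableM f g : cmeasurable f -> cmeasurable g ->
  cmeasurable (fun x => f x * g x).
Proof.
move=> [f1 f2] [g1 g2]; split.
  under eq_fun do rewrite ReM.
  by apply: measurable_funB; exact: measurable_funM.
under eq_fun do rewrite ImM.
by apply: measurable_funD; exact: measurable_funM.
Qed.

Lemma cmeasurableZ (c : R[i]) f :
  cmeasurable f -> cmeasurable (fun x => c * f x).
Proof. by apply: cmeasurableM; exact: cmeasurable_cst. Qed.

Lemma cmeasurableJ f : cmeasurable f -> cmeasurable (fun x => conjc (f x)).
Proof.
move=> [f1 f2]; split; first by under eq_fun do rewrite ReJ.
by under eq_fun do rewrite ImJ; exact: measurable_funN.
Qed.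

Lemma measurable_sqnorm f :
  cmeasurable f -> measurable_fun setT (fun x => sqnorm (f x)).
Proof.
by move=> [f1 f2]; apply: measurable_funD; exact: measurable_funX.
Qed.

Lemma measurable_normc f :
  cmeasurable f -> measurable_fun setT (fun x => Normc.normc (f x)).
Proof.
move=> mf; under eq_fun do rewrite normc_sqrt.
apply: (measurable_comp (F := setT)) => //; last exact: measurable_sqnorm.
by apply: continuous_measurable_fun => x; exact: sqrt_continuous.
Qed.

End cmeasurable.

Lemma cmeasurable_comp {R : realType} d d' {T : measurableType d}
    {T' : measurableType d'} (f : T' -> R[i]) (g : T -> T') :
  cmeasurable f -> measurable_fun setT g -> cmeasurable (fun x => f (g x)).
Proof.
by move=> [f1 f2] mg; split; [exact: (measurableT_comp f1)|
                              exact: (measurableT_comp f2)].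
Qed.

Section L2sq.
Context {R : realType} d {T : measurableType d}.
Variable mu : {measure set T -> \bar R}.
Implicit Types f g h : T -> R[i].
Local Open Scope ereal_scope.

(** The square of [cLnorm mu 2 f], by [cLnorm_sqr]. *)
Definition L2sq f : \bar R := \int[mu]_x (sqnorm (f x))%:E.

Definition cL2 f := cmeasurable f /\ L2sq f < +oo.

Definition cintegrable f :=
  mu.-integrable setT (fun x => (complex.Re (f x))%:E) /\
  mu.-integrable setT (fun x => (complex.Im (f x))%:E).

Definition cL12 f := cintegrable f /\ cL2 f.

Lemma L2sq_ge0 f : 0 <= L2sq f.
Proof. by apply: integral_ge0 => x _; rewrite lee_fin sqnorm_ge0. Qed.

Lemma measurable_sqnormE f :
  cmeasurable f -> measurable_fun setT (fun x => (sqnorm (f x))%:E).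
Proof. by move=> mf; apply/measurable_EFinP; exact: measurable_sqnorm. Qed.

Lemma le_L2sq f g : cmeasurable f -> cmeasurable g ->
  (forall x, sqnorm (f x) <= sqnorm (g x))%R -> L2sq f <= L2sq g.
Proof.
move=> mf mg fg; apply: ge0_le_integral => //.
- by move=> x _; rewrite lee_fin sqnorm_ge0.
- exact: measurable_sqnormE.
- exact: measurable_sqnormE.
- by move=> x _; rewrite lee_fin.
Qed.

Lemma L2sqZ (c : R[i]) f : cmeasurable f ->
  L2sq (fun x => c * f x)%R = (sqnorm c)%:E * L2sq f.
Proof.
move=> mf; rewrite /L2sq -ge0_integralZl_EFin//.
- by apply: eq_integral => x _; rewrite sqnormM EFinM.
- by move=> x _; rewrite lee_fin sqnorm_ge0.
- exact: measurable_sqnormE.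
- exact: sqnorm_ge0.
Qed.

Lemma L2sqD f g : cmeasurable f -> cmeasurable g ->
  L2sq (f \+ g)%R <= 2%:E * L2sq f + 2%:E * L2sq g.
Proof.
move=> mf mg.
have sc h : cmeasurable h ->
    2%:E * L2sq h = \int[mu]_x (2%:E * (sqnorm (h x))%:E).
  move=> mh; rewrite ge0_integralZl_EFin//; last exact: measurable_sqnormE.
  by move=> x _; rewrite lee_fin sqnorm_ge0.
rewrite !sc// -ge0_integralD//.
- apply: ge0_le_integral => //.
  + by move=> x _; rewrite lee_fin sqnorm_ge0.
  + by apply: measurable_sqnormE; exact: cmeasurableD.
  + by apply: emeasurable_funD; apply: measurable_funeM; exact: measurable_sqnormE.
  + by move=> x _ /=; rewrite -!EFinM -EFinD lee_fin sqnormD.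
- by move=> x _; rewrite mule_ge0// lee_fin// sqnorm_ge0.
- by apply: measurable_funeM; exact: measurable_sqnormE.
- by move=> x _; rewrite mule_ge0// lee_fin// sqnorm_ge0.
- by apply: measurable_funeM; exact: measurable_sqnormE.
Qed.

Lemma L2sqBC f g : L2sq (f \- g)%R = L2sq (g \- f)%R.
Proof. by apply: eq_integral => x _; rewrite /= sqnormBC. Qed.

Lemma L2sqB f g h : cmeasurable f -> cmeasurable g -> cmeasurable h ->
  L2sq (f \- h)%R <= 2%:E * L2sq (f \- g)%R + 2%:E * L2sq (g \- h)%R.
Proof.
move=> mf mg mh.
rewrite (_ : (f \- h)%R = ((f \- g) \+ (g \- h))%R); last first.
  by apply/funext => x /=; rewrite addrA subrK.
by apply: L2sqD; exact: cmeasurableB.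
Qed.

Lemma ae_eq_L2sq f g : cmeasurable f -> cmeasurable g ->
  {ae mu, forall x, f x = g x} -> L2sq f = L2sq g.
Proof.
move=> mf mg fg; apply: ae_eq_integral => //.
- exact: measurable_sqnormE.
- exact: measurable_sqnormE.
- by apply: filterS fg => x -> _.
Qed.

Lemma L2sq_eq0 f : cmeasurable f -> L2sq f = 0 -> {ae mu, forall x, f x = 0%R}.
Proof.
move=> mf f0; have := ae_eq_integral_abs mu (@measurableT _ T)
  (measurable_sqnormE mf).
under eq_integral do rewrite gee0_abs ?lee_fin ?sqnorm_ge0//.
move=> [/(_ f0) + _]; apply: filterS => x /(_ I) [].
exact: sqnorm_eq0.
Qed.

Lemma L2sq_cst0 : L2sq (cst 0%R) = 0.
Proof. by apply: integral0_eq => x _ /=; rewrite sqnorm0. Qed.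

Lemma cL2D f g : cL2 f -> cL2 g -> cL2 (f \+ g)%R.
Proof.
move=> [mf f2] [mg g2]; split; first exact: cmeasurableD.
by apply: (le_lt_trans (L2sqD mf mg)); rewrite lte_add_pinfty// lte_mul_pinfty.
Qed.

Lemma cL2Z (c : R[i]) f : cL2 f -> cL2 (fun x => c * f x)%R.
Proof.
move=> [mf f2]; split; first exact: cmeasurableZ.
by rewrite L2sqZ// lte_mul_pinfty// lee_fin sqnorm_ge0.
Qed.

Lemma cL2B f g : cL2 f -> cL2 g -> cL2 (f \- g)%R.
Proof.
move=> hf /(cL2Z (-1)%R) /(cL2D hf); congr cL2.
by apply/funext => x /=; rewrite mulN1r.
Qed.

Lemma cintegrable_measurable f : cintegrable f -> cmeasurable f.
Proof.
by move=> [/measurable_int/measurable_EFinP ? /measurable_int/measurable_EFinP].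
Qed.

(** The modulus dominates each component and is dominated by the sum of their absolute values. *)
Lemma cintegrableP f : cmeasurable f ->
  cintegrable f <-> \int[mu]_x (Normc.normc (f x))%:E < +oo.
Proof.
move=> mf; have [mf1 mf2] := mf; split.
  move=> [/integrable_abse h1 /integrable_abse h2].
  have /integrableP[_] := integrableD (@measurableT _ T) h1 h2.
  apply: le_lt_trans; apply: ge0_le_integral => //.
  - by move=> x _; rewrite lee_fin normc_ge0.
  - by apply/measurable_EFinP; exact: measurable_normc.
  - apply: measurableT_comp => //; apply: emeasurable_funD;
      by apply: measurableT_comp => //; exact/measurable_EFinP.
  - by move=> x _; rewrite /= lee_fin (le_trans (normc_le _))// ler_norm.
move=> h; have i : mu.-integrable setT (fun x => (Normc.normc (f x))%:E).
  apply/integrableP; split.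
    by apply/measurable_EFinP; exact: measurable_normc.
  by under eq_integral do rewrite gee0_abs ?lee_fin ?normc_ge0//.
split.
- apply: le_integrable i => //; first exact/measurable_EFinP.
  move=> x _; rewrite /= lee_fin (le_trans (normr_Re_le _))//.
  by rewrite ger0_norm// normc_ge0.
- apply: le_integrable i => //; first exact/measurable_EFinP.
  move=> x _; rewrite /= lee_fin (le_trans (normr_Im_le _))//.
  by rewrite ger0_norm// normc_ge0.
Qed.

Lemma cintegrable_le f g : cmeasurable f -> cintegrable g ->
  (forall x, Normc.normc (f x) <= Normc.normc (g x))%R -> cintegrable f.
Proof.
move=> mf ig fg; have mg := cintegrable_measurable ig.
apply/cintegrableP => //; move/cintegrableP: (ig) => /(_ mg).
apply: le_lt_trans; apply: ge0_le_integral => //.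
- by move=> x _; rewrite lee_fin normc_ge0.
- by apply/measurable_EFinP; exact: measurable_normc.
- by apply/measurable_EFinP; exact: measurable_normc.
- by move=> x _; rewrite lee_fin.
Qed.

Lemma cintegrableD f g : cintegrable f -> cintegrable g ->
  cintegrable (f \+ g)%R.
Proof.
move=> [f1 f2] [g1 g2]; split.
  under eq_fun do rewrite ReD EFinD; exact: integrableD.
by under eq_fun do rewrite ImD EFinD; exact: integrableD.
Qed.

Lemma cintegrableZ (c : R[i]) f : cintegrable f ->
  cintegrable (fun x => c * f x)%R.
Proof.
move=> [f1 f2]; split.
  under eq_fun do rewrite ReM EFinB !EFinM.
  by apply: integrableB => //; exact: integrableZl.
under eq_fun do rewrite ImM EFinD !EFinM.
by apply: integrableD => //; exact: integrableZl.
Qed.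

Lemma cintegrableJ f : cintegrable f -> cintegrable (fun x => conjc (f x)).
Proof.
move=> [f1 f2]; split; first by under eq_fun do rewrite ReJ.
by under eq_fun do rewrite ImJ EFinN; exact: integrableN.
Qed.

Lemma cL12D f g : cL12 f -> cL12 g -> cL12 (f \+ g)%R.
Proof. by move=> [? ?] [? ?]; split; [exact: cintegrableD|exact: cL2D]. Qed.

Lemma cL12Z (c : R[i]) f : cL12 f -> cL12 (fun x => c * f x)%R.
Proof. by move=> [? ?]; split; [exact: cintegrableZ|exact: cL2Z]. Qed.

Lemma cintegralD f g : cintegrable f -> cintegrable g ->
  cintegral mu (f \+ g)%R = (cintegral mu f + cintegral mu g)%R.
Proof.
move=> [f1 f2] [g1 g2]; apply: eq_ReIm => /=.
  rewrite -RintegralD//; apply: eq_Rintegral => x _; exact: ReD.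
by rewrite -RintegralD//; apply: eq_Rintegral => x _; exact: ImD.
Qed.

Lemma cintegralZ (c : R[i]) f : cintegrable f ->
  cintegral mu (fun x => c * f x)%R = (c * cintegral mu f)%R.
Proof.
move=> [f1 f2]; apply: eq_ReIm => /=.
  rewrite ReM -!RintegralZl// -RintegralB//; last 2 first.
  - exact: (integrableZl _ _ f1).
  - exact: (integrableZl _ _ f2).
  by apply: eq_Rintegral => x _; rewrite ReM.
rewrite ImM -!RintegralZl// -RintegralD//; last 2 first.
- exact: (integrableZl _ _ f2).
- exact: (integrableZl _ _ f1).
by apply: eq_Rintegral => x _; rewrite ImM.
Qed.

Lemma cintegralJ f : cintegrable f ->
  cintegral mu (fun x => conjc (f x)) = conjc (cintegral mu f).
Proof.
move=> [f1 f2]; apply: eq_ReIm => /=.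
  by apply: eq_Rintegral => x _; rewrite ReJ.
rewrite -mulN1r -RintegralZl//.
by apply: eq_Rintegral => x _; rewrite ImJ mulN1r.
Qed.

Lemma eq_cintegral f g : f =1 g -> cintegral mu f = cintegral mu g.
Proof. by move=> fg; congr cintegral; exact/funext. Qed.

Lemma ae_eq_cintegral f g : cmeasurable f -> cmeasurable g ->
  {ae mu, forall x, f x = g x} -> cintegral mu f = cintegral mu g.
Proof.
move=> [mf1 mf2] [mg1 mg2] fg; apply: eq_ReIm; rewrite /= /Rintegral.
  congr fine; apply: ae_eq_integral => //; try exact/measurable_EFinP.
  by apply: filterS fg => x -> _.
congr fine; apply: ae_eq_integral => //; try exact/measurable_EFinP.
by apply: filterS fg => x -> _.
Qed.

(* The factor 2 comes from bounding both components by the whole integral. *)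
Lemma normc_cintegral_le f : cintegrable f ->
  (Normc.normc (cintegral mu f))%:E <=
  2%:E * \int[mu]_x (Normc.normc (f x))%:E.
Proof.
move=> fi; have mf := cintegrable_measurable fi.
have [f1 f2] := fi; have /cintegrableP := mf => -[/(_ fi) foo _].
have mn : measurable_fun setT (fun x => (Normc.normc (f x))%:E).
  by apply/measurable_EFinP; exact: measurable_normc.
have n0 x : setT x -> 0 <= (Normc.normc (f x))%:E.
  by move=> _; rewrite lee_fin normc_ge0.
have bound (g : T -> R) : mu.-integrable setT (EFin \o g) ->
    (forall x, `|g x| <= Normc.normc (f x))%R ->
    (`|(\int[mu]_x g x)%R|)%:E <= \int[mu]_x (Normc.normc (f x))%:E.
  move=> gi gf; rewrite EFin_normr_Rintegral//.
  have mg := measurable_int _ gi.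
  apply: (le_trans (le_abse_integral mu measurableT mg)).
  apply: ge0_le_integral => //; first exact: measurableT_comp.
  by move=> x _; rewrite /= lee_fin.
apply: (@le_trans _ _ ((`|(\int[mu]_x complex.Re (f x))%R|)%:E +
                       (`|(\int[mu]_x complex.Im (f x))%R|)%:E)).
  by rewrite -EFinD lee_fin normc_le.
rewrite [2%:E](_ : _ = 1 + 1)// ge0_muleDl// mul1e.
apply: leeD; apply: bound => // x; [exact: normr_Re_le|exact: normr_Im_le].
Qed.

Lemma L2sq_eq f g : cmeasurable f -> cmeasurable g -> L2sq (f \- g)%R = 0 ->
  {ae mu, forall x, f x = g x}.
Proof.
move=> mf mg /(L2sq_eq0 (cmeasurableB mf mg)); apply: filterS => x /= /eqP.
by rewrite subr_eq0 => /eqP.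
Qed.

End L2sq.

Section ereal_eps.
Context {R : realType}.
Implicit Types u : nat -> \bar R.
Local Open Scope ereal_scope.

Lemma cvge0_lt u e : (0 < e)%R -> u n @[n --> \oo] --> 0 ->
  \forall n \near \oo, u n < e%:E.
Proof.
move=> e0 /fine_cvgP[fu /cvgr_lt /(_ _ e0)] => lt_e; near=> n.
by rewrite -(@fineK _ (u n)) ?lte_fin; [near: n|near: n].
Unshelve. all: by end_near. Qed.

Lemma cvge0P u : (forall n, 0 <= u n) ->
  (forall e, (0 < e)%R -> \forall n \near \oo, u n < e%:E) ->
  u n @[n --> \oo] --> 0.
Proof.
move=> u0 ue; apply/fine_cvgP; split.
  apply: filterS (ue 1%R ltr01) => n un; rewrite ge0_fin_numE//.
  exact: lt_trans un (ltry _).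
apply/cvgrPdist_lt => e e0; apply: filterS (ue e e0) => n un /=.
have fn : u n \is a fin_num by rewrite ge0_fin_numE// (lt_trans un)// ltry.
by rewrite sub0r normrN ger0_norm ?fine_ge0// -lte_fin fineK.
Qed.

Lemma eps_eq0 (x : \bar R) : 0 <= x ->
  (forall e, (0 < e)%R -> x <= e%:E) -> x = 0.
Proof.
move=> x0 xe; apply/eqP; rewrite eq_le x0 andbT.
by apply/lee_addgt0Pr => e e0; rewrite add0e xe.
Qed.

End ereal_eps.

Import HBSimple.
Import HBNNSimple.

(** * An induction principle for $L^2$ from indicators of a generating family *)

Section density.
Context {R : realType} d {T : measurableType d}.
Variable mu : {measure set T -> \bar R}.
Local Open Scope ereal_scope.
Local Open Scope complex_scope.

Lemma L2sq_dominated (u : nat -> T -> R[i]) (h : T -> R) :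
  (forall n, cmeasurable (u n)) -> mu.-integrable setT (EFin \o h) ->
  (forall n x, sqnorm (u n x) <= h x)%R ->
  {ae mu, forall x, sqnorm (u n x) @[n --> \oo] --> (0 : R)%R} ->
  L2sq mu (u n) @[n --> \oo] --> 0.
Proof.
move=> mu_ hi uh u0.
have [] := @dominated_convergence _ _ _ mu setT measurableT
  (fun n x => (sqnorm (u n x))%:E) (cst 0) (EFin \o h) _ _ _ hi.
- by move=> n; exact: measurable_sqnormE.
- exact: measurable_cst.
- apply: filterS u0 => x ux _; apply: cvg_EFin => //; exact: nearW.
- by apply: aeW => x n _; rewrite /= lee_fin ger0_norm ?sqnorm_ge0.
by move=> _ _; rewrite integral_cst// mul0e.
Qed.

Lemma integrable_indic_lty A : measurable A -> mu A < +oo ->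
  mu.-integrable setT (EFin \o (\1_A : T -> R)).
Proof.
move=> mA Aoo; apply/integrableP; split.
  by apply/measurable_EFinP; exact: measurable_indic.
under eq_integral do rewrite /= ger0_norm//.
by rewrite integral_indic// setIT.
Qed.

Definition cindic (A : set T) : T -> R[i] := fun x => (\1_A x)%:C.

Lemma cmeasurable_cindic A : measurable A -> cmeasurable (cindic A).
Proof. by move=> mA; apply: cmeasurable_real; exact: measurable_indic. Qed.

Lemma sqnorm_cindic A x : sqnorm (cindic A x) = \1_A x.
Proof. by rewrite sqnorm_real indicE; case: (_ \in _); rewrite ?expr1n ?expr0n. Qed.

Lemma L2sq_cindic A : measurable A -> L2sq mu (cindic A) = mu A.
Proof.
move=> mA; rewrite /L2sq; under eq_integral do rewrite sqnorm_cindic.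
by rewrite integral_indic// setIT.
Qed.

Lemma cL12_cindic A : measurable A -> mu A < +oo -> cL12 mu (cindic A).
Proof.
move=> mA Aoo; split; last first.
  by split; [exact: cmeasurable_cindic|rewrite L2sq_cindic].
by split => /=; [exact: integrable_indic_lty|exact: integrable0].
Qed.

Section L2_ind.
Variables (G : set (set T)) (B : nat -> set T) (V : (T -> R[i]) -> Prop).
Hypothesis TG : d.-measurable = <<s G >>.
Hypothesis GI : setI_closed G.
Hypothesis mB : forall n, measurable (B n).
Hypothesis ndB : nondecreasing_seq B.
Hypothesis UB : \bigcup_n B n = setT.
Hypothesis Boo : forall n, mu (B n) < +oo.
Hypothesis VD : forall f g, V f -> V g -> V (f \+ g)%R.
Hypothesis VZ : forall (c : R[i]) f, V f -> V (fun x => c * f x)%R.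
Hypothesis Vlim : forall f, cL2 mu f ->
  (forall e, (0 < e)%R -> exists g,
     [/\ V g, cmeasurable g & L2sq mu (g \- f)%R < e%:E]) -> V f.
Hypothesis VG : forall A n, G A -> V (cindic (A `&` B n)).
Hypothesis VB : forall n, V (cindic (B n)).

(** The indicators of [E n] converge in $L^2$ to that of the union by dominated convergence; the
    dominating function is the indicator of the union, whence the finite measure. *)
Let V_ndcup (E : nat -> set T) : (forall n, measurable (E n)) ->
  nondecreasing_seq E -> mu (\bigcup_n E n) < +oo ->
  (forall n, V (cindic (E n))) -> V (cindic (\bigcup_n E n)).
Proof.
move=> mE ndE Eoo VE; have mU : measurable (\bigcup_n E n).
  exact: bigcupT_measurable.
have [_ L2U] := cL12_cindic mU Eoo.
apply: Vlim => // e e0.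
have : L2sq mu (cindic (E n) \- cindic (\bigcup_n E n))%R @[n --> \oo] --> 0.
  apply: (@L2sq_dominated _ (\1_(\bigcup_n E n))).
  - by move=> n; apply: cmeasurableB; exact: cmeasurable_cindic.
  - exact: integrable_indic_lty.
  - move=> n x; rewrite /cindic /= -raddfB sqnorm_real !indicE.
    have [xE|xE] := boolP (x \in E n); last first.
      by rewrite sub0r sqrrN; case: (x \in _); rewrite ?expr1n ?expr0n.
    rewrite mem_set ?subrr ?expr0n//; exists n => //; exact: set_mem.
  - apply: aeW => x /=; rewrite /cindic.
    have [[k _ Ekx]|nx] := pselect ((\bigcup_n E n) x); last first.
      apply: cvg_near_cst; apply: nearW => n.
      rewrite !indicE !memNset ?subrr ?sqnorm0// => Enx.
      by apply: nx; exists n.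
    apply: cvg_near_cst; near=> n; rewrite !indicE !mem_set ?subrr ?sqnorm0//.
      by exists k.
    have kn : (k <= n)%N by near: n; exists k.
    by move/subsetPset: (ndE _ _ kn); apply.
move=> /(cvge0_lt e0) [N _ /(_ N (leqnn N)) NE].
by exists (cindic (E N)); split => //; exact: cmeasurable_cindic.
Unshelve. all: by end_near. Qed.

(** Dynkin's argument carried out inside a fixed [B n]: every set met has finite measure, and a
    complement becomes a difference of two indicators. *)
Let V_measurable A n : measurable A -> V (cindic (A `&` B n)).
Proof.
rewrite TG; move: A; apply: dynkin_induction => //.
- by rewrite setTI.
- by move=> A GA; exact: VG.
- move=> A mA VA.
  rewrite (_ : cindic _ =
    (cindic (B n) \+ (fun x => (-1) * cindic (A `&` B n) x))%R); last first.
    apply/funext => x; rewrite /cindic /= mulN1r -raddfB; congr (_%:C).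
    rewrite !indicE !in_setI in_setC.
    by case: (x \in A); case: (x \in B n); rewrite /= ?subrr ?subr0.
  by apply: VD; [exact: VB|exact: VZ].
(* The disjoint union is the increasing union of the finite unions [E m], whose indicators are
   finite sums by disjointness. *)
- move=> F mF tF VF; rewrite setI_bigcupl.
  pose E m := \big[setU/set0]_(k < m) (F k `&` B n).
  have EE m : E m = \bigcup_(k < m) (F k `&` B n) by rewrite bigcup_mkord.
  have mFB k : measurable (F k `&` B n) by exact: measurableI.
  have <- : \bigcup_m E m = \bigcup_k (F k `&` B n).
    apply/seteqP; split => x.
      move=> [m _]; rewrite EE => -[k _ Hk]; by exists k.
    move=> [k _ Hk]; exists k.+1 => //; rewrite EE; exists k => //=.
  apply: V_ndcup.
  + by move=> m; apply: bigsetU_measurable => k _.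
  + move=> m p mp; apply/subsetPset; rewrite !EE => x [k /= km Hk];
      exists k => //=; exact: leq_trans km mp.
  + apply: le_lt_trans (Boo n); apply: le_measure; rewrite ?inE//.
      by apply: bigcupT_measurable => m; apply: bigsetU_measurable => k _.
    move=> x [m _]; rewrite EE => -[k _ []//].
  + elim => [|m IH].
      rewrite /E big_ord0 (_ : cindic _ = (fun x => 0 * cindic (B n) x)%R).
        exact/VZ/VB.
      by apply/funext => x; rewrite /cindic indic0 mul0r.
    rewrite /E big_ord_recr/= -/(E m).
    rewrite (_ : cindic _ = (cindic (E m) \+ cindic (F m `&` B n))%R).
      by apply: VD.
    apply/funext => x; rewrite /cindic /= -raddfD; congr (_%:C).
    rewrite !indicE in_setU.
    have [xE|_] := boolP (x \in E m); last by rewrite add0r.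
    suff -> : (x \in F m `&` B n) = false by rewrite orbF addr0.
    apply/negP => /set_mem[Fmx _].
    move/set_mem: xE; rewrite EE => -[k /= km [Fkx _]].
    have kEm : k = m by apply: (tF k m Logic.I Logic.I); exists x.
    by rewrite kEm ltnn in km.
Qed.

Let V_fin A : measurable A -> mu A < +oo -> V (cindic A).
Proof.
move=> mA Aoo; have AE : \bigcup_n (A `&` B n) = A.
  by rewrite -setI_bigcupr UB setIT.
rewrite -AE; apply: V_ndcup.
- by move=> n; exact: measurableI.
- move=> m n mn; apply/subsetPset => x [Ax Bx]; split => //.
  by move: x Bx {Ax}; exact/subsetPset/ndB.
- by rewrite AE.
- by move=> n; exact: V_measurable.
Qed.

Let V0 : V (cst 0%R).
Proof.
rewrite (_ : cst _ = (fun x => 0 * cindic (B 0) x)%R); first exact/VZ/VB.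
by apply/funext => x; rewrite mul0r.
Qed.

Let V_sum (s : seq R) (F : R -> T -> R[i]) : (forall r, r \in s -> V (F r)) ->
  V (fun x => \sum_(r <- s) F r x)%R.
Proof.
elim: s => [_|r s IH H].
  rewrite (_ : (fun x => _) = cst 0%R); first exact: V0.
  by apply/funext => x; rewrite big_nil.
rewrite (_ : (fun x => _) = (F r \+ (fun x => \sum_(r <- s) F r x))%R).
  apply: VD; first by apply: H; rewrite mem_head.
  by apply: IH => k ks; apply: H; rewrite in_cons ks orbT.
by apply/funext => x; rewrite big_cons.
Qed.

Let V_nnsfun (g : {nnsfun T >-> R}) :
  cL2 mu (fun x => (g x)%:C) -> V (fun x => (g x)%:C).
Proof.
move=> [mg g2].
rewrite (_ : (fun x => _) = (fun x => \sum_(r <- finmap.enum_fset (fset_set (range g)))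
    (r%:C * cindic (g @^-1` [set r]) x))%R); last first.
  apply/funext => x; rewrite fimfunE fsbig_finite//= raddf_sum/=.
  by apply: eq_bigr => r _; rewrite rmorphM.
apply: V_sum => r _; have [->|r0] := eqVneq r 0%R.
  by rewrite (_ : (fun x => _) = cst 0%R)//; apply/funext => x; rewrite mul0r.
have mr : measurable (g @^-1` [set r]) by exact: measurable_sfunP.
apply: VZ; apply: V_fin => //.
(* Chebyshev: the squared modulus equals [r ^+ 2] on the level set of [r], so this set has finite
   measure when [r] is nonzero. *)
have r2 : (0 < r ^+ 2)%R by rewrite exprn_even_gt0.
suff : (r ^+ 2)%:E * mu (g @^-1` [set r]) < +oo.
  move=> h; rewrite ltNge leye_eq; apply/negP => /eqP mr_oo.
  by move: h; rewrite mr_oo gt0_muley// lte_fin.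
apply: le_lt_trans g2; rewrite -(L2sq_cindic mr) -(sqnorm_real r) -L2sqZ//; last first.
  exact: cmeasurable_cindic.
apply: le_L2sq => //; first by apply: cmeasurableZ; exact: cmeasurable_cindic.
move=> x; rewrite sqnormM sqnorm_cindic indicE !sqnorm_real.
have [/set_mem <-|_] := boolP (x \in _); first by rewrite mulr1.
by rewrite mulr0 sqr_ge0.
Qed.

Let V_nneg (f : T -> R) : measurable_fun setT f -> (forall x, 0 <= f x)%R ->
  L2sq mu (fun x => (f x)%:C) < +oo -> V (fun x => (f x)%:C).
Proof.
move=> mf f0 f2.
have mF : measurable_fun setT (EFin \o f) by exact/measurable_EFinP.
have L2f : cL2 mu (fun x => (f x)%:C) by split => //; exact: cmeasurable_real.
pose g := nnsfun_approx (@measurableT _ T) mF.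
have gf x : g n x @[n --> \oo] --> f x.
  have /fine_cvgP[_] := @cvg_nnsfun_approx _ _ _ _ (@measurableT _ T) _ mF
    (fun x _ => f0 x) x Logic.I.
  exact.
have g_le n x : (g n x <= f x)%R.
  rewrite -(cvg_lim _ (gf x))//; apply: nondecreasing_cvgn_le.
    by move=> m p mp; exact/lefP/nd_nnsfun_approx.
  by apply/cvg_ex; exists (f x).
have mg n : cmeasurable (fun x => (g n x)%:C : R[i]).
  exact: cmeasurable_real.
have L2g n : cL2 mu (fun x => (g n x)%:C).
  split => //; apply: le_lt_trans f2; apply: le_L2sq => //.
  by move=> x; rewrite !sqnorm_real ler_sqr// nnegrE.
apply: Vlim => // e e0.
have : L2sq mu ((fun x => (g n x)%:C) \- (fun x => (f x)%:C))%R @[n --> \oo] --> 0.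
  apply: (@L2sq_dominated _ (fun x => f x ^+ 2)%R).
  - by move=> n; apply: cmeasurableB; [exact: mg|by case: L2f].
  - apply/integrableP; split.
      by apply/measurable_EFinP; exact: measurable_funX.
    under eq_integral do rewrite /= ger0_norm ?sqr_ge0//.
    by move: f2; rewrite /L2sq; under eq_integral do rewrite sqnorm_real.
  - move=> n x; rewrite /= -raddfB sqnorm_real -sqrrN opprB ler_sqr ?nnegrE//.
      by rewrite gerBl.
    by rewrite subr_ge0.
  - apply: aeW => x; under eq_fun do rewrite /= -raddfB sqnorm_real expr2.
    have gf0 : (g n x - f x)%R @[n --> \oo] --> (0 : R)%R.
      by rewrite -(subrr (f x)); apply: cvgB => //; exact: cvg_cst.
    by have := cvgM gf0 gf0; rewrite mulr0; exact.
move=> /(cvge0_lt e0) [N _ /(_ N (leqnn N)) NE].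
exists (fun x => (g N x)%:C); split => //; exact: V_nnsfun.
Qed.

Let V_real (f : T -> R) : measurable_fun setT f ->
  L2sq mu (fun x => (f x)%:C) < +oo -> V (fun x => (f x)%:C).
Proof.
move=> mf f2; have posneg x : f x = (Num.max (f x) 0 - Num.max (- f x) 0)%R.
  have /orP[f0|f0] := le_total 0%R (f x).
    by rewrite max_l// max_r ?subr0// oppr_le0.
  by rewrite max_r// max_l ?sub0r ?opprK// oppr_ge0.
(* The values 1 and -1 of [s] give the positive and the negative part. *)
have V1 (s : R) (s1 : `|s|%R = 1%R) : V (fun x => (Num.max (s * f x) 0)%:C)%R.
  have mm : measurable_fun setT (fun x => Num.max (s * f x) 0)%R.
    apply: measurable_maxr => //; exact: measurable_funM.
  apply: V_nneg => //; first by move=> x; rewrite le_max lexx orbT.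
  apply: le_lt_trans f2; apply: le_L2sq => //; try exact: cmeasurable_real.
  move=> x; rewrite !sqnorm_real -[leRHS]real_normK ?num_real//.
  rewrite ler_sqr ?nnegrE//; last by rewrite le_max lexx orbT.
  by rewrite ge_max normr_ge0 andbT (le_trans (ler_norm _))// normrM s1 mul1r.
rewrite (_ : (fun x => _) = ((fun x => (Num.max (1 * f x) 0)%:C) \+
   (fun x => (-1) * (Num.max ((-1) * f x) 0)%:C))%R).
  by apply: VD; [apply: V1; rewrite normr1|apply: VZ; apply: V1; rewrite normrN1].
by apply/funext => x /=; rewrite mul1r !mulN1r -raddfB -posneg.
Qed.

(** The principle behind the extension arguments: from the generating family to sets of finite
    measure, then to simple, nonnegative, real and complex functions, each stage being an $L^2$
    limit or a linear combination of the previous one. *)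
Lemma cL2_ind f : cL2 mu f -> V f.
Proof.
move=> [[m1 m2] f2]; have mf : cmeasurable f by [].
rewrite (_ : f = ((fun x => (complex.Re (f x))%:C) \+
                  (fun x => 'i * (complex.Im (f x))%:C))%R); last first.
  by apply/funext => x /=; rewrite -complexE.
apply: VD; [|apply: VZ]; apply: V_real => //; apply: le_lt_trans f2.
  apply: le_L2sq => //.
  by move=> x; rewrite sqnorm_real lerDl sqr_ge0.
apply: le_L2sq => //.
by move=> x; rewrite sqnorm_real lerDr sqr_ge0.
Qed.

End L2_ind.

End density.

(** * Completeness of $L^2$ along fast Cauchy sequences *)

Section L2_completeness.
Context {R : realType}.

(** The hypothesis bounds the increments by the geometric sequence [g k], so the tail from [n] on is
    at most [2 * g n]; squaring gives the factor 4. *)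
Lemma fast_cauchy_cvg (a : nat -> R) (s : R) : 0 <= s ->
  (forall k, 4 ^+ k * (a k.+1 - a k) ^+ 2 <= s) ->
  exists l : R, a n @[n --> \oo] --> l /\
            forall n, (a n - l) ^+ 2 <= 4 * s * (4^-1) ^+ n.
Proof.
move=> s0 H; pose r := Num.sqrt s; pose g n : R := r * 2^-1 ^+ n.
have r0 : 0 <= r by rewrite sqrtr_ge0.
have g0 n : 0 <= g n by rewrite mulr_ge0// exprn_ge0.
have gS n : g n.+1 = g n / 2 by rewrite /g exprSr mulrA.
have gE n : g n ^+ 2 = s * 4^-1 ^+ n.
  rewrite /g exprMn sqr_sqrtr// -exprM mulnC exprM; congr (_ * _ ^+ _).
  by rewrite exprVn -natrX.
have dg k : `|a k.+1 - a k| <= g k.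
  rewrite -ler_sqr ?nnegrE// real_normK ?num_real// gE.
  rewrite exprVn ler_pdivlMr ?exprn_gt0// mulrC; exact: H.
have main n p : `|a (n + p)%N - a n| <= 2 * g n - 2 * g (n + p)%N.
  elim: p => [|p IH]; first by rewrite addn0 !subrr normr0.
  have := dg (n + p)%N; rewrite addnS gS => h.
  rewrite (_ : _ - a n = (a (n + p).+1 - a (n + p)%N) + (a (n + p)%N - a n));
    last by rewrite addrA subrK.
  apply: (le_trans (ler_normD _ _)); move: IH h; lra.
have main' n p : `|a (n + p)%N - a n| <= 2 * g n.
  by apply: (le_trans (main n p)); rewrite gerBl mulr_ge0.
have gcvg : g n @[n --> \oo] --> (0 : R).
  by apply: cvg_geometric; rewrite ger0_norm ?invr_ge0// invf_lt1// ltr1n.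
(* An increment is at least [- g n], while [2 * g n] drops by exactly [g n], so the corrected
   sequence is nondecreasing and monotone convergence applies. *)
have cvg_c : cvgn (fun n => a n - 2 * g n).
  apply: nondecreasing_is_cvgn.
    apply/nondecreasing_seqP => n; have := dg n; rewrite ler_norml gS => /andP[].
    lra.
  exists (a 0%N + 2 * g 0%N) => _ [n _ <-]; have := main' 0%N n; rewrite add0n.
  by rewrite ler_norml => /andP[_]; have := g0 n; lra.
have [l al] : exists l : R, a n @[n --> \oo] --> l.
  exists (limn (fun n => a n - 2 * g n) + 2 * 0).
  rewrite [X in X @ _](_ : _ = fun n => (a n - 2 * g n) + 2 * g n); last first.
    by apply/funext => n; rewrite subrK.
  by apply: cvgD => //; apply: cvgM => //; exact: cvg_cst.
exists l; split=> // n.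
have : `|a n - l| <= 2 * g n.
  have h : (fun p => `|a (n + p)%N - a n|) p @[p --> \oo] --> `|l - a n|.
    apply: cvg_norm; apply: cvgB; last exact: cvg_cst.
    by under eq_fun do rewrite addnC; move: al; rewrite -(cvg_shiftn n).
  by rewrite distrC; apply: (cvgr_to_le h); exact: nearW.
rewrite -(@ler_pXn2r _ 2) ?nnegrE ?mulr_ge0// real_normK ?num_real// => /le_trans.
apply; rewrite exprMn gE -natrX mulrA; lra.
Qed.

Context d (T : measurableType d) (mu : {measure set T -> \bar R}).
Local Open Scope ereal_scope.

(** Riesz-Fischer. Squared increments of integral at most $8^{-k}$ are weighted by $4^k$: the
    weighted sum [S] has integral at most $\sum_k2^{-k}=2$, hence is finite almost everywhere, and
    where it is finite the sequence converges at a rate governed by [S]. *)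
Lemma L2_complete_real (u : nat -> T -> R) :
  (forall n, measurable_fun setT (u n)) ->
  (forall n, \int[mu]_x ((u n.+1 x - u n x) ^+ 2)%:E <= ((8^-1) ^+ n)%:E) ->
  exists g : T -> R, measurable_fun setT g /\
    \int[mu]_x ((u n x - g x) ^+ 2)%:E @[n --> \oo] --> 0.
Proof.
move=> mu_ u8.
pose D k x : \bar R := (4 ^+ k * (u k.+1 x - u k x) ^+ 2)%:E.
have mD k : measurable_fun setT (D k).
  apply/measurable_EFinP; apply: measurable_funM => //.
  by apply: measurable_funX; exact: measurable_funB.
have D0 k x : 0 <= D k x by rewrite /D lee_fin mulr_ge0 ?sqr_ge0 ?exprn_ge0.
pose S x := \sum_(0 <= k <oo) D k x.
have mS : measurable_fun setT S.
  apply: (@ge0_emeasurable_sum _ _ _ setT D xpredT) => [k x _ _|k _].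
    exact: D0.
  exact: mD.
have S0 x : 0 <= S x by apply: nneseries_ge0.
have IS : \int[mu]_x S x <= 2%:E.
  rewrite /S integral_nneseries//.
  apply: lime_le.
    by apply: is_cvg_nneseries => n _ _; apply: integral_ge0.
  apply: nearW => n; apply: (@le_trans _ _ (\sum_(0 <= k < n) ((2^-1) ^+ k)%:E)).
    apply: lee_sum => k _; rewrite /D.
    under eq_integral do rewrite EFinM.
    rewrite ge0_integralZl_EFin//; last 2 first.
    - by move=> x _; rewrite lee_fin sqr_ge0.
    - apply/measurable_EFinP; apply: measurable_funX; exact: measurable_funB.
    apply: (le_trans (lee_wpmul2l _ (u8 k))); first by rewrite lee_fin exprn_ge0.
    rewrite -EFinM lee_fin -exprMn; apply: lerXn2r; rewrite ?nnegrE//; lra.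
  rewrite sumEFin lee_fin.
  have h2 : (0 < 2^-1 :> R)%R by rewrite invr_gt0.
  have h1 : (`|2^-1 : R| < 1)%R by rewrite ger0_norm; lra.
  have := geometric_le_lim n ler01 h2 h1; rewrite /series/=.
  under eq_bigr do rewrite mul1r.
  move=> /le_trans; apply; rewrite ler_pdivrMr; lra.
have iS : mu.-integrable setT S.
  apply/integrableP; split => //.
  under eq_integral do rewrite gee0_abs//.
  exact: le_lt_trans IS (ltry _).
pose A := [set x | S x \is a fin_num].
have mA : measurable A.
  have := emeasurable_fin_num measurableT mS; by rewrite setTI.
have aeA : {ae mu, forall x, A x}.
  by have := integrable_ae measurableT iS; apply: filterS => x; exact.
have cvgA x : A x -> exists l : R, (u n x @[n --> \oo] --> l)%R /\
    (forall n, (u n x - l) ^+ 2 <= 4 * fine (S x) * (4^-1) ^+ n)%R.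
  move=> Ax; apply: fast_cauchy_cvg; first exact: fine_ge0.
  move=> k; rewrite -lee_fin fineK//.
  apply: (le_trans _ (nneseries_lim_ge k.+1 (fun n _ _ => D0 n x))).
  by rewrite big_nat_recr//= leeDr// sume_ge0.
(* With the value 0 off [A], the sequence cut off by the indicator of [A] converges to [g] at every
   point, which yields measurability. *)
pose g x : R := if pselect (A x) is left Ax then sval (cid (cvgA x Ax)) else 0%R.
have gA x : A x -> (u n x @[n --> \oo] --> g x)%R /\
    (forall n, (u n x - g x) ^+ 2 <= 4 * fine (S x) * (4^-1) ^+ n)%R.
  move=> Ax; rewrite /g; case: pselect => // Ax'; by case: cid.
have mg : measurable_fun setT g.
  apply: (@measurable_fun_cvg _ _ _ _ (fun n x => \1_A x * u n x)%R).
    by move=> n; apply: measurable_funM => //; exact: measurable_indic.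
  move=> x _; rewrite indicE.
  have [/set_mem Ax|/negP nA] := boolP (x \in A).
    by under eq_fun do rewrite mul1r; have [] := gA x Ax.
  under eq_fun do rewrite mul0r.
  rewrite /g; case: pselect => [Ax|_]; last exact: cvg_cst.
  by exfalso; apply: nA; rewrite inE.
exists g; split => //.
(* The 8 is the 4 of [fast_cauchy_cvg] times the bound 2 on the integral of [S]. *)
have bound n : \int[mu]_x ((u n x - g x) ^+ 2)%:E <= (8 * (4^-1) ^+ n)%:E.
  apply: (@le_trans _ _ (\int[mu]_x ((4 * (4^-1) ^+ n)%:E * S x))).
    apply: ae_ge0_le_integral => //.
    - by move=> x _; rewrite lee_fin sqr_ge0.
    - apply/measurable_EFinP; apply: measurable_funX; exact: measurable_funB.
    - by move=> x _; rewrite mule_ge0// lee_fin mulr_ge0// exprn_ge0.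
    - exact: measurable_funeM.
    - apply: filterS aeA => x Ax _; have [_ /(_ n)] := gA x Ax.
      rewrite -[in X in _ -> X](@fineK _ (S x))// -EFinM lee_fin => /le_trans; apply.
      by rewrite mulrAC.
  rewrite ge0_integralZl_EFin//.
  apply: (le_trans (lee_wpmul2l _ IS)).
    by rewrite lee_fin mulr_ge0// exprn_ge0.
  by rewrite -EFinM lee_fin mulrAC -natrM.
apply: (@squeeze_cvge _ _ _ _ (cst 0) _ (fun n => (8 * (4^-1) ^+ n)%:E)).
- by apply: nearW => n; rewrite bound andbT integral_ge0// => x _; rewrite lee_fin sqr_ge0.
- exact: cvg_cst.
- apply: cvg_EFin; first exact: nearW.
  by apply: cvg_geometric; rewrite ger0_norm ?invr_ge0// invf_lt1// ltr1n.
Qed.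

Lemma L2_complete (u : nat -> T -> R[i]) :
  (forall n, cmeasurable (u n)) ->
  (forall n, L2sq mu (u n.+1 \- u n)%R <= ((8^-1) ^+ n)%:E) ->
  exists g : T -> R[i], cmeasurable g /\
    L2sq mu (u n \- g)%R @[n --> \oo] --> 0.
Proof.
move=> mu_ u8.
have [g1 [mg1 ug1]] : exists g : T -> R, measurable_fun setT g /\
    \int[mu]_x ((complex.Re (u n x) - g x) ^+ 2)%:E @[n --> \oo] --> 0.
  apply: L2_complete_real; first by move=> n; case: (mu_ n).
  move=> n; apply: le_trans (u8 n); apply: ge0_le_integral => //.
  - by move=> x _; rewrite lee_fin sqr_ge0.
  - apply/measurable_EFinP; apply: measurable_funX; apply: measurable_funB.
      by case: (mu_ n.+1).
    by case: (mu_ n).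
  - by apply: measurable_sqnormE; exact: cmeasurableB.
  - by move=> x _; rewrite lee_fin /sqnorm /= !ReImE lerDl sqr_ge0.
have [g2 [mg2 ug2]] : exists g : T -> R, measurable_fun setT g /\
    \int[mu]_x ((complex.Im (u n x) - g x) ^+ 2)%:E @[n --> \oo] --> 0.
  apply: L2_complete_real; first by move=> n; case: (mu_ n).
  move=> n; apply: le_trans (u8 n); apply: ge0_le_integral => //.
  - by move=> x _; rewrite lee_fin sqr_ge0.
  - apply/measurable_EFinP; apply: measurable_funX; apply: measurable_funB.
      by case: (mu_ n.+1).
    by case: (mu_ n).
  - by apply: measurable_sqnormE; exact: cmeasurableB.
  - by move=> x _; rewrite lee_fin /sqnorm /= !ReImE lerDr sqr_ge0.
exists (fun x => Complex (g1 x) (g2 x)); split => //.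
rewrite [X in X @ _ --> _](_ : _ = fun n =>
  \int[mu]_x ((complex.Re (u n x) - g1 x) ^+ 2)%:E +
  \int[mu]_x ((complex.Im (u n x) - g2 x) ^+ 2)%:E); last first.
  apply/funext => n; have [m1 m2] := mu_ n; rewrite -ge0_integralD//.
  - by apply: eq_integral => x _; rewrite -EFinD /sqnorm /= !ReImE.
  - by move=> x _; rewrite lee_fin sqr_ge0.
  - by apply/measurable_EFinP; apply: measurable_funX; exact: measurable_funB.
  - by move=> x _; rewrite lee_fin sqr_ge0.
  - by apply/measurable_EFinP; apply: measurable_funX; exact: measurable_funB.
by rewrite -[0]adde0; apply: cvgeD.
Qed.

End L2_completeness.

(** * Bounded operators and extension by continuity *)

Section bounded_op.
Context {R : realType} d d' (T : measurableType d) (T' : measurableType d').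
Variables (mu : {measure set T -> \bar R}) (nu : {measure set T' -> \bar R}).
Local Open Scope ereal_scope.

(* F is defined on L^1 \cap L^2 only up to null sets, hence the almost
   everywhere linearity. *)
Record bounded_op (C : R) (F : (T -> R[i]) -> T' -> R[i]) : Prop := BoundedOp {
  bop_ge0 : (0 <= C)%R ;
  bop_measurable : forall f, cL12 mu f -> cmeasurable (F f) ;
  bopD : forall f g, cL12 mu f -> cL12 mu g ->
    {ae nu, forall x, F (f \+ g)%R x = (F f x + F g x)%R} ;
  bopZ : forall (c : R[i]) f, cL12 mu f ->
    {ae nu, forall x, F (fun x => c * f x)%R x = (c * F f x)%R} ;
  bop_le : forall f, cL12 mu f -> L2sq nu (F f) <= C%:E * L2sq mu f }.

Variables (C : R) (F : (T -> R[i]) -> T' -> R[i]).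
Hypothesis bF : bounded_op C F.

Lemma bop_cL2 f : cL12 mu f -> cL2 nu (F f).
Proof.
move=> hf; split; first exact: (bop_measurable bF).
apply: le_lt_trans (bop_le bF hf) _; case: hf => _ [_ f2].
by rewrite lte_mul_pinfty// lee_fin (bop_ge0 bF).
Qed.

(** Additivity and homogeneity hold off null sets, which [L2sq] does not see. *)
Lemma bopB f g : cL12 mu f -> cL12 mu g ->
  L2sq nu (F f \- F g)%R <= C%:E * L2sq mu (f \- g)%R.
Proof.
move=> hf hg; have hn := cL12Z (-1)%R hg.
rewrite (_ : (f \- g)%R = (f \+ (fun x => -1 * g x))%R); last first.
  by apply/funext => x /=; rewrite mulN1r.
apply: le_trans (bop_le bF (cL12D hf hn)); rewrite le_eqVlt; apply/orP; left.
apply/eqP; apply: ae_eq_L2sq.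
- by apply: cmeasurableB; exact: (bop_measurable bF).
- by apply: (bop_measurable bF); exact: cL12D.
have h := bopZ bF (-1)%R hg; apply: filterS2 (bopD bF hf hn) h => x -> /= ->.
by rewrite mulN1r.
Qed.

End bounded_op.

Lemma cL2_fin {R : realType} d (T : measurableType d)
    (mu : {measure set T -> \bar R}) f : cL2 mu f ->
  exists2 r : R, 0 <= r & L2sq mu f = r%:E.
Proof.
move=> [_ f2]; have f0 := L2sq_ge0 mu f.
by exists (fine (L2sq mu f)); rewrite ?fine_ge0// fineK// ge0_fin_numE.
Qed.

Section L2_approximation.
Context {R : realType} d d1 d2 (T : measurableType d) (T1 : measurableType d1)
  (T2 : measurableType d2).
Variables (mu : {measure set T -> \bar R}) (nu : {measure set T1 -> \bar R})
  (rho : {measure set T2 -> \bar R}).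
Local Open Scope ereal_scope.

(* A substitute for B (A f) = D f when B is only given on L^1 \cap L^2, which A
   does not preserve: A h is replaced by a nearby w. *)
Lemma bop_approx (A : (T -> R[i]) -> T1 -> R[i]) (B : (T1 -> R[i]) -> T2 -> R[i])
    (D : (T -> R[i]) -> T2 -> R[i]) (CA CB CD : R)
    (G : set (set T)) (K : nat -> set T) :
  bounded_op mu nu CA A -> bounded_op nu rho CB B -> bounded_op mu rho CD D ->
  d.-measurable = <<s G >> -> setI_closed G ->
  (forall n, measurable (K n)) -> nondecreasing_seq K ->
  \bigcup_n K n = setT -> (forall n, mu (K n) < +oo) ->
  (forall X n e, G X \/ X = setT -> (0 < e)%R -> exists w, [/\ cL12 nu w,
     L2sq nu (w \- A (cindic (X `&` K n)))%R < e%:E &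
     L2sq rho (B w \- D (cindic (X `&` K n)))%R < e%:E]) ->
  forall f, cL2 mu f -> forall e, (0 < e)%R -> exists h w,
    [/\ cL12 mu h, cL12 nu w, L2sq mu (h \- f)%R < e%:E,
        L2sq nu (w \- A h)%R < e%:E & L2sq rho (B w \- D h)%R < e%:E].
Proof.
move=> bA bB bD TG GI mK ndK UK Koo ind f hf.
pose V f := cmeasurable f /\ forall e, (0 < e)%R -> exists h w,
    [/\ cL12 mu h, cL12 nu w, L2sq mu (h \- f)%R < e%:E,
        L2sq nu (w \- A h)%R < e%:E & L2sq rho (B w \- D h)%R < e%:E].
have mG X : G X \/ X = setT -> measurable X.
  by move=> [GX|->//]; rewrite TG; exact: sub_sigma_algebra.
have sum2 (x y : \bar R) e : x < (e / 4)%:E -> y < (e / 4)%:E ->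
    2%:E * x + 2%:E * y < e%:E.
  move=> xe ye; have -> : e%:E = 2%:E * (e / 4)%:E + 2%:E * (e / 4)%:E.
    by rewrite -!EFinM -EFinD; congr EFin; lra.
  by apply: lteD; rewrite lte_pmul2l.
suff : V f by case.
move: f hf; apply: (@cL2_ind _ _ _ mu G K V) => //.
- move=> f g [mf Vf] [mg Vg]; split; first exact: cmeasurableD.
  move=> e e0; have e4 : (0 < e / 4)%R by rewrite divr_gt0.
  have [h1 [w1 [h1L w1L h1f w1h1 Bw1]]] := Vf _ e4.
  have [h2 [w2 [h2L w2L h2g w2h2 Bw2]]] := Vg _ e4.
  have mh1 := cintegrable_measurable h1L.1.
  have mh2 := cintegrable_measurable h2L.1.
  have mw1 := cintegrable_measurable w1L.1.
  have mw2 := cintegrable_measurable w2L.1.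
  have mAh1 := bop_measurable bA h1L; have mAh2 := bop_measurable bA h2L.
  have mDh1 := bop_measurable bD h1L; have mDh2 := bop_measurable bD h2L.
  have mBw1 := bop_measurable bB w1L; have mBw2 := bop_measurable bB w2L.
  have hL := cL12D h1L h2L; have wL := cL12D w1L w2L.
  exists (h1 \+ h2)%R, (w1 \+ w2)%R; split => //.
  + rewrite (_ : (_ \- _)%R = ((h1 \- f) \+ (h2 \- g))%R); last first.
      by apply/funext => x /=; rewrite addrACA opprD.
    apply: (le_lt_trans (L2sqD _ _ _)); try exact: cmeasurableB.
    exact: sum2.
  + rewrite (@ae_eq_L2sq _ _ _ nu _ ((w1 \- A h1) \+ (w2 \- A h2))%R).
    * apply: (le_lt_trans (L2sqD _ _ _)); try exact: cmeasurableB.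
      exact: sum2.
    * apply: cmeasurableB; first exact: cmeasurableD.
      exact: (bop_measurable bA).
    * by apply: cmeasurableD; exact: cmeasurableB.
    * by apply: filterS (bopD bA h1L h2L) => x /= ->; rewrite addrACA opprD.
  + rewrite (@ae_eq_L2sq _ _ _ rho _ ((B w1 \- D h1) \+ (B w2 \- D h2))%R).
    * apply: (le_lt_trans (L2sqD _ _ _)); try exact: cmeasurableB.
      exact: sum2.
    * apply: cmeasurableB; first exact: (bop_measurable bB).
      exact: (bop_measurable bD).
    * by apply: cmeasurableD; exact: cmeasurableB.
    * apply: filterS2 (bopD bB w1L w2L) (bopD bD h1L h2L) => x /= -> ->.
      by rewrite addrACA opprD.
- move=> c f [mf Vf]; split; first exact: cmeasurableZ.
  (* The added 1 keeps the denominator positive when [c] is 0. *)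
  move=> e e0; pose e' := (e / (sqnorm c + 1))%R.
  have c1 : (0 < sqnorm c + 1)%R by rewrite ltr_wpDl// sqnorm_ge0.
  have e'0 : (0 < e')%R by rewrite divr_gt0.
  have sc (x : \bar R) : 0 <= x -> x < e'%:E -> (sqnorm c)%:E * x < e%:E.
    move=> x0 xe; apply: (@le_lt_trans _ _ ((sqnorm c)%:E * e'%:E)).
      by rewrite lee_wpmul2l ?lee_fin ?sqnorm_ge0// ltW.
    rewrite -EFinM lte_fin /e' mulrCA gtr_pMr//.
    by rewrite ltr_pdivrMr// mul1r ltrDl.
  have [h [w [hL wL hf wh Bw]]] := Vf _ e'0.
  have mh := cintegrable_measurable hL.1.
  have mw := cintegrable_measurable wL.1.
  have mAh := bop_measurable bA hL; have mDh := bop_measurable bD hL.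
  have mBw := bop_measurable bB wL.
  have chL := cL12Z c hL; have cwL := cL12Z c wL.
  exists (fun x => c * h x)%R, (fun x => c * w x)%R; split => //.
  + rewrite (_ : (_ \- _)%R = (fun x => c * (h \- f) x)%R); last first.
      by apply/funext => x /=; rewrite mulrBr.
    by rewrite L2sqZ ?sc ?L2sq_ge0//; exact: cmeasurableB.
  + rewrite (@ae_eq_L2sq _ _ _ nu _ (fun x => c * (w \- A h) x)%R).
    * by rewrite L2sqZ ?sc ?L2sq_ge0//; exact: cmeasurableB.
    * apply: cmeasurableB; first exact: cmeasurableZ.
      exact: (bop_measurable bA).
    * by apply: cmeasurableZ; exact: cmeasurableB.
    * by apply: filterS (bopZ bA c hL) => x /= ->; rewrite mulrBr.
  + rewrite (@ae_eq_L2sq _ _ _ rho _ (fun x => c * (B w \- D h) x)%R).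
    * by rewrite L2sqZ ?sc ?L2sq_ge0//; exact: cmeasurableB.
    * apply: cmeasurableB; first exact: (bop_measurable bB).
      exact: (bop_measurable bD).
    * by apply: cmeasurableZ; exact: cmeasurableB.
    * apply: filterS2 (bopZ bB c wL) (bopZ bD c hL) => x /= -> ->.
      by rewrite mulrBr.
(* Only the first of the three estimates mentions [f], so the pair found for the nearby [g] also
   serves [f]. *)
- move=> f [mf _] Vf; split => // e e0.
  have e4 : (0 < e / 4)%R by rewrite divr_gt0.
  have [g [[mg Vg] _ gf]] := Vf _ e4.
  have [h [w [hL wL hg wh Bw]]] := Vg _ e4.
  have mh := cintegrable_measurable hL.1.
  have e4e : (e / 4)%:E <= e%:E by rewrite lee_fin ler_pdivrMr//; lra.
  exists h, w; split => //.
  + by apply: (le_lt_trans (L2sqB mu mh mg mf)); exact: sum2.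
  + exact: lt_le_trans wh e4e.
  + exact: lt_le_trans Bw e4e.
- move=> X n GX; split.
    by apply: cmeasurable_cindic; apply: measurableI => //; apply: mG; left.
  move=> e e0; have [w [wL wA BD]] := ind X n e (or_introl GX) e0.
  exists (cindic (X `&` K n)), w; split => //.
    apply: cL12_cindic; first by apply: measurableI => //; apply: mG; left.
    apply: le_lt_trans (Koo n); apply: le_measure; rewrite ?inE//.
    by apply: measurableI => //; apply: mG; left.
  rewrite (_ : (_ \- _)%R = cst 0%R) ?L2sq_cst0 ?lte_fin//.
  by apply/funext => x /=; rewrite subrr.
- move=> n; split; first exact: cmeasurable_cindic.
  move=> e e0; have [w] := ind setT n e (or_intror erefl) e0.
  rewrite setTI => -[wL wA BD].
  exists (cindic (K n)), w; split => //; first exact: cL12_cindic.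
  rewrite (_ : (_ \- _)%R = cst 0%R) ?L2sq_cst0 ?lte_fin//.
  by apply/funext => x /=; rewrite subrr.
Qed.

End L2_approximation.

(** * The continuous extension from $L^1\cap L^2$ to $L^2$ *)

Section extension.
Context {R : realType} d (T : measurableType d).
Variable mu : {sigma_finite_measure set T -> \bar R}.
Local Open Scope ereal_scope.
Implicit Types f g h : T -> R[i].

(** Truncation to an exhausting sequence of sets of finite measure. A truncation is integrable
    because $|f|\le|f|^2+1$ there. *)
Lemma cL12_dense f e : cL2 mu f -> (0 < e)%R ->
  exists2 h, cL12 mu h & L2sq mu (h \- f)%R < e%:E.
Proof.
move=> [mf f2] e0.
have /sigma_finiteP[E [UE ndE Eoo]] := sigma_finiteT mu.
pose u n x : R[i] := (cindic (E n) x * f x)%R.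
have mE n : measurable (E n) by case: (Eoo n).
have mu_ n : cmeasurable (u n).
  by apply: cmeasurableM => //; exact: cmeasurable_cindic.
have uf n x : (sqnorm (u n x) <= sqnorm (f x))%R.
  rewrite sqnormM sqnorm_cindic indicE.
  by case: (_ \in _); rewrite ?mul1r// mul0r sqnorm_ge0.
have isq : mu.-integrable setT (fun x => (sqnorm (f x))%:E).
  apply/integrableP; split; first exact: measurable_sqnormE.
  by under eq_integral do rewrite gee0_abs ?lee_fin ?sqnorm_ge0//.
have uL n : cL12 mu (u n).
  split; last by split => //; apply: le_lt_trans f2; exact: le_L2sq.
  apply/cintegrableP => //.
  have i1 := integrable_indic_lty (mE n) (Eoo n).2.
  have /integrableP[_] := integrableD measurableT isq i1.
  apply: le_lt_trans; apply: ge0_le_integral => //.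
  - by move=> x _; rewrite lee_fin normc_ge0.
  - by apply/measurable_EFinP; exact: measurable_normc.
  - apply: measurableT_comp => //; apply: emeasurable_funD.
      exact: measurable_sqnormE.
    by apply/measurable_EFinP; exact: measurable_indic.
  - move=> x _; rewrite lee_fin; apply: le_trans (ler_norm _).
    rewrite normc_sqrt sqnormM sqnorm_cindic indicE.
    case: (_ \in _); last by rewrite mul0r sqrtr0 addr0 sqnorm_ge0.
    rewrite mul1r -normc_sqrt -normc_sqr.
    move: (Normc.normc (f x)) (normc_ge0 (f x)) => r r0 /=.
    have := sqr_ge0 (r - 1)%R; rewrite sqrrB1 => ?; have := sqr_ge0 r; lra.
have : L2sq mu (u n \- f)%R @[n --> \oo] --> 0.
  apply: (@L2sq_dominated _ _ _ mu _ (fun x => sqnorm (f x))) => //.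
  - by move=> n; exact: cmeasurableB.
  - move=> n x; rewrite /u /= /cindic indicE.
    by case: (_ \in _); rewrite /= ?mul1r ?subrr ?sqnorm0 ?sqnorm_ge0// mul0r sub0r sqnormN.
  - apply: aeW => x; have : [set: T] x by [].
    rewrite {1}UE => -[k _ Ekx]; apply: cvg_near_cst; near=> n.
    rewrite /= /u /cindic indicE mem_set ?mul1r ?subrr ?sqnorm0//.
    have kn : (k <= n)%N by near: n; exists k.
    by move/subsetPset: (ndE _ _ kn); apply.
move=> /(cvge0_lt e0) [N _ /(_ N (leqnn N)) NE].
by exists (u N).
Unshelve. all: by end_near. Qed.

Lemma cLnorm_ge0 (p : R) f : 0 <= cLnorm mu p f.
Proof. exact: Lnorm_ge0. Qed.

Lemma cLnorm_sqr f : cLnorm mu 2 f * cLnorm mu 2 f = L2sq mu f.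
Proof.
have two0 : (2 : R)%R != 0%R by rewrite pnatr_eq0.
have e2 : (2 = 1 + 1 :> R)%R by rewrite -mulr2n.
have := powR_Lnorm mu (EFin \o @Normc.normc R \o f) two0.
rewrite [X in _ `^ X = _]e2 poweRD ?poweRe1 ?Lnorm_ge0//; last first.
  by rewrite /poweRD_def -e2 (negbTE two0).
move=> ->; apply: eq_integral => x _ /=.
by rewrite powR_mulrn// real_normK ?num_real// normc_sqr.
Qed.

Lemma lty_sqre (x : \bar R) : 0 <= x -> (x * x < +oo) = (x < +oo).
Proof.
by case: x => [r| |]// _; rewrite -EFinM !ltry.
Qed.

Lemma lt_sqre (x : \bar R) (e : R) : 0 <= x -> (0 < e)%R ->
  (x * x < (e ^+ 2)%:E) = (x < e%:E).
Proof.
case: x => [r| |]//; rewrite ?lee_fin => x0 e0.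
by rewrite -EFinM !lte_fin -expr2 ltr_pXn2r// nnegrE// ltW.
Qed.

Lemma cvg_cLnorm (u : nat -> T -> R[i]) :
  cLnorm mu 2 (u n) @[n --> \oo] --> 0 <-> L2sq mu (u n) @[n --> \oo] --> 0.
Proof.
split => h; apply: cvge0P.
- by move=> n; exact: L2sq_ge0.
- move=> e e0; have s0 : (0 < Num.sqrt e)%R by rewrite sqrtr_gt0.
  apply: filterS (cvge0_lt s0 h) => n.
  by rewrite -lt_sqre// ?cLnorm_ge0// cLnorm_sqr sqr_sqrtr// ltW.
- by move=> n; exact: cLnorm_ge0.
- move=> e e0; have s0 : (0 < e ^+ 2)%R by rewrite exprn_gt0.
  apply: filterS (cvge0_lt s0 h) => n.
  by rewrite -cLnorm_sqr lt_sqre// cLnorm_ge0.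
Qed.

Lemma cLfun2P f : cLfun mu 2 f <-> cL2 mu f.
Proof.
rewrite /cL2 -cLnorm_sqr lty_sqre ?cLnorm_ge0//.
by split => [[]|[[]]].
Qed.

Lemma cLfun12P f : cLfun mu 1 f /\ cLfun mu 2 f <-> cL12 mu f.
Proof.
have E : cLnorm mu 1 f = \int[mu]_x (Normc.normc (f x))%:E.
  rewrite /cLnorm Lnorm1; apply: eq_integral => x _ /=.
  by rewrite ger0_norm// normc_ge0.
split=> [[[m1 m2 f1] /cLfun2P f2]|[f1 /cLfun2P f2]]; split => //.
  by apply/cintegrableP => //; rewrite -E.
have [m1 m2] := cintegrable_measurable f1.
by split => //; rewrite E; apply/cintegrableP.
Qed.

Variables (C : R) (F : (T -> R[i]) -> T -> R[i]).
Hypothesis bF : bounded_op mu mu C F.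

(** Two triangle inequalities through an approximant [k] cost a factor 2 each, hence [4 * C]. The
    terms involving [k] add up to at most [(4 * C + 2) * e'], which is [e]. *)
Let bop_limit f g : cL2 mu f -> cL2 mu g ->
  (forall e, (0 < e)%R -> exists h, [/\ cL12 mu h, L2sq mu (h \- f)%R < e%:E &
     L2sq mu (F h \- g)%R < e%:E]) ->
  forall h, cL12 mu h ->
    L2sq mu (F h \- g)%R <= (4 * C)%:E * L2sq mu (h \- f)%R.
Proof.
move=> fL gL H h hL; have C0 := bop_ge0 bF.
apply/lee_addgt0Pr => e e0; pose e' := (e / (4 * C + 2))%R.
have e'0 : (0 < e')%R by rewrite divr_gt0// ltr_wpDl// mulr_ge0.
have [k [kL kf Fk]] := H _ e'0.
have mf := fL.1; have mg := gL.1.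
have mh := cintegrable_measurable hL.1; have mk := cintegrable_measurable kL.1.
have mFh := bop_measurable bF hL; have mFk := bop_measurable bF kL.
have h1 := L2sqB mu mFh mFk mg; have h2 := bopB bF hL kL.
have h3 := L2sqB mu mh mf mk.
move: h1 h2 h3 kf Fk; rewrite (L2sqBC mu f k).
have [a1 a10 ->] := cL2_fin (cL2B (bop_cL2 bF hL) gL).
have [a2 a20 ->] := cL2_fin (cL2B (bop_cL2 bF hL) (bop_cL2 bF kL)).
have [a3 a30 ->] := cL2_fin (cL2B (bop_cL2 bF kL) gL).
have [a4 a40 ->] := cL2_fin (cL2B hL.2 kL.2).
have [a5 a50 ->] := cL2_fin (cL2B hL.2 fL).
have [a6 a60 ->] := cL2_fin (cL2B kL.2 fL).
rewrite -?EFinM -?EFinD ?lee_fin ?lte_fin => h1 h2 h3 h4 h5.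
have : ((4 * C + 2) * e' = e)%R.
  by rewrite /e' mulrCA divff ?mulr1// gt_eqF// ltr_wpDl// mulr_ge0.
move: h1 h2 h3 h4 h5; move: e' {e'0} => e'; nra.
Qed.

(** The defining set of the extension is nonempty by completeness, so [xget] returns a true limit
    and not its default 0. Whichever limit is selected, [bop_limit] measures its distance to [F h]
    by that of [h] to [f]. *)
Lemma L2_extensionP f : cL2 mu f -> cL2 mu (L2_extension mu F f) /\
  forall h, cL12 mu h ->
    L2sq mu (F h \- L2_extension mu F f)%R <= (4 * C)%:E * L2sq mu (h \- f)%R.
Proof.
move=> fL; have C0 := bop_ge0 bF; have mf := fL.1.
(* The rate is chosen so that consecutive [F (h n)] differ in squared norm by at most [4 * C * c n],
   below the $8^{-n}$ that [L2_complete] asks for. *)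
pose c n : R := (8^-1 ^+ n / (4 * (C + 1)))%R.
have C1 : (0 < 4 * (C + 1))%R by rewrite mulr_gt0// ltr_wpDl.
have c0 n : (0 < c n)%R by rewrite divr_gt0// exprn_gt0// invr_gt0.
have /choice[h hP] : forall n, exists h, cL12 mu h /\ L2sq mu (h \- f)%R < (c n)%:E.
  by move=> n; have [h ? ?] := cL12_dense fL (c0 n); exists h.
have hL n := (hP n).1.
have hf : L2sq mu (h n \- f)%R @[n --> \oo] --> 0.
  apply: (@squeeze_cvge _ _ _ _ (cst 0) _ (fun n => (c n)%:E)).
  - by apply: nearW => n; rewrite L2sq_ge0/= ltW// (hP n).2.
  - exact: cvg_cst.
  - apply: cvg_EFin; first exact: nearW.
    rewrite /c; have := @cvg_geometric R (4 * (C + 1))^-1 8^-1.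
    under eq_fun do rewrite mulrC; apply.
    by rewrite ger0_norm ?invr_ge0// invf_lt1// ltr1n.
have [g [mg gF]] : exists g : T -> R[i], cmeasurable g /\
    L2sq mu (F (h n) \- g)%R @[n --> \oo] --> 0.
  apply: L2_complete; first by move=> n; exact: (bop_measurable bF).
  move=> n; apply: (le_trans (bopB bF (hL _) (hL _))).
  have mh k := cintegrable_measurable (hL k).1.
  have h1 := L2sqB mu (mh n.+1) mf (mh n).
  have := hP n.+1; have := hP n; rewrite -(L2sqBC mu f (h n)).
  move: h1.
  have [a1 a10 ->] := cL2_fin (cL2B (hL n.+1).2 (hL n).2).
  have [a2 a20 ->] := cL2_fin (cL2B (hL n.+1).2 fL).
  have [a3 a30 ->] := cL2_fin (cL2B fL (hL n).2).
  rewrite -!EFinM -!EFinD !lee_fin !lte_fin => h1 [_ h2] [_ h3].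
  have cS : (c n.+1 <= c n)%R.
    rewrite /c ler_pM2r ?invr_gt0// exprSr ler_piMr ?exprn_ge0 ?invr_ge0//; lra.
  have cE : (8^-1 ^+ n = 4 * (C + 1) * c n)%R.
    by rewrite /c mulrC divfK// gt_eqF.
  rewrite cE; move: (c n) (c n.+1) h2 h3 cS (c0 n) => x y; nra.
have gL : cL2 mu g.
  split => //; have [n _ /(_ n (leqnn n))] := cvge0_lt ltr01 gF => Fg.
  have mFh := bop_measurable bF (hL n).
  rewrite (_ : g = (F (h n) \- (F (h n) \- g))%R); last first.
    by apply/funext => x /=; rewrite subKr.
  apply: (cL2B (bop_cL2 bF (hL n)) _).2; split; first exact: cmeasurableB.
  exact: lt_trans Fg (ltry _).
have near_g (g' : T -> R[i]) : L2sq mu (F (h n) \- g')%R @[n --> \oo] --> 0 ->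
    forall e, (0 < e)%R -> exists h, [/\ cL12 mu h, L2sq mu (h \- f)%R < e%:E &
     L2sq mu (F h \- g')%R < e%:E].
  move=> g'F e e0; have : \forall n \near \oo, L2sq mu (h n \- f)%R < e%:E /\
      L2sq mu (F (h n) \- g')%R < e%:E.
    by near=> n; split; near: n; exact: cvge0_lt.
  by move=> [n _ /(_ n (leqnn n))[? ?]]; exists (h n).
pose S : set (T -> R[i]) := [set g | cLfun mu 2 g /\
    forall f_ : nat -> T -> R[i],
      (forall k, cLfun mu 1 (f_ k) /\ cLfun mu 2 (f_ k)) ->
      cLnorm mu 2 (f_ k \- f)%R @[k --> \oo] --> 0%E ->
      cLnorm mu 2 (F (f_ k) \- g)%R @[k --> \oo] --> 0%E].
have Sg : S g.
  split; first exact/cLfun2P.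
  move=> k_ /(_ _)/cLfun12P kL /cvg_cLnorm kf; apply/cvg_cLnorm.
  apply: (@squeeze_cvge _ _ _ _ (cst 0) _
    (fun n => (4 * C)%:E * L2sq mu (k_ n \- f)%R)).
  - apply: nearW => n; rewrite L2sq_ge0/=.
    exact: (bop_limit fL gL (near_g g gF) (kL n)).
  - exact: cvg_cst.
  - by rewrite -[0](mule0 (4 * C)%:E); exact: cvgeZl.
(* The limit [g] along [h] lies in [S], so the selected one does too. As [h] is an admissible
   sequence, the selected limit is also approached along it, which is the hypothesis of
   [bop_limit]. *)
have [/cLfun2P g'L g'S] : S (L2_extension mu F f) by apply: xgetPex; exists g.
split => //; apply: bop_limit => //; apply: near_g; apply/cvg_cLnorm.
apply: g'S; first by move=> n; exact/cLfun12P.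
exact/cvg_cLnorm.
Unshelve. all: by end_near. Qed.

End extension.

(** * Product measures *)

Section product_integrals.
Context {R : realType} d d' (S : measurableType d) (T : measurableType d').
Variables (mu : {sigma_finite_measure set S -> \bar R})
          (nu : {sigma_finite_measure set T -> \bar R}).
Local Open Scope ereal_scope.

Let sigma_finite_prod_setT : sigma_finite setT (mu \x nu).
Proof.
have [K [UK ndK Koo]] := (sigma_finiteP _ _).1 (sigma_finiteT mu).
have [L [UL ndL Loo]] := (sigma_finiteP _ _).1 (sigma_finiteT nu).
exists (fun n => K n `*` L n).
  rewrite -setXTT UK UL; apply/seteqP; split => -[x y]; last first.
    by move=> [k _ []/= ? ?]; split; exists k.
  move=> [/= [k _ Kx] [l _ Ly]]; exists (maxn k l) => //; split.
  - by move: x Kx; exact/subsetPset/ndK/leq_maxl.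
  - by move: y Ly; exact/subsetPset/ndL/leq_maxr.
move=> n; have [mK Kn] := Koo n; have [mL Ln] := Loo n.
split; first exact: measurableX.
by rewrite product_measure1E// lte_mul_pinfty ?ge0_fin_numE.
Qed.

(* mu \x nu with its sigma-finite structure, which is not inferred. *)
Definition prod_measure : {sigma_finite_measure set (S * T)%type -> \bar R} :=
  HB.pack_for {sigma_finite_measure set (S * T)%type -> \bar R} (mu \x nu)
    (Measure_isSigmaFinite.Build _ _ _ (mu \x nu) sigma_finite_prod_setT).

Lemma L2sq_prod1 (b : S * T -> R[i]) : cmeasurable b ->
  L2sq (mu \x nu) b = \int[mu]_x L2sq nu (fun y => b (x, y)).
Proof.
move=> mb; rewrite /L2sq fubini_tonelli1//; first exact: measurable_sqnormE.
by move=> x; rewrite lee_fin sqnorm_ge0.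
Qed.

Lemma L2sq_prod2 (b : S * T -> R[i]) : cmeasurable b ->
  L2sq (mu \x nu) b = \int[nu]_y L2sq mu (fun x => b (x, y)).
Proof.
move=> mb; rewrite /L2sq fubini_tonelli2//; first exact: measurable_sqnormE.
by move=> x; rewrite lee_fin sqnorm_ge0.
Qed.

Lemma measurable_L2sq_slice (b : S * T -> R[i]) : cmeasurable b ->
  measurable_fun setT (fun x => L2sq nu (fun y => b (x, y))).
Proof.
move=> mb; apply: (@measurable_fun_fubini_tonelli_F _ _ _ _ _ _
  (fun p => (sqnorm (b p))%:E)); first exact: measurable_sqnormE.
by move=> x; rewrite lee_fin sqnorm_ge0.
Qed.

Lemma measurable_normc_slice (b : S * T -> R[i]) : cmeasurable b ->
  measurable_fun setT (fun x => \int[nu]_y (Normc.normc (b (x, y)))%:E).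
Proof.
move=> mb; apply: (@measurable_fun_fubini_tonelli_F _ _ _ _ _ _
  (fun p => (Normc.normc (b p))%:E)).
  by apply/measurable_EFinP; exact: measurable_normc.
by move=> x; rewrite lee_fin normc_ge0.
Qed.

Lemma cmeasurable_slice (b : S * T -> R[i]) x :
  cmeasurable b -> cmeasurable (fun y => b (x, y)).
Proof. by move=> mb; apply: cmeasurable_comp => //; exact: measurable_pair1. Qed.

(** The slice integral is [fine] of the difference of two Tonelli functions, one for each sign; this
    is measurable in [x] even across slices that are not integrable. *)
Lemma measurable_Rintegral_slice (b : S * T -> R) : measurable_fun setT b ->
  measurable_fun setT (fun x => (\int[nu]_y b (x, y))%R).
Proof.
move=> mb; apply: (measurable_comp (F := setT)) => //.
pose f : S * T -> \bar R := EFin \o b.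
have mf : measurable_fun setT f by exact/measurable_EFinP.
rewrite (_ : (fun x => _) = fun x => fubini_F nu f^\+ x - fubini_F nu f^\- x).
  apply: emeasurable_funB.
    apply: measurable_fun_fubini_tonelli_F => //; exact: measurable_funepos.
  apply: measurable_fun_fubini_tonelli_F => //; exact: measurable_funeneg.
apply/funext => x; rewrite [LHS]integralE /fubini_F.
by congr (_ - _); apply: eq_integral => y _; rewrite ?funeposE ?funenegE.
Qed.

Lemma cmeasurable_cintegral_slice (b : S * T -> R[i]) : cmeasurable b ->
  cmeasurable (fun x => cintegral nu (fun y => b (x, y))).
Proof.
by move=> [m1 m2]; split; [exact: (measurable_Rintegral_slice m1)|
                           exact: (measurable_Rintegral_slice m2)].
Qed.

Lemma cintegrable_slice (b : S * T -> R[i]) : cintegrable (mu \x nu) b ->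
  {ae mu, forall x, cintegrable nu (fun y => b (x, y))}.
Proof.
by move=> [/ae_integrable1 h1 /ae_integrable1]; apply: filterS2 h1 => x ? ?.
Qed.

(** Fubini with inner integrals made real by [fine], which changes nothing at almost every [x],
    where the slice is integrable. *)
Lemma Rintegral_prod1 (b : S * T -> R) : (mu \x nu).-integrable setT (EFin \o b) ->
  (\int[mu \x nu]_p b p = \int[mu]_x \int[nu]_y b (x, y))%R.
Proof.
move=> ib; have mb := measurable_int _ ib; rewrite /Rintegral; congr fine.
rewrite -integral12_prod_meas1//; apply: ae_eq_integral => //.
- exact: (measurable_fubini_F ib).
- apply/measurable_EFinP; apply: measurable_Rintegral_slice.
  exact/measurable_EFinP.
- apply: filterS (ae_integrable1 ib) => x ix _.
  by rewrite /fubini_F fineK// integrable_fin_num.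
Qed.

Lemma cintegral_prod1 (b : S * T -> R[i]) : cintegrable (mu \x nu) b ->
  cintegral (mu \x nu) b = cintegral mu (fun x => cintegral nu (fun y => b (x, y))).
Proof. by move=> [h1 h2]; apply: eq_ReIm; exact: Rintegral_prod1. Qed.

Lemma normc_integral_prod1 (b : S * T -> R[i]) : cmeasurable b ->
  \int[mu \x nu]_p (Normc.normc (b p))%:E =
  \int[mu]_x \int[nu]_y (Normc.normc (b (x, y)))%:E.
Proof.
move=> mb; rewrite fubini_tonelli1//.
  by apply/measurable_EFinP; exact: measurable_normc.
by move=> p; rewrite lee_fin normc_ge0.
Qed.

End product_integrals.

Lemma L2sq_swap {R : realType} d d' (S : measurableType d) (T : measurableType d')
    (mu : {sigma_finite_measure set S -> \bar R})
    (nu : {sigma_finite_measure set T -> \bar R}) (b : S * T -> R[i]) :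
  cmeasurable b -> L2sq (nu \x mu)%E (fun p => b (p.2, p.1)) = L2sq (mu \x nu)%E b.
Proof.
move=> mb; rewrite L2sq_prod1 ?L2sq_prod2//.
by apply: cmeasurable_comp => //; exact: measurable_fun_pair.
Qed.

(** When the modulus has infinite integral the right side is $+\infty$. *)
Lemma normc_cintegral_le' {R : realType} d (T : measurableType d)
    (mu : {measure set T -> \bar R}) (f : T -> R[i]) : cmeasurable f ->
  ((Normc.normc (cintegral mu f))%:E <=
  2%:E * \int[mu]_x (Normc.normc (f x))%:E)%E.
Proof.
move=> mf; have := leey (\int[mu]_x (Normc.normc (f x))%:E)%E.
rewrite le_eqVlt => /predU1P[->|/cintegrableP]; first by rewrite gt0_muley// leey.
by move=> /(_ mf); exact: normc_cintegral_le.
Qed.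

Section tensor.
Context {R : realType} d d' (S : measurableType d) (T : measurableType d').
Variables (mu : {sigma_finite_measure set S -> \bar R})
          (nu : {sigma_finite_measure set T -> \bar R}).
Local Open Scope ereal_scope.
Implicit Types (u : S -> R[i]) (v : T -> R[i]).

Definition tensor u v : S * T -> R[i] := fun p => (u p.1 * v p.2)%R.

Lemma cmeasurable_tensor u v : cmeasurable u -> cmeasurable v ->
  cmeasurable (tensor u v).
Proof.
move=> mu' mv; apply: cmeasurableM.
  by apply: (cmeasurable_comp mu'); exact: measurable_fst.
by apply: (cmeasurable_comp mv); exact: measurable_snd.
Qed.

Lemma L2sq_tensor u v : cmeasurable u -> cmeasurable v ->
  L2sq (mu \x nu) (tensor u v) = L2sq mu u * L2sq nu v.
Proof.
move=> mu' mv; rewrite L2sq_prod1; last exact: cmeasurable_tensor.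
under eq_integral do rewrite /tensor/= L2sqZ// muleC.
rewrite ge0_integralZl ?L2sq_ge0//; first by rewrite muleC.
  exact: measurable_sqnormE.
by move=> x _; rewrite lee_fin sqnorm_ge0.
Qed.

Lemma cintegrable_tensor u v : cintegrable mu u -> cintegrable nu v ->
  cintegrable (mu \x nu) (tensor u v).
Proof.
move=> iu iv; have mu' := cintegrable_measurable iu.
have mv := cintegrable_measurable iv; have muv := cmeasurable_tensor mu' mv.
apply/cintegrableP => //; rewrite normc_integral_prod1//.
under eq_integral => x _.
  under eq_integral do rewrite /tensor/= Normc.normcM EFinM.
  rewrite ge0_integralZl_EFin ?normc_ge0//; last 2 first.
    by move=> y _; rewrite lee_fin normc_ge0.
    by apply/measurable_EFinP; exact: measurable_normc.
  rewrite muleC.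
  over.
rewrite ge0_integralZl//; last 3 first.
- by apply/measurable_EFinP; exact: measurable_normc.
- by move=> x _; rewrite lee_fin normc_ge0.
- by apply: integral_ge0 => x _; rewrite lee_fin normc_ge0.
move/cintegrableP: iu => /(_ mu') hu; move/cintegrableP: iv => /(_ mv) hv.
rewrite lte_mul_pinfty// ?ge0_fin_numE//;
  by apply: integral_ge0 => x _; rewrite lee_fin normc_ge0.
Qed.

Lemma cL2_tensor u v : cL2 mu u -> cL2 nu v -> cL2 (mu \x nu) (tensor u v).
Proof.
move=> [mu' u2] [mv v2]; split; first exact: cmeasurable_tensor.
by rewrite L2sq_tensor// lte_mul_pinfty ?L2sq_ge0// ge0_fin_numE ?L2sq_ge0.
Qed.

Lemma cL12_tensor u v : cL12 mu u -> cL12 nu v -> cL12 (mu \x nu) (tensor u v).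
Proof.
by move=> [? ?] [? ?]; split; [exact: cintegrable_tensor|exact: cL2_tensor].
Qed.

Lemma cintegral_tensor u v : cintegrable mu u -> cintegrable nu v ->
  cintegral (mu \x nu) (tensor u v) = (cintegral mu u * cintegral nu v)%R.
Proof.
move=> iu iv; rewrite cintegral_prod1; last exact: cintegrable_tensor.
rewrite mulrC -cintegralZ//; apply: eq_cintegral => x.
by rewrite mulrC -cintegralZ.
Qed.

Lemma tensor_continuous u0 v0 e : cL2 mu u0 -> cL2 nu v0 -> (0 < e)%R ->
  exists2 r : R, (0 < r)%R & forall u v, cL2 mu u -> cL2 nu v ->
    L2sq mu (u \- u0)%R < r%:E -> L2sq nu (v \- v0)%R < r%:E ->
    L2sq (mu \x nu) (tensor u v \- tensor u0 v0)%R < e%:E.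
Proof.
move=> hu0 hv0 e0; have [a a0 aE] := cL2_fin hu0; have [b b0 bE] := cL2_fin hv0.
(* Write [r] for [e / k]. The summand [e] of [k] gives [r <= 1], so that $\|v\|^2\le2b+2$; the error
   is then at most [(2 * (2 * b + 2) + 2 * a) * r], that is [(k - e) * r], strictly below [k * r],
   which is [e]. *)
pose k := (2 * (2 * b + 2) + 2 * a + e)%R.
have k0 : (0 < k)%R by rewrite /k; lra.
have r0 : (0 < e / k)%R by rewrite divr_gt0.
have r1 : (e / k <= 1)%R by rewrite ler_pdivrMr// mul1r /k; lra.
exists (e / k)%R => // u v hu hv ur vr.
have [mu' mv mu0 mv0] := And4 hu.1 hv.1 hu0.1 hv0.1.
have muv := cmeasurable_tensor mu' mv; have mu0v := cmeasurable_tensor mu0 mv.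
have muv0 := cmeasurable_tensor mu0 mv0.
have := L2sqB (mu \x nu) muv mu0v muv0.
rewrite (_ : (tensor u v \- tensor u0 v)%R = tensor (u \- u0)%R v); last first.
  by apply/funext => p; rewrite /tensor/= mulrBl.
rewrite (_ : (tensor u0 v \- tensor u0 v0)%R = tensor u0 (v \- v0)%R); last first.
  by apply/funext => p; rewrite /tensor/= mulrBr.
rewrite !L2sq_tensor//; try exact: cmeasurableB.
have := L2sqB nu mv mv0 (cmeasurable_cst 0%R).
have subr0f (f : T -> R[i]) : (f \- (fun=> 0))%R = f.
  by apply/funext => x; rewrite /= subr0.
rewrite !subr0f.
move: ur vr; rewrite aE bE.
have [x x0 ->] := cL2_fin (cL2B hu hu0); have [y y0 ->] := cL2_fin (cL2B hv hv0).
have [z z0 ->] := cL2_fin hv.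
rewrite -!EFinM -!EFinD !lee_fin !lte_fin => xr yr zb.
move=> /le_lt_trans; apply; rewrite lte_fin.
have : (k * (e / k) = e)%R by rewrite mulrCA divff ?mulr1// gt_eqF.
move: (e / k)%R r0 r1 xr yr => r r0 r1 xr yr; rewrite /k => er.
have h1 : (x * z <= r * (2 * b + 2))%R.
  apply: ler_pM => //; first exact: ltW.
  lra.
have h2 : (a * y <= a * r)%R by rewrite ler_wpM2l// ltW.
have : (0 < e * r)%R by rewrite mulr_gt0.
nra.
Qed.

Lemma cindic_setX (A : set S) (B : set T) :
  cindic (A `*` B) = tensor (cindic A) (cindic B).
Proof.
apply/funext => p; rewrite /tensor /cindic -rmorphM; congr real_complex_def.
by rewrite !indicE in_setX; case: (_ \in _); rewrite ?mul1r ?mul0r.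
Qed.

End tensor.

(** * Fourier pairs *)

Section kernel_transform_def.
Context {R : realType} d (T : measurableType d).
Variable mu : {measure set T -> \bar R}.
Implicit Types (e : T -> T -> R[i]) (f : T -> R[i]) (c : R).
Local Open Scope complex_scope.

(** The common shape of [fourierL1], of a slice of [fourier2L1] and, through [conjk], of the
    adjoints. *)
Definition ft c e f (y : T) : R[i] :=
  c%:C * cintegral mu (fun x => e y x * f x).

Definition conjk e : T -> T -> R[i] := fun y x => conjc (e y x).

(** A unimodular kernel leaves the modulus of the integrand unchanged, so the transform of an
    integrable function converges absolutely at every point. *)
Record phase e : Prop := Phase {
  phase_measurable : cmeasurable (fun p : T * T => e p.1 p.2) ;
  phase_norm : forall y x, sqnorm (e y x) = 1%R }.

Local Open Scope ereal_scope.

(* A Plancherel bound with an unspecified constant, and Fourier inversion; the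
   latter goes through an approximation w of ft f, which need not be
   integrable. *)
Record fourier_pair (c : R) e (C : R) : Prop := FourierPair {
  fp_phase : phase e ;
  fp_gt0 : (0 < C)%R ;
  fp_le : forall f, cintegrable mu f ->
    L2sq mu (ft c e f) <= C%:E * L2sq mu f ;
  fp_inv : forall f, cL12 mu f -> forall r, (0 < r)%R -> exists w,
    [/\ cL12 mu w, L2sq mu (w \- ft c e f)%R < r%:E &
        L2sq mu (ft c (conjk e) w \- f)%R < r%:E] }.

End kernel_transform_def.

Section kernel_transform.
Context {R : realType} d (T : measurableType d).
Variable mu : {sigma_finite_measure set T -> \bar R}.
Implicit Types (e : T -> T -> R[i]) (f : T -> R[i]) (c : R).
Local Open Scope complex_scope.

Lemma phase_conj e : phase e -> phase (conjk e).
Proof.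
move=> [me ne]; split; first exact: cmeasurableJ.
by move=> y x; rewrite sqnorm_conjc.
Qed.

Section transform_theory.
Variables (c : R) (e : T -> T -> R[i]).
Hypothesis pe : phase e.

Lemma cmeasurable_phase y : cmeasurable (e y).
Proof.
exact: (@cmeasurable_slice _ _ _ _ _ (fun p => e p.1 p.2) y (phase_measurable pe)).
Qed.

Lemma cintegrable_phase y f :
  cintegrable mu f -> cintegrable mu (fun x => e y x * f x).
Proof.
move=> fi; have mf := cintegrable_measurable fi.
apply: (cintegrable_le _ fi).
  by apply: cmeasurableM => //; exact: cmeasurable_phase.
by move=> x; rewrite Normc.normcM (normc_sqrt (e y x)) (phase_norm pe) sqrtr1 mul1r.
Qed.

Lemma cmeasurable_ft f : cmeasurable f -> cmeasurable (ft mu c e f).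
Proof.
move=> mf; apply: cmeasurableZ.
apply: (@cmeasurable_cintegral_slice _ _ _ _ _ mu (fun p => e p.1 p.2 * f p.2)).
apply: cmeasurableM; first exact: (phase_measurable pe).
by apply: (cmeasurable_comp mf); exact: measurable_snd.
Qed.

Lemma ftD f g y : cintegrable mu f -> cintegrable mu g ->
  ft mu c e (f \+ g) y = ft mu c e f y + ft mu c e g y.
Proof.
move=> fi gi; rewrite /ft -mulrDr -cintegralD; try exact: cintegrable_phase.
by congr (_ * _); apply: eq_cintegral => x /=; rewrite mulrDr.
Qed.

Lemma ftZ (k : R[i]) f y : cintegrable mu f ->
  ft mu c e (fun x => k * f x) y = k * ft mu c e f y.
Proof.
move=> fi; rewrite /ft [RHS]mulrCA -(cintegralZ k); last exact: cintegrable_phase.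
by congr (_ * _); apply: eq_cintegral => x /=; rewrite mulrCA.
Qed.

Lemma ft_conj f y : cintegrable mu f ->
  ft mu c (conjk e) f y = conjc (ft mu c e (fun x => conjc (f x)) y).
Proof.
move=> fi; rewrite /ft conjcM conjc_real -cintegralJ; last first.
  by apply: cintegrable_phase; exact: cintegrableJ.
congr (_ * _); apply: eq_cintegral => x.
by rewrite conjcM conjcK.
Qed.

End transform_theory.

Local Open Scope ereal_scope.

Lemma ft_bounded_op c e C : phase e -> (0 < C)%R ->
  (forall f, cintegrable mu f -> L2sq mu (ft mu c e f) <= C%:E * L2sq mu f) ->
  bounded_op mu mu C (ft mu c e).
Proof.
move=> pe C0 Fle; split.
- exact: ltW.
- by move=> f [/cintegrable_measurable ? _]; exact: cmeasurable_ft.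
- by move=> f g [fi _] [gi _]; apply: aeW => x; exact: ftD.
- by move=> k f [fi _]; apply: aeW => x; exact: ftZ.
- by move=> f [fi _]; exact: Fle.
Qed.

(** Conjugating input and output exchanges [e] and [conjk e] and preserves the norms. *)
Lemma ft_conj_le c e C : phase e ->
  (forall f, cintegrable mu f -> L2sq mu (ft mu c e f) <= C%:E * L2sq mu f) ->
  (forall f, cintegrable mu f -> L2sq mu (ft mu c (conjk e) f) <= C%:E * L2sq mu f).
Proof.
move=> pe Fle f fi; have fJ := cintegrableJ fi.
rewrite (_ : L2sq mu (ft _ _ _ _) = L2sq mu (ft mu c e (fun x => conjc (f x)))).
  apply: (le_trans (Fle _ fJ)); rewrite (_ : L2sq mu _ = L2sq mu f)//.
  by apply: eq_integral => x _; rewrite sqnorm_conjc.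
by apply: eq_integral => y _; rewrite ft_conj// sqnorm_conjc.
Qed.

Lemma id_bounded_op : bounded_op mu mu 1 (fun f : T -> R[i] => f).
Proof.
split => //.
- by move=> f [/cintegrable_measurable].
- by move=> f g _ _; exact: aeW.
- by move=> c f _; exact: aeW.
- by move=> f _; rewrite mul1e.
Qed.

(** Inversion is [bop_approx] with the identity as its third operator, so it need only be tested on
    indicators from a generating family. *)
Lemma fourier_pair_dense c e C (G : set (set T)) (K : nat -> set T) :
  phase e -> (0 < C)%R ->
  (forall f, cintegrable mu f -> L2sq mu (ft mu c e f) <= C%:E * L2sq mu f) ->
  d.-measurable = <<s G >> -> setI_closed G ->
  (forall n, measurable (K n)) -> nondecreasing_seq K ->
  \bigcup_n K n = setT -> (forall n, mu (K n) < +oo) ->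
  (forall X n r, G X \/ X = setT -> (0 < r)%R -> exists w, [/\ cL12 mu w,
     L2sq mu (w \- ft mu c e (cindic (X `&` K n)))%R < r%:E &
     L2sq mu (ft mu c (conjk e) w \- cindic (X `&` K n))%R < r%:E]) ->
  fourier_pair mu c e C.
Proof.
move=> pe C0 Fle TG GI mK ndK UK Koo ind; split => // f fL r r0.
have bF := ft_bounded_op pe C0 Fle.
have bF' := ft_bounded_op (phase_conj pe) C0 (ft_conj_le pe Fle).
have C4 : (0 < 4 * (C + 1))%R by rewrite mulr_gt0// addr_gt0.
(* Going back from [h] to [f] costs [2 * r' + 2 * C * r'] for the first estimate and [4 * r'] for
   the second; both stay within [r]. *)
pose r' := (r / (4 * (C + 1)))%R; have r'0 : (0 < r')%R by rewrite divr_gt0.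
have rE : (r = 4 * (C + 1) * r')%R by rewrite /r' mulrC divfK// gt_eqF.
clearbody r'.
have [h [w [hL wL hf wh Bw]]] := bop_approx bF bF' id_bounded_op TG GI mK ndK UK
  Koo ind fL.2 r'0.
have [Fh Ff] := (bop_cL2 bF hL, bop_cL2 bF fL); have Fw := bop_cL2 bF' wL.
have e1 := L2sqB mu wL.2.1 Fh.1 Ff.1; have e2 := bopB bF hL fL.
have e3 := L2sqB mu Fw.1 hL.2.1 fL.2.1.
exists w; split => //.
- apply: (le_lt_trans e1); move: e2 hf wh.
  have [x x0 ->] := cL2_fin (cL2B Fh Ff); have [y y0 ->] := cL2_fin (cL2B hL.2 fL.2).
  have [z z0 ->] := cL2_fin (cL2B wL.2 Fh).
  rewrite -!EFinM -!EFinD !lee_fin !lte_fin => e2 hf wh.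
  rewrite rE; nra.
- apply: (le_lt_trans e3); move: hf Bw.
  have [x x0 ->] := cL2_fin (cL2B hL.2 fL.2); have [y y0 ->] := cL2_fin (cL2B Fw hL.2).
  rewrite -!EFinM -!EFinD !lte_fin => hf Bw.
  rewrite rE; nra.
Qed.

End kernel_transform.

Section tensor_transform.
Context {R : realType} d d' (S : measurableType d) (T : measurableType d').
Variables (mu : {sigma_finite_measure set S -> \bar R})
          (nu : {sigma_finite_measure set T -> \bar R}).
Local Open Scope ereal_scope.

(** The one-variable bound is applied on almost every slice and integrated by Tonelli. *)
Lemma partial_ft_le (c : R) (e : T -> T -> R[i]) (C : R) (b : S * T -> R[i]) :
  fourier_pair nu c e C -> cmeasurable b ->
  {ae mu, forall x, cintegrable nu (fun y => b (x, y))} ->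
  cmeasurable (fun p => ft nu c e (fun y => b (p.1, y)) p.2) /\
  L2sq (mu \x nu) (fun p => ft nu c e (fun y => b (p.1, y)) p.2) <=
  C%:E * L2sq (mu \x nu) b.
Proof.
move=> [pe C0 Fle _] mb ib.
have mF : cmeasurable (fun p : S * T => ft nu c e (fun y => b (p.1, y)) p.2).
  apply: cmeasurableZ.
  apply: (@cmeasurable_cintegral_slice _ _ _ _ _ nu
    (fun q : (S * T) * T => e q.1.2 q.2 * b (q.1.1, q.2))%R).
  apply: cmeasurableM.
    apply: (@cmeasurable_comp _ _ _ _ _ _ (fun q : (S * T) * T => (q.1.2, q.2))
      (phase_measurable pe)).
    apply: measurable_fun_pair => //.
    exact: (measurableT_comp measurable_snd measurable_fst).
  apply: (cmeasurable_comp mb); apply: measurable_fun_pair => //.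
  exact: (measurableT_comp measurable_fst measurable_fst).
split => //; rewrite !L2sq_prod1// -ge0_integralZl_EFin//; last 3 first.
- by move=> x _; exact: L2sq_ge0.
- exact: measurable_L2sq_slice.
- exact: ltW.
apply: ae_ge0_le_integral => //.
- by move=> x _; exact: L2sq_ge0.
- exact: (measurable_L2sq_slice _ mF).
- by move=> x _; rewrite mule_ge0 ?L2sq_ge0// lee_fin ltW.
- by apply: measurable_funeM; exact: measurable_L2sq_slice.
(* Of a slice only integrability is known here, which is why [fp_le] asks for [cintegrable] alone
   and tolerates an infinite right side. *)
- by apply: filterS ib => x ix _; exact: (Fle (fun y => b (x, y)) ix).
Qed.

Definition tensork (e : S -> S -> R[i]) (e' : T -> T -> R[i]) :
  S * T -> S * T -> R[i] := fun p q => (e p.1 q.1 * e' p.2 q.2)%R.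

Lemma conjk_tensork e e' : conjk (tensork e e') = tensork (conjk e) (conjk e').
Proof. by apply/funext => p; apply/funext => q; rewrite /conjk conjcM. Qed.

Lemma phase_tensork e e' : phase e -> phase e' -> phase (tensork e e').
Proof.
move=> [me ne] [me' ne']; split; last first.
  by move=> p q; rewrite sqnormM ne ne' mulr1.
apply: cmeasurableM.
  apply: (@cmeasurable_comp _ _ _ _ _ _
    (fun q : (S * T) * (S * T) => (q.1.1, q.2.1)) me).
  apply: measurable_fun_pair => /=.
    exact: (measurableT_comp measurable_fst measurable_fst).
  exact: (measurableT_comp measurable_fst measurable_snd).
apply: (@cmeasurable_comp _ _ _ _ _ _
  (fun q : (S * T) * (S * T) => (q.1.2, q.2.2)) me').
apply: measurable_fun_pair => /=.
  exact: (measurableT_comp measurable_snd measurable_fst).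
exact: (measurableT_comp measurable_snd measurable_snd).
Qed.

Lemma ft_tensor (c c' : R) (e : S -> S -> R[i]) (e' : T -> T -> R[i]) u v : phase e -> phase e' ->
  cintegrable mu u -> cintegrable nu v ->
  ft (mu \x nu) (c * c')%R (tensork e e') (tensor u v) =
  tensor (ft mu c e u) (ft nu c' e' v).
Proof.
move=> pe pe' iu iv; apply/funext => p; rewrite /ft /tensor rmorphM/= mulrACA.
congr (_ * _)%R; rewrite -cintegral_tensor; try exact: cintegrable_phase.
by apply: eq_cintegral => q; rewrite /tensork/tensor mulrACA.
Qed.

End tensor_transform.

Section tensor_fourier_pair.
Context {R : realType} d d' (S : measurableType d) (T : measurableType d').
Variables (mu : {sigma_finite_measure set S -> \bar R})
          (nu : {sigma_finite_measure set T -> \bar R}).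
Variables (c c' C C' : R) (e : S -> S -> R[i]) (e' : T -> T -> R[i]).
Hypothesis he : fourier_pair mu c e C.
Hypothesis he' : fourier_pair nu c' e' C'.
Local Open Scope ereal_scope.

Let munu := prod_measure mu nu.

Let I (b : S * T -> R[i]) (y' : T) (x : S) : R[i] :=
  cintegral nu (fun y => e' y' y * b (x, y))%R.

Let cmeasurable_I b y' : cmeasurable b -> cmeasurable (I b y').
Proof.
move=> mb.
apply: (@cmeasurable_cintegral_slice _ _ _ _ _ nu (fun p => e' y' p.2 * b p)%R).
apply: cmeasurableM => //.
exact: (cmeasurable_comp (cmeasurable_phase (fp_phase he') y') measurable_snd).
Qed.

(** The modulus of the partial integral is at most $2\int|b(x,y)|\,dy$, integrable in [x] by
    Tonelli. The bound does not depend on [y'], so the conclusion holds at every [y']. *)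
Let cintegrable_I b y' : cintegrable (mu \x nu) b -> cintegrable mu (I b y').
Proof.
move=> ib; have mb := cintegrable_measurable ib.
have mI := cmeasurable_I y' mb; apply/cintegrableP => //.
have mF := measurable_normc_slice nu mb.
apply: (@le_lt_trans _ _
  (\int[mu]_x (2%:E * \int[nu]_y (Normc.normc (b (x, y)))%:E))).
  apply: ge0_le_integral => //.
  - by move=> x _; rewrite lee_fin normc_ge0.
  - by apply/measurable_EFinP; exact: measurable_normc.
  - exact: measurable_funeM.
  - move=> x _; have mex := cmeasurable_phase (fp_phase he') y'.
    apply: le_trans (normc_cintegral_le' nu _) _.
      by apply: cmeasurableM => //; exact: cmeasurable_slice.
    rewrite le_eqVlt; apply/orP; left; apply/eqP; congr (_ * _).
    apply: eq_integral => y _.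
    rewrite Normc.normcM (normc_sqrt (e' y' y)) (phase_norm (fp_phase he')).
    by rewrite sqrtr1 mul1r.
rewrite ge0_integralZl_EFin//; last first.
  by move=> x _; apply: integral_ge0 => y _; rewrite lee_fin normc_ge0.
rewrite -(normc_integral_prod1 mu nu mb) lte_mul_pinfty//.
by apply/cintegrableP.
Qed.

Let ft_iterated b p : cintegrable (mu \x nu) b ->
  ft (mu \x nu) (c * c')%R (tensork e e') b p =
  ft mu c e (fun x => ft nu c' e' (fun y => b (x, y)) p.2) p.1.
Proof.
move=> ib; have mb := cintegrable_measurable ib.
have pe := fp_phase he; have pe' := fp_phase he'.
have iI := cintegrable_I p.2 ib.
rewrite /ft (_ : cintegral mu _ =
    cintegral mu (fun x => (real_complex_def (Phant R) c') * (e p.1 x * I b p.2 x))%R); last first.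
  by apply: eq_cintegral => x; rewrite mulrCA.
rewrite cintegralZ; last exact: cintegrable_phase.
rewrite mulrA -rmorphM; congr (_ * _)%R.
have iZ : cintegrable (mu \x nu) _ :=
  cintegrable_phase (mu := munu) (phase_tensork pe pe') p ib.
rewrite cintegral_prod1//; apply: ae_eq_cintegral.
- exact: (cmeasurable_cintegral_slice nu (cintegrable_measurable iZ)).
- exact: (cintegrable_measurable (cintegrable_phase pe p.1 iI)).
- apply: filterS (cintegrable_slice ib) => x ix.
  rewrite /I -cintegralZ; last exact: cintegrable_phase.
  by apply: eq_cintegral => y; rewrite /tensork/= mulrA.
Qed.

(** The transform is the composition of two partial ones, bounded by [C'] and [C]. The variables are
    swapped in between because [partial_ft_le] acts on the second one. *)
Lemma ft_tensork_le b : cintegrable (mu \x nu) b ->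
  L2sq (mu \x nu) (ft (mu \x nu) (c * c')%R (tensork e e') b) <=
  (C * C')%:E * L2sq (mu \x nu) b.
Proof.
move=> ib; have mb := cintegrable_measurable ib.
pose g (p : S * T) : R[i] := ft nu c' e' (fun y => b (p.1, y)) p.2.
have [mg g_le] := partial_ft_le he' mb (cintegrable_slice ib).
pose g' (p : T * S) := g (p.2, p.1).
have mg' : cmeasurable g'.
  by apply: cmeasurable_comp => //; exact: measurable_fun_pair.
have ig' : {ae nu, forall y, cintegrable mu (fun x => g' (y, x))}.
  by apply: aeW => y; apply: cintegrableZ; exact: cintegrable_I.
have [mG G_le] := partial_ft_le he mg' ig'.
rewrite (_ : ft _ _ _ b = fun p =>
    (fun q => ft mu c e (fun x => g' (q.1, x)) q.2) (p.2, p.1)); last first.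
  by apply/funext => p; rewrite ft_iterated.
rewrite (L2sq_swap nu mu mG); apply: (le_trans G_le).
by rewrite (L2sq_swap mu nu mg) EFinM -muleA lee_wpmul2l// lee_fin ltW// (fp_gt0 he).
Qed.

(** The indicator of a rectangle is a tensor, and so is its transform. Approximants [w1], [w2] of
    the factors give [tensor w1 w2], and [tensor_continuous] combines the two pairs of estimates;
    [fourier_pair_dense] does the rest. *)
Lemma fourier_pair_tensor :
  fourier_pair (mu \x nu) (c * c')%R (tensork e e') (C * C')%R.
Proof.
have pe := fp_phase he; have pe' := fp_phase he'.
have [K [UK ndK Koo]] := (sigma_finiteP _ _).1 (sigma_finiteT mu).
have [L [UL ndL Loo]] := (sigma_finiteP _ _).1 (sigma_finiteT nu).
have b1 : bounded_op mu mu C (ft mu c e).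
  by apply: ft_bounded_op; [|exact: (fp_gt0 he)|exact: (fp_le he)].
have b2 : bounded_op nu nu C' (ft nu c' e').
  by apply: ft_bounded_op; [|exact: (fp_gt0 he')|exact: (fp_le he')].
have b1' : bounded_op mu mu C (ft mu c (conjk e)).
  apply: ft_bounded_op; [exact: phase_conj|exact: (fp_gt0 he)|].
  by apply: ft_conj_le => //; exact: (fp_le he).
have b2' : bounded_op nu nu C' (ft nu c' (conjk e')).
  apply: ft_bounded_op; [exact: phase_conj|exact: (fp_gt0 he')|].
  by apply: ft_conj_le => //; exact: (fp_le he').
have rect A n B m r : measurable A -> measurable B -> (0 < r)%R ->
  exists w, [/\ cL12 (mu \x nu) w,
     L2sq (mu \x nu) (w \- ft (mu \x nu) (c * c')%R (tensork e e')
       (cindic ((A `&` K n) `*` (B `&` L m))))%R < r%:E &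
     L2sq (mu \x nu) (ft (mu \x nu) (c * c')%R (conjk (tensork e e')) w \-
       cindic ((A `&` K n) `*` (B `&` L m)))%R < r%:E].
  move=> mA mB r0.
  have hA : cL12 mu (cindic (A `&` K n)).
    apply: cL12_cindic; first by apply: measurableI => //; exact: (Koo n).1.
    apply: le_lt_trans (Koo n).2; apply: le_measure; rewrite ?inE//.
      by apply: measurableI => //; exact: (Koo n).1.
    exact: (Koo n).1.
  have hB : cL12 nu (cindic (B `&` L m)).
    apply: cL12_cindic; first by apply: measurableI => //; exact: (Loo m).1.
    apply: le_lt_trans (Loo m).2; apply: le_measure; rewrite ?inE//.
      by apply: measurableI => //; exact: (Loo m).1.
    exact: (Loo m).1.
  rewrite cindic_setX; set u := cindic _ in hA *; set v := cindic _ in hB *.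
  have [r1 r10 H1] := tensor_continuous (bop_cL2 b1 hA) (bop_cL2 b2 hB) r0.
  have [r2 r20 H2] := tensor_continuous hA.2 hB.2 r0.
  have r12 : (0 < Num.min r1 r2)%R by rewrite lt_min r10.
  have min1 : (Num.min r1 r2)%:E <= r1%:E by rewrite lee_fin ge_min lexx.
  have min2 : (Num.min r1 r2)%:E <= r2%:E by rewrite lee_fin ge_min lexx orbT.
  have [w1 [w1L w1u Bw1]] := fp_inv he hA r12.
  have [w2 [w2L w2u Bw2]] := fp_inv he' hB r12.
  exists (tensor w1 w2); split; first exact: cL12_tensor.
  - rewrite ft_tensor//; [|by case: hA|by case: hB].
    apply: H1; [by case: w1L|by case: w2L|exact: lt_le_trans w1u min1|].
    exact: lt_le_trans w2u min1.
  - rewrite conjk_tensork ft_tensor; [|exact: phase_conj|exact: phase_conj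
      |by case: w1L|by case: w2L].
    apply: H2; [exact: (bop_cL2 b1' w1L)|exact: (bop_cL2 b2' w2L)|exact: lt_le_trans Bw1 min2|].
    exact: lt_le_trans Bw2 min2.
apply: (@fourier_pair_dense _ _ _ munu _ _ _
  [set A `*` B | A in measurable & B in measurable] (fun n => K n `*` L n)).
- exact: phase_tensork.
- by rewrite mulr_gt0// ?(fp_gt0 he) ?(fp_gt0 he').
- exact: ft_tensork_le.
- exact: measurable_prod_measurableType.
- move=> _ _ [A1 mA1 [B1 mB1 <-]] [A2 mA2 [B2 mB2 <-]].
  exists (A1 `&` A2); first exact: measurableI.
  by exists (B1 `&` B2); [exact: measurableI|rewrite setXI].
- by move=> n; apply: measurableX; [exact: (Koo n).1|exact: (Loo n).1].
- move=> m n mn; apply/subsetPset => -[x y] [/= Kx Ly]; split => /=.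
    by move: x Kx; exact/subsetPset/ndK.
  by move: y Ly; exact/subsetPset/ndL.
- rewrite -setXTT UK UL; apply/seteqP; split => -[x y].
    by move=> [k _ []/= ? ?]; split; exists k.
  move=> [/= [k _ Fkx] [l _ Gly]]; exists (maxn k l) => //; split.
  + by move: x Fkx; exact/subsetPset/ndK/leq_maxl.
  + by move: y Gly; exact/subsetPset/ndL/leq_maxr.
- move=> n; rewrite [X in X < _](_ : _ = mu (K n) * nu (L n)); last first.
    by apply: product_measure1E; [exact: (Koo n).1|exact: (Loo n).1].
  by rewrite lte_mul_pinfty ?ge0_fin_numE//; [exact: (Koo n).2|exact: (Loo n).2].
- move=> X n r [[A mA [B mB <-]]|->] r0.
    by rewrite -setXI; exact: rect.
  rewrite -setXTT -setXI; exact: rect.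
Qed.

End tensor_fourier_pair.

(** * Transport of integrals and Fourier pairs along an image measure *)

Section transport.
Context {R : realType} d d' (S : measurableType d) (T : measurableType d').
Variables (mu : {sigma_finite_measure set S -> \bar R})
          (nu : {sigma_finite_measure set T -> \bar R}) (phi : S -> T).
Hypothesis mphi : measurable_fun setT phi.
Hypothesis nuE : forall A, measurable A -> nu A = mu (phi @^-1` A).
Local Open Scope ereal_scope.

Lemma integral_transport (f : T -> \bar R) : measurable_fun setT f ->
  \int[nu]_y f y = \int[mu]_x f (phi x).
Proof.
have ge0 (g : T -> \bar R) : measurable_fun setT g -> (forall y, 0 <= g y) ->
    \int[nu]_y g y = \int[mu]_x g (phi x).
  move=> mg g0; rewrite -(@ge0_integral_pushforward _ _ _ _ _ _ mphi mu setT)//.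
  by apply: eq_measure_integral => A mA _; exact: nuE.
move=> mf; rewrite integralE [RHS]integralE; congr (_ - _).
  rewrite ge0//; last exact: measurable_funepos.
  by apply: eq_integral => x _; rewrite !funeposE.
rewrite ge0//; last exact: measurable_funeneg.
by apply: eq_integral => x _; rewrite !funenegE.
Qed.

Lemma L2sq_transport (f : T -> R[i]) : cmeasurable f ->
  L2sq nu f = L2sq mu (fun x => f (phi x)).
Proof. by move=> mf; rewrite /L2sq integral_transport//; exact: measurable_sqnormE. Qed.

Lemma cintegral_transport (f : T -> R[i]) : cmeasurable f ->
  cintegral nu f = cintegral mu (fun x => f (phi x)).
Proof.
by move=> [m1 m2]; apply: eq_ReIm; rewrite /= /Rintegral integral_transport//;
  exact/measurable_EFinP.
Qed.

Lemma cintegrable_transport (f : T -> R[i]) : cmeasurable f ->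
  cintegrable nu f <-> cintegrable mu (fun x => f (phi x)).
Proof.
move=> mf; have mf' := cmeasurable_comp mf mphi.
by rewrite !cintegrableP// integral_transport//;
  apply/measurable_EFinP; exact: measurable_normc.
Qed.

Lemma cL12_transport (f : T -> R[i]) : cmeasurable f ->
  cL12 nu f <-> cL12 mu (fun x => f (phi x)).
Proof.
move=> mf; have mf' := cmeasurable_comp mf mphi.
rewrite /cL12 /cL2 L2sq_transport//; split => -[h1 [h2 h3]]; split => //.
  exact/(cintegrable_transport mf).
exact/(cintegrable_transport mf).
Qed.

Variables (psi : T -> S).
Hypothesis mpsi : measurable_fun setT psi.
Hypothesis phiK : cancel phi psi.

(** Integrals against [nu] see only values at points [phi x], where [psi (phi x)] is [x]; at these
    points the transported transform is the original one ([ftE]). *)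
Lemma fourier_pair_transport (c C : R) (e : S -> S -> R[i]) :
  fourier_pair mu c e C ->
  fourier_pair nu c (fun y x => e (psi y) (psi x)) C.
Proof.
move=> [pe C0 Fle Finv].
have pe' : phase (fun y x => e (psi y) (psi x)).
  split; last by move=> y x; exact: (phase_norm pe).
  apply: (@cmeasurable_comp _ _ _ _ _ _ (fun q : T * T => (psi q.1, psi q.2))
    (phase_measurable pe)).
  apply: measurable_fun_pair.
    exact: (measurableT_comp mpsi measurable_fst).
  exact: (measurableT_comp mpsi measurable_snd).
have ftE k (pk : phase k) f x : cmeasurable f ->
    ft nu c (fun y x => k (psi y) (psi x)) f (phi x) =
    ft mu c k (fun x => f (phi x)) x.
  move=> mf; rewrite /ft cintegral_transport; last first.
    apply: cmeasurableM => //.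
    exact: (cmeasurable_comp (cmeasurable_phase pk (psi (phi x))) mpsi).
  congr (_ * _)%R; apply: eq_cintegral => y; by rewrite !phiK.
split => //.
- move=> f fi; have mf := cintegrable_measurable fi.
  rewrite !L2sq_transport//; last exact: (cmeasurable_ft _ _ pe').
  under eq_fun do rewrite ftE//.
  by apply: Fle; exact/(cintegrable_transport mf).
- move=> f fL r r0; have mf := fL.2.1.
  have [w [wL wf Bw]] := Finv _ ((cL12_transport mf).1 fL) r r0.
  have mw : cmeasurable (fun y => w (psi y)).
    by apply: cmeasurable_comp => //; case: wL => _ [].
  have wE : (fun x => w (psi (phi x))) = w by apply/funext => x; rewrite phiK.
  exists (fun y => w (psi y)); split.
  + by apply/cL12_transport => //; rewrite wE.
  + rewrite L2sq_transport; last first.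
      by apply: cmeasurableB => //; exact: (cmeasurable_ft _ _ pe').
    under eq_fun => x do rewrite /= ftE// phiK.
    exact: wf.
  + rewrite L2sq_transport; last first.
      apply: cmeasurableB => //.
      exact: (cmeasurable_ft _ _ (phase_conj pe')).
    have ftE' := ftE _ (phase_conj pe) (fun y => w (psi y)).
    under eq_fun => x do rewrite /= ftE'// wE.
    exact: Bw.
Qed.

End transport.

(** * Summability kernels *)

Section fubini_swap.
Context {R : realType} d d' (S : measurableType d) (T : measurableType d').
Variables (mu : {sigma_finite_measure set S -> \bar R})
          (nu : {sigma_finite_measure set T -> \bar R}).
Local Open Scope ereal_scope.

Lemma Rintegral_prod2 (b : S * T -> R) : (mu \x nu).-integrable setT (EFin \o b) ->
  (\int[mu \x nu]_p b p = \int[nu]_y \int[mu]_x b (x, y))%R.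
Proof.
move=> ib; have mb := measurable_int _ ib; rewrite /Rintegral; congr fine.
rewrite -integral21_prod_meas1//; apply: ae_eq_integral => //.
- exact: (measurable_fubini_G ib).
- apply/measurable_EFinP.
  apply: (measurable_Rintegral_slice mu (b := fun p => b (p.2, p.1))).
  have : measurable_fun setT b by exact/measurable_EFinP.
  move=> mb'; apply: (measurableT_comp mb').
  exact: measurable_fun_pair.
- apply: filterS (ae_integrable2 ib) => x ix _.
  by rewrite /fubini_G fineK// integrable_fin_num.
Qed.

Lemma cintegral_prod2 (b : S * T -> R[i]) : cintegrable (mu \x nu) b ->
  cintegral (mu \x nu) b = cintegral nu (fun y => cintegral mu (fun x => b (x, y))).
Proof. by move=> [h1 h2]; apply: eq_ReIm; exact: Rintegral_prod2. Qed.

Lemma cintegral_swap (b : S * T -> R[i]) : cintegrable (mu \x nu) b ->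
  cintegral mu (fun x => cintegral nu (fun y => b (x, y))) =
  cintegral nu (fun y => cintegral mu (fun x => b (x, y))).
Proof. by move=> ib; rewrite -cintegral_prod1// cintegral_prod2. Qed.

End fubini_swap.

Section fatou_bound.
Context {R : realType} d (T : measurableType d) (mu : {measure set T -> \bar R}).
Local Open Scope ereal_scope.

(** Fatou's lemma, after replacing [f] by the lower limit of the sequence, with which it agrees
    almost everywhere. *)
Lemma fatou_bound (u : nat -> T -> R) (f : T -> R) (K : \bar R) :
  (forall n, measurable_fun setT (u n)) -> measurable_fun setT f ->
  (forall n x, 0 <= u n x)%R -> (forall x, 0 <= f x)%R ->
  {ae mu, forall x, (u n x @[n --> \oo] --> f x)%R} ->
  (forall n, \int[mu]_x (u n x)%:E <= K) -> \int[mu]_x (f x)%:E <= K.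
Proof.
move=> mu_ mf u0 f0 uf uK.
have mE n : measurable_fun setT (fun x => (u n x)%:E) by exact/measurable_EFinP.
have mfE : measurable_fun setT (fun x => (f x)%:E) by exact/measurable_EFinP.
have u0' n x : setT x -> 0 <= (u n x)%:E by move=> _; rewrite lee_fin.
have limE x : (u n x @[n --> \oo] --> f x)%R ->
    limn_einf (fun n => (u n x)%:E) = (f x)%:E.
  move=> ux; have h : (u n x)%:E @[n --> \oo] --> (f x)%:E.
    by apply: cvg_EFin => //; exact: nearW.
  by rewrite is_cvg_limn_einfE; [exact: cvg_lim|apply/cvg_ex; exists (f x)%:E].
rewrite (@ae_eq_integral _ _ _ mu setT (fun x => limn_einf (fun n => (u n x)%:E)))//.
- apply: (le_trans (fatou mu measurableT mE u0')).
  rewrite limn_einf_lim; apply: lime_le; first exact: is_cvg_einfs.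
  apply: nearW => n; apply: le_trans (uK n).
  by apply: ereal_inf_lbound; exists n => /=.
- under eq_fun => x do rewrite -[limn_einf _]oppeK -limn_esupN.
  apply: measurableT_comp => //; apply: measurable_fun_limn_esup => n.
  exact: measurableT_comp.
- by apply: filterS uf => x ux _; rewrite limE.
Qed.

End fatou_bound.

Section complex_cvg.
Context {R : realType}.
Implicit Types (u : nat -> R[i]) (l : R[i]).

Definition ccvg u l :=
  (complex.Re (u n) @[n --> \oo] --> complex.Re l) /\
  (complex.Im (u n) @[n --> \oo] --> complex.Im l).

Lemma ccvg_shift u l N : ccvg u l -> ccvg (fun n => u (N + n)%N) l.
Proof.
move=> [u1 u2]; split; under eq_fun do rewrite addnC.
  by move: u1; rewrite -(cvg_shiftn N).
by move: u2; rewrite -(cvg_shiftn N).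
Qed.

Lemma sqnorm_cvg (z : R[i]) u l : ccvg u l ->
  sqnorm (z - u n) @[n --> \oo] --> sqnorm (z - l).
Proof.
move=> [u1 u2]; rewrite /sqnorm !ReImE.
under eq_fun do rewrite !ReImE; rewrite !expr2.
under eq_fun do rewrite !expr2.
by apply: cvgD; apply: cvgM; apply: cvgB => //; exact: cvg_cst.
Qed.

End complex_cvg.

Section summability_kernel.
Context {R : realType} d (T : measurableType d).
Variable mu : {sigma_finite_measure set T -> \bar R}.
Variables (c M : R) (e : T -> T -> R[i]) (G : nat -> T -> R).
Hypothesis pe : phase e.
Hypothesis esym : forall y x, e y x = e x y.
Hypothesis M0 : 0 < M.
Hypothesis iG : forall n, mu.-integrable setT (EFin \o G n).
Hypothesis G0 : forall n y, 0 <= G n y.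
Hypothesis G1 : forall n y, G n y <= 1.
Hypothesis cvgG : forall y, G n y @[n --> \oo] --> (1 : R).
Local Open Scope complex_scope.

(** Up to the order of its arguments, the kernel of the transform followed by multiplication by
    [G n] and by the adjoint transform, see [adjoint_sumk]. The hypothesis [HM] bounds the mass of
    its rows uniformly in [n]. *)
Definition sumk n x x' : R[i] :=
  cintegral mu (fun y => (G n y)%:C * (e y x * conjc (e y x'))).

Hypothesis HM : forall n x,
  (\int[mu]_x' (Normc.normc (sumk n x x'))%:E <= M%:E)%E.

Let mG n : measurable_fun setT (G n).
Proof. exact/measurable_EFinP/(measurable_int mu (iG n)). Qed.

Let cG n : cintegrable mu (fun y => (G n y)%:C).
Proof. by split => /=; [exact: (iG n)|exact: integrable0]. Qed.

Let normc_e y x : Normc.normc (e y x) = 1.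
Proof. by rewrite normc_sqrt (phase_norm pe) sqrtr1. Qed.

Let normc_conj (z : R[i]) : Normc.normc (conjc z) = Normc.normc z.
Proof. by rewrite !normc_sqrt sqnorm_conjc. Qed.

Let normc_G n y : Normc.normc (G n y)%:C = G n y.
Proof. by rewrite normc_sqrt sqnorm_real sqrtr_sqr ger0_norm. Qed.

Lemma cmeasurable_sumk n : cmeasurable (fun p : T * T => sumk n p.1 p.2).
Proof.
apply: (@cmeasurable_cintegral_slice _ _ _ _ _ mu
  (fun q : (T * T) * T => (G n q.2)%:C * (e q.2 q.1.1 * conjc (e q.2 q.1.2)))).
apply: cmeasurableM.
  apply: cmeasurable_real; exact: (measurableT_comp (mG n) measurable_snd).
apply: cmeasurableM; [|apply: cmeasurableJ].
  apply: (@cmeasurable_comp _ _ _ _ _ _ (fun q : (T * T) * T => (q.2, q.1.1))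
    (phase_measurable pe)).
  apply: measurable_fun_pair => //.
  exact: (measurableT_comp measurable_fst measurable_fst).
apply: (@cmeasurable_comp _ _ _ _ _ _ (fun q : (T * T) * T => (q.2, q.1.2))
  (phase_measurable pe)).
apply: measurable_fun_pair => //.
exact: (measurableT_comp measurable_snd measurable_fst).
Qed.

Let iGf n f x : cintegrable mu f -> cintegrable (mu \x mu)%E
  (fun p => (G n p.1)%:C * conjc (e p.1 x) * (e p.1 p.2 * f p.2)).
Proof.
move=> fi; have mf := cintegrable_measurable fi.
apply: (cintegrable_le _ (cintegrable_tensor (cG n) fi)).
  apply: cmeasurableM; apply: cmeasurableM.
  - apply: cmeasurable_real; exact: (measurableT_comp (mG n) measurable_fst).
  - apply: cmeasurableJ.
    have mex : cmeasurable (fun y => e y x).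
      apply: (@cmeasurable_comp _ _ _ _ _ _ (fun y : T => (y, x))
        (phase_measurable pe)).
      exact: measurable_fun_pair.
    exact: (cmeasurable_comp mex measurable_fst).
  - exact: (phase_measurable pe).
  - exact: (cmeasurable_comp mf measurable_snd).
move=> p; rewrite /tensor !Normc.normcM normc_conj !normc_e mulr1 mul1r//.
Qed.

(** The weight licenses Fubini: the integrand has modulus $G_n(y)|f(x')|$, integrable on the
    product, which $|f(x')|$ alone is not in general. *)
Lemma adjoint_sumk n f x : cintegrable mu f ->
  cintegral mu (fun y => conjc (e y x) *
    ((G n y)%:C * cintegral mu (fun x' => e y x' * f x'))) =
  cintegral mu (fun x' => sumk n x' x * f x').
Proof.
move=> fi.
transitivity (cintegral mu (fun y => cintegral mu (fun x' =>
    (G n y)%:C * conjc (e y x) * (e y x' * f x')))).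
  apply: eq_cintegral => y; rewrite cintegralZ; last exact: cintegrable_phase.
  by rewrite mulrCA mulrA.
rewrite (cintegral_swap (iGf n x fi)); apply: eq_cintegral => x' /=.
rewrite mulrC /sumk -cintegralZ.
  by apply: eq_cintegral => y; ring.
apply: (cintegrable_le _ (cG n)).
  apply: cmeasurableM; first by apply: cmeasurable_real.
  apply: cmeasurableM; [|apply: cmeasurableJ].
    apply: (@cmeasurable_comp _ _ _ _ _ _ (fun y : T => (y, x'))
        (phase_measurable pe)); exact: measurable_fun_pair.
  apply: (@cmeasurable_comp _ _ _ _ _ _ (fun y : T => (y, x))
        (phase_measurable pe)); exact: measurable_fun_pair.
by move=> y; rewrite !Normc.normcM normc_conj !normc_e !mulr1.
Qed.

Let isumk n x x' :
  cintegrable mu (fun y => (G n y)%:C * (e y x * conjc (e y x'))).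
Proof.
apply: (cintegrable_le _ (cG n)).
  apply: cmeasurableM; first by apply: cmeasurable_real.
  apply: cmeasurableM; [|apply: cmeasurableJ].
    apply: (@cmeasurable_comp _ _ _ _ _ _ (fun y : T => (y, x))
        (phase_measurable pe)); exact: measurable_fun_pair.
  apply: (@cmeasurable_comp _ _ _ _ _ _ (fun y : T => (y, x'))
        (phase_measurable pe)); exact: measurable_fun_pair.
by move=> y; rewrite !Normc.normcM normc_conj !normc_e !mulr1.
Qed.

Lemma sumk_sym n x x' : sumk n x x' = conjc (sumk n x' x).
Proof.
rewrite /sumk -cintegralJ; last exact: isumk.
apply: eq_cintegral => y.
by rewrite !conjcM conjcK conjc_real [X in _ * X = _]mulrC.
Qed.

Let If (f : T -> R[i]) y := cintegral mu (fun x => e y x * f x).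

Let cmeasurable_If f : cmeasurable f -> cmeasurable (If f).
Proof.
move=> mf; have := cmeasurable_ft mu 1 pe mf; rewrite /ft.
by under eq_fun do rewrite mul1r.
Qed.

Let If_bound f : cintegrable mu f ->
  exists2 B, 0 <= B & forall y, Normc.normc (If f y) <= B.
Proof.
move=> fi; have mf := cintegrable_measurable fi.
have foo := (cintegrableP mu mf).1 fi.
have I0 : (0 <= \int[mu]_x (Normc.normc (f x))%:E)%E.
  by apply: integral_ge0 => x _; rewrite lee_fin normc_ge0.
exists (fine (2%:E * \int[mu]_x (Normc.normc (f x))%:E)%E).
  by rewrite fine_ge0// mule_ge0.
move=> y; rewrite -lee_fin fineK; last first.
  by rewrite ge0_fin_numE ?mule_ge0// lte_mul_pinfty.
apply: (le_trans (normc_cintegral_le (cintegrable_phase pe y fi))).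
by under eq_integral do rewrite Normc.normcM normc_e mul1r.
Qed.

Let iGJ n f : cintegrable mu f ->
  cintegrable mu (fun y => (G n y)%:C * conjc (If f y)).
Proof.
move=> fi; have [B B0 HB] := If_bound fi.
have mI := cmeasurable_If (cintegrable_measurable fi).
apply: (cintegrable_le _ (cintegrableZ B%:C (cG n))).
  by apply: cmeasurableM; [exact: cmeasurable_real|exact: cmeasurableJ].
move=> y; rewrite !Normc.normcM normc_conj normc_G mulrC ler_wpM2r//.
by rewrite (le_trans (HB y))// normc_sqrt sqnorm_real sqrtr_sqr ler_norm.
Qed.

(** Expanding one of the two copies of the transform and exchanging the integrals moves it across
    the pairing, where it meets the other copy as [adjoint_sumk]. *)
Let quadE n f : cintegrable mu f ->
  cintegral mu (fun y => (G n y * sqnorm (If f y))%:C) =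
  cintegral mu (fun x => f x *
    conjc (cintegral mu (fun x' => sumk n x' x * f x'))).
Proof.
move=> fi; have mf := cintegrable_measurable fi.
have mI := cmeasurable_If mf.
transitivity (cintegral mu (fun y => cintegral mu (fun x =>
    ((G n y)%:C * conjc (If f y)) * (e y x * f x)))).
  apply: eq_cintegral => y; rewrite cintegralZ; last exact: cintegrable_phase.
  rewrite rmorphM -mulrA; congr (_ * _).
  by apply: eq_ReIm; rewrite !ReImE /sqnorm /If /=; ring.
have ik : cintegrable (mu \x mu)%E (fun p =>
    ((G n p.1)%:C * conjc (If f p.1)) * (e p.1 p.2 * f p.2)).
  apply: (cintegrable_le _ (cintegrable_tensor (iGJ n fi) fi)).
    apply: cmeasurableM.
      exact: (cmeasurable_comp (cintegrable_measurable (iGJ n fi)) measurable_fst).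
    apply: cmeasurableM; first exact: (phase_measurable pe).
    exact: (cmeasurable_comp mf measurable_snd).
  by move=> p; rewrite /tensor !Normc.normcM normc_e mul1r.
rewrite (cintegral_swap ik); apply: eq_cintegral => x; rewrite -adjoint_sumk//.
rewrite -cintegralJ; last first.
  apply: (cintegrable_le _ (cintegrableJ (iGJ n fi))).
    apply: cmeasurableM.
      apply: cmeasurableJ; apply: (@cmeasurable_comp _ _ _ _ _ _ (fun y : T => (y, x))
        (phase_measurable pe)); exact: measurable_fun_pair.
    by apply: cmeasurableM => //; exact: cmeasurable_real.
  by move=> y; rewrite !normc_conj !Normc.normcM !normc_conj normc_e mul1r.
rewrite -cintegralZ.
  apply: eq_cintegral => y; rewrite !conjcM conjcK conjc_real /If.
  by ring.
apply: (cintegrable_le _ (cintegrableJ (iGJ n fi))).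
  apply: cmeasurableJ; apply: cmeasurableM.
    apply: cmeasurableJ; apply: (@cmeasurable_comp _ _ _ _ _ _ (fun y : T => (y, x))
      (phase_measurable pe)); exact: measurable_fun_pair.
  by apply: cmeasurableM => //; exact: cmeasurable_real.
by move=> y; rewrite !normc_conj !Normc.normcM !normc_conj normc_e mul1r.
Qed.

Local Open Scope ereal_scope.

(** Schur's test. Two bounds on the modulus of a complex integral give the 4 in [Phi]; the
    inequality $4hh'N\le2h^2N+2h'^2N$ splits it into two terms, and the row bound, with the symmetry
    of $|{\rm sumk}|$, makes each at most [2 * M] times the squared norm. *)
Lemma schur_quad n f : cintegrable mu f ->
  \int[mu]_y (G n y * sqnorm (If f y))%:E <= (4 * M)%:E * L2sq mu f.
Proof.
move=> fi; have mf := cintegrable_measurable fi; have mI := cmeasurable_If mf.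
pose h x := Normc.normc (f x); pose N x x' := Normc.normc (sumk n x x').
have h0 x : (0 <= h x)%R by exact: normc_ge0.
have N0 x x' : (0 <= N x x')%R by exact: normc_ge0.
have mh : measurable_fun setT h by exact: measurable_normc.
have mN : measurable_fun setT (fun p : T * T => N p.2 p.1).
  have m' := measurable_normc (cmeasurable_sumk n).
  have sw : measurable_fun setT (fun p : T * T => (p.2, p.1)).
    exact: measurable_fun_pair.
  exact: (measurableT_comp m' sw).
have Nsym x x' : N x x' = N x' x by rewrite /N sumk_sym normc_conj.
pose P x := cintegral mu (fun x' => sumk n x' x * f x')%R.
have mss : cmeasurable (fun p : T * T => (sumk n p.2 p.1 * f p.2)%R).
  apply: cmeasurableM; last exact: (cmeasurable_comp mf measurable_snd).
  apply: (@cmeasurable_comp _ _ _ _ _ _ (fun p : T * T => (p.2, p.1))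
    (cmeasurable_sumk n)); exact: measurable_fun_pair.
have mP : cmeasurable P by exact: (cmeasurable_cintegral_slice mu mss).
have mhN : measurable_fun setT (fun p : T * T => (h p.2 * N p.2 p.1)%R).
  apply: measurable_funM => //; exact: (measurableT_comp mh measurable_snd).
have P_le x : (Normc.normc (P x))%:E <=
    2%:E * \int[mu]_x' (h x' * N x' x)%:E.
  apply: le_trans (normc_cintegral_le' mu (cmeasurable_slice x mss)) _.
  rewrite le_eqVlt; apply/orP; left; apply/eqP; congr (_ * _).
  by apply: eq_integral => x' _; rewrite Normc.normcM mulrC.
have q0 y : (0 <= G n y * sqnorm (If f y))%R by rewrite mulr_ge0// sqnorm_ge0.
(* Integrability, from the boundedness of the transform, lets the extended integral be read off the
   real part of a [cintegral], where [fine] would hide an infinite value. *)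
have iq : mu.-integrable setT (fun y => (G n y * sqnorm (If f y))%:E).
  have [B B0 HB] := If_bound fi.
  have := (cintegrableZ (B ^+ 2)%:C%C (cG n)).1.
  apply: le_integrable => //.
    by apply/measurable_EFinP; apply: measurable_funM => //; exact: measurable_sqnorm.
  move=> y _; rewrite !ReImE /= mul0r subr0 lee_fin ger0_norm// mulrC.
  rewrite ger0_norm; last by rewrite mulr_ge0// sqr_ge0.
  by rewrite ler_wpM2r// -normc_sqr ler_sqr ?nnegrE// normc_ge0.
have -> : \int[mu]_y (G n y * sqnorm (If f y))%:E =
    (complex.Re (cintegral mu (fun y => (G n y * sqnorm (If f y))%:C%C)))%:E.
  by rewrite /= /Rintegral fineK// integrable_fin_num.
rewrite quadE//.
have mfP : cmeasurable (fun x => f x * conjc (P x))%R.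
  by apply: cmeasurableM => //; exact: cmeasurableJ.
apply: (@le_trans _ _ (Normc.normc (cintegral mu (fun x => f x * conjc (P x))%R))%:E).
  by rewrite lee_fin (le_trans (ler_norm _))// normr_Re_le.
apply: (le_trans (normc_cintegral_le' mu mfP)).
pose Phi (p : T * T) := (4 * (h p.1 * (h p.2 * N p.2 p.1)))%R.
have mPhi : measurable_fun setT (fun p => (Phi p)%:E).
  apply/measurable_EFinP; apply: measurable_funM => //; apply: measurable_funM => //.
  exact: (measurableT_comp mh measurable_fst).
have Phi0 p : 0 <= (Phi p)%:E by rewrite lee_fin !mulr_ge0.
apply: (@le_trans _ _ (\int[mu \x mu]_p (Phi p)%:E)).
  rewrite fubini_tonelli1// -ge0_integralZl_EFin//; last 2 first.
  - by move=> x _; rewrite lee_fin normc_ge0.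
  - by apply/measurable_EFinP; exact: measurable_normc.
  apply: ge0_le_integral => //.
  - by move=> x _; rewrite mule_ge0// lee_fin normc_ge0.
  - by apply: measurable_funeM; apply/measurable_EFinP; exact: measurable_normc.
  - exact: (measurable_fun_fubini_tonelli_F (fun p => (Phi p)%:E)).
  - move=> x _; rewrite Normc.normcM normc_conj -/(h x) /fubini_F.
    rewrite [leRHS](_ : _ = 2%:E * ((h x)%:E *
        (2%:E * \int[mu]_x' (h x' * N x' x)%:E))); last first.
      have mx : measurable_fun setT (fun x' => (h x' * N x' x)%:E).
        apply/measurable_EFinP.
        exact: (measurableT_comp mhN (measurable_pair1 x)).
      have hN0 x' : setT x' -> 0 <= (h x' * N x' x)%:E.
        by move=> _; rewrite lee_fin mulr_ge0.
      rewrite -ge0_integralZl_EFin// -ge0_integralZl_EFin//; last 2 first.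
      - by move=> x' _; rewrite mule_ge0// hN0.
      - exact: measurable_funeM.
      rewrite -ge0_integralZl_EFin//; last 2 first.
      - by move=> x' _; rewrite mule_ge0 ?lee_fin// mulr_ge0// mulr_ge0.
      - by apply: measurable_funeM; exact: measurable_funeM.
      apply: eq_integral => x' _; rewrite -!EFinM /Phi/=; congr EFin; ring.
    by rewrite lee_wpmul2l// EFinM lee_wpmul2l// lee_fin.
have mA : measurable_fun setT (fun p : T * T => (2 * h p.1 ^+ 2 * N p.2 p.1)%:E).
  apply/measurable_EFinP; apply: measurable_funM => //; apply: measurable_funM => //.
  apply: measurable_funX; exact: (measurableT_comp mh measurable_fst).
have mB : measurable_fun setT (fun p : T * T => (2 * h p.2 ^+ 2 * N p.2 p.1)%:E).
  apply/measurable_EFinP; apply: measurable_funM => //; apply: measurable_funM => //.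
  apply: measurable_funX; exact: (measurableT_comp mh measurable_snd).
have A0 (p : T * T) : 0 <= (2 * h p.1 ^+ 2 * N p.2 p.1)%:E.
  by rewrite lee_fin !mulr_ge0// sqr_ge0.
have B0 (p : T * T) : 0 <= (2 * h p.2 ^+ 2 * N p.2 p.1)%:E.
  by rewrite lee_fin !mulr_ge0// sqr_ge0.
apply: (@le_trans _ _ (\int[mu \x mu]_p
    ((2 * h p.1 ^+ 2 * N p.2 p.1)%:E + (2 * h p.2 ^+ 2 * N p.2 p.1)%:E))).
  apply: ge0_le_integral => //; first exact: emeasurable_funD.
  move=> p _; rewrite -EFinD lee_fin /Phi -mulrDl mulrA mulrA [leLHS]mulrAC.
  rewrite mulrAC -subr_ge0 -mulrBl mulr_ge0//.
  rewrite (_ : _ - _ = 2 * (h p.1 - h p.2) ^+ 2)%R; last by ring.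
  by rewrite mulr_ge0// sqr_ge0.
rewrite ge0_integralD//.
have L2h : L2sq mu f = \int[mu]_x (h x ^+ 2)%:E.
  by apply: eq_integral => x _; rewrite /h normc_sqr.
have key (k : T -> T -> R) (mk : forall x, measurable_fun setT (k x))
    (k0 : forall x y, (0 <= k x y)%R) (kM : forall x, \int[mu]_y (k x y)%:E <= M%:E)
    (mkh : measurable_fun setT (fun x => \int[mu]_y (2 * h x ^+ 2 * k x y)%:E)) :
    \int[mu]_x \int[mu]_y (2 * h x ^+ 2 * k x y)%:E <= (2 * M)%:E * L2sq mu f.
  rewrite L2h -ge0_integralZl_EFin//; last 3 first.
  - by move=> x _; rewrite lee_fin sqr_ge0.
  - by apply/measurable_EFinP; exact: measurable_funX.
  - by rewrite mulr_ge0// ltW.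
  apply: ge0_le_integral => //.
  - by move=> x _; apply: integral_ge0 => y _; rewrite lee_fin !mulr_ge0// sqr_ge0.
  - by apply: measurable_funeM; apply/measurable_EFinP; exact: measurable_funX.
  - move=> x _; under eq_integral do rewrite EFinM.
    rewrite ge0_integralZl_EFin//; last 3 first.
    + by move=> y _; rewrite lee_fin.
    + exact/measurable_EFinP.
    + by rewrite mulr_ge0// sqr_ge0.
    rewrite -EFinM (_ : (2 * M * h x ^+ 2)%:E = (2 * h x ^+ 2)%:E * M%:E); last first.
      by rewrite -EFinM; congr EFin; ring.
    by rewrite lee_wpmul2l// lee_fin mulr_ge0// sqr_ge0.
rewrite (_ : (4 * M)%:E = (2 * M)%:E + (2 * M)%:E); last first.
  by rewrite -EFinD; congr EFin; ring.
rewrite ge0_muleDl ?lee_fin ?mulr_ge0 ?(ltW M0)//.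
apply: leeD.
  rewrite fubini_tonelli1//; apply: (key (fun x y => N y x)) => //.
  - by move=> x; exact: (measurableT_comp mN (measurable_pair1 x)).
  - by move=> x; under eq_integral do rewrite Nsym; exact: HM.
  - exact: (measurable_fun_fubini_tonelli_F _ mA A0).
rewrite fubini_tonelli2//; apply: (key N) => //.
- move=> x; rewrite (_ : N x = fun y => N y x); last exact/funext/Nsym.
  exact: (measurableT_comp mN (measurable_pair1 x)).
- by move=> x; exact: HM.
- exact: (measurable_fun_fubini_tonelli_G _ mB B0).
Qed.

(** The weights tend to 1 and [schur_quad] is uniform in [n], so Fatou removes the weight. *)
Lemma schur_le f : cintegrable mu f ->
  L2sq mu (ft mu c e f) <= (c ^+ 2 * (4 * M))%:E * L2sq mu f.
Proof.
move=> fi; have mf := cintegrable_measurable fi.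
have mI := cmeasurable_If mf.
rewrite /ft L2sqZ// sqnorm_real (EFinM (c ^+ 2)) -muleA lee_wpmul2l//.
  by rewrite lee_fin sqr_ge0.
apply: (@fatou_bound _ _ _ mu (fun n y => G n y * sqnorm (If f y))%R).
- by move=> n; apply: measurable_funM => //; exact: measurable_sqnorm.
- exact: measurable_sqnorm.
- by move=> n x; rewrite mulr_ge0// sqnorm_ge0.
- by move=> x; exact: sqnorm_ge0.
- apply: aeW => x; rewrite -[X in _ --> X]mul1r.
  by apply: cvgM => //; exact: cvg_cst.
- by move=> n; exact: schur_quad.
Qed.

(** The approximants are the weighted transforms [w n]: integrable, because the transform is bounded
    and [G n] integrable, and convergent to the transform in $L^2$. Their adjoint images converge to
    [f] almost everywhere by hypothesis; being Cauchy in $L^2$ by the Schur bound, they also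
    converge to it in $L^2$. *)
Lemma summable_inv f r : (0 < r)%R -> cL12 mu f ->
  {ae mu, forall x, ccvg (fun n =>
     (c ^+ 2)%:C%C * cintegral mu (fun x' => sumk n x' x * f x'))%R (f x)} ->
  exists w, [/\ cL12 mu w, L2sq mu (w \- ft mu c e f)%R < r%:E &
        L2sq mu (ft mu c (conjk e) w \- f)%R < r%:E].
Proof.
move=> r0 fL cvgf; have [fi [mf f2]] := fL.
have [B B0 HB] := If_bound fi; have mI := cmeasurable_If mf.
have mft := cmeasurable_ft mu c pe mf.
pose C := (c ^+ 2 * (4 * M))%R.
have C0 : (0 <= C)%R by rewrite mulr_ge0 ?sqr_ge0// mulr_ge0// ltW.
have ft2 : L2sq mu (ft mu c e f) < +oo.
  by apply: (le_lt_trans (schur_le fi)); rewrite lte_mul_pinfty.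
pose w n y : R[i] := ((G n y)%:C%C * ft mu c e f y)%R.
have mw n : cmeasurable (w n).
  by apply: cmeasurableM => //; exact: cmeasurable_real.
have wi n : cintegrable mu (w n).
  apply: (cintegrable_le _ (cintegrableZ (`|c| * B)%:C%C (cG n))) => // y.
  rewrite /w /ft !Normc.normcM normc_G mulrC ler_wpM2r//.
  rewrite !(normc_sqrt (_%:C)%C) !sqnorm_real !sqrtr_sqr normrM normr_id.
  by rewrite (ger0_norm B0) ler_wpM2l// HB.
have w_le n x : (sqnorm (w n x) <= sqnorm (ft mu c e f x))%R.
  rewrite sqnormM sqnorm_real ler_piMl ?sqnorm_ge0//.
  by rewrite exprn_ile1.
have wL n : cL12 mu (w n).
  by split => //; split => //; apply: le_lt_trans ft2; exact: le_L2sq.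
have wcvg : L2sq mu (w n \- ft mu c e f)%R @[n --> \oo] --> 0.
  apply: (@L2sq_dominated _ _ _ mu _ (fun x => sqnorm (ft mu c e f x))).
  - by move=> n; exact: cmeasurableB.
  - apply/integrableP; split; first exact: measurable_sqnormE.
    by under eq_integral do rewrite gee0_abs ?lee_fin ?sqnorm_ge0//.
  - move=> n x; rewrite /= /w -[X in (_ - X)%R]mul1r -mulrBl sqnormM.
    rewrite ler_piMl ?sqnorm_ge0// -rmorphB sqnorm_real -sqrrN opprB.
    by rewrite exprn_ile1 ?subr_ge0// gerBl.
  - apply: aeW => x /=.
    rewrite (_ : (fun n => _) = fun n =>
        ((G n x - 1) * (G n x - 1) * sqnorm (ft mu c e f x))%R); last first.
      apply/funext => n; rewrite /w -[X in (_ - X)%R]mul1r -mulrBl sqnormM.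
      by rewrite -[1%R in LHS]/(1%:C)%C -rmorphB sqnorm_real expr2.
    have G10 : (G n x - 1)%R @[n --> \oo] --> (0 : R)%R.
      by rewrite -(subrr (1 : R)%R); apply: cvgB => //; exact: cvg_cst.
    have := cvgM (cvgM G10 G10) (cvg_cst (sqnorm (ft mu c e f x))).
    by rewrite !mul0r; exact.
have pe' := phase_conj pe.
have v_le g : cintegrable mu g -> L2sq mu (ft mu c (conjk e) g) <= C%:E * L2sq mu g.
  by move: g; apply: ft_conj_le => // g gi; exact: schur_le.
(* The constant is raised by 1 because [ft_bounded_op] asks for a positive one and [C] vanishes with
   [c]. *)
have bF' : bounded_op mu mu (C + 1) (ft mu c (conjk e)).
  apply: ft_bounded_op => //; first by rewrite ltr_wpDl.
  move=> g gi; apply: (le_trans (v_le g gi)); rewrite lee_wpmul2r ?L2sq_ge0//.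
  by rewrite lee_fin lerDl.
pose r1 := (r / (4 * (C + 1) + 2))%R.
have C2 : (0 < 4 * (C + 1) + 2)%R by lra.
have r10 : (0 < r1)%R by rewrite divr_gt0.
have rE : (r = r1 * (4 * (C + 1) + 2))%R by rewrite divfK// gt_eqF.
have [N _ HN] := cvge0_lt r10 wcvg.
have mv n := cmeasurable_ft mu c pe' (mw n).
exists (w N); split => //.
  apply: (lt_trans (HN N (leqnn N))); rewrite lte_fin rE; nra.
apply: (@le_lt_trans _ _ ((C + 1) * (4 * r1))%:E); last first.
  by rewrite lte_fin rE; lra.
(* Fatou in [m] with [N] fixed: [w N] and [w (N + m)] are both within [r1] of the transform in
   squared norm, hence within [4 * r1] of each other. *)
apply: (@fatou_bound _ _ _ mu (fun m x =>
  sqnorm (ft mu c (conjk e) (w N) x - ft mu c (conjk e) (w (N + m)%N) x))%R).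
- by move=> m; apply: measurable_sqnorm; exact: cmeasurableB.
- by apply: measurable_sqnorm; exact: cmeasurableB.
- by move=> *; exact: sqnorm_ge0.
- by move=> *; exact: sqnorm_ge0.
- apply: filterS cvgf => x cvgx.
  suff h : ccvg (fun n => ft mu c (conjk e) (w n) x) (f x).
    exact: sqnorm_cvg (ccvg_shift N h).
  move: cvgx; congr ccvg; apply/funext => n; rewrite /ft rmorphXn/= expr2 -mulrA.
  congr (_ * _)%R; rewrite -(adjoint_sumk n x fi) -cintegralZ.
    (* [ft] integrates over the second argument of the kernel and [adjoint_sumk] over the first;
       [esym] reconciles them. *)
    by apply: eq_cintegral => y; rewrite /w /ft /conjk (esym x); ring.
  apply: (cintegrable_le _ (cintegrableZ B%:C%C (cG n))).
    apply: cmeasurableM.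
      apply: cmeasurableJ; apply: (@cmeasurable_comp _ _ _ _ _ _ (fun y : T => (y, x))
        (phase_measurable pe)); exact: measurable_fun_pair.
    by apply: cmeasurableM => //; exact: cmeasurable_real.
  move=> y; rewrite !Normc.normcM normc_conj normc_e mul1r normc_G mulrC ler_wpM2r//.
  by rewrite (le_trans (HB y))// normc_sqrt sqnorm_real sqrtr_sqr ler_norm.
- move=> m; apply: (le_trans (bopB bF' (wL N) (wL (N + m)%N))).
  rewrite EFinM lee_wpmul2l ?lee_fin ?addr_ge0//.
  apply: (le_trans (L2sqB mu (mw N) mft (mw (N + m)%N))).
  have h1 := HN N (leqnn N); have h2 := HN (N + m)%N (leq_addr m N).
  rewrite (L2sqBC mu (ft mu c e f)) (_ : (4 * r1)%:E = 2%:E * r1%:E + 2%:E * r1%:E).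
    by apply: leeD; rewrite lee_wpmul2l// ltW.
  by rewrite -!EFinM -EFinD; congr EFin; lra.
Qed.

End summability_kernel.

(** * Affine changes of variable on the line *)

Section affine1.
Context {R : realType}.
Local Notation mu := (@lebesgue_measure R).
Local Open Scope ereal_scope.

Lemma measurable_affine (c v : R) :
  measurable_fun setT (fun x : measurableTypeR R => c * x + v : measurableTypeR R)%R.
Proof. by apply: measurable_funD => //; exact: measurable_funM. Qed.

Lemma preimage_affine_itv (c v a b : R) : c != 0%R ->
  (fun x => c * x + v)%R @^-1` `]a, b] =
  if (0 < c)%R then `]((a - v) / c)%R, ((b - v) / c)%R]%classic
  else `[((b - v) / c)%R, ((a - v) / c)%R[%classic.
Proof.
move=> c0; case: ifPn => [c_gt0|].
  apply/seteqP; split => x; rewrite /= !in_itv/= ltr_pdivrMr// ler_pdivlMr//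
    ltrBlDr lerBrDr (mulrC x)//.
rewrite -leNgt le_eqVlt (negbTE c0)/= => c_lt0.
apply/seteqP; split => x; rewrite /= !in_itv/= ler_ndivrMr// ltr_ndivlMr//
  ltrBlDr lerBrDr (mulrC x)// andbC//.
Qed.

(** The right side is a measure that agrees with Lebesgue measure on half-open intervals, whence the
    equality by uniqueness. For negative [c] the preimage is closed at the other end, which does not
    change its measure. *)
Lemma lebesgue_measure_affine (c v : R) (A : set (measurableTypeR R)) :
  c != 0%R -> measurable A ->
  mu A = (`|c|)%:E * mu ((fun x => c * x + v)%R @^-1` A).
Proof.
move=> c0 mA; have c_ge0 : (0 <= `|c|)%R by [].
have maff := measurable_affine c v.
have := @lebesgue_measure_unique R (mscale (NngNum c_ge0) (pushforward mu
  (fun x : measurableTypeR R => c * x + v : measurableTypeR R)%R)).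
apply => // _ [[a b] _ <-]; rewrite /mscale /pushforward /=.
rewrite [X in _ = _ * lebesgue_measure X](preimage_affine_itv v a b c0); case: ifPn => [c_gt0|].
  rewrite !lebesgue_measure_itv/= !lte_fin ltr_pM2r ?invr_gt0// ltrD2r.
  case: ifP => _; last by rewrite mule0.
  rewrite -!EFinB -EFinM; congr EFin; rewrite gtr0_norm//.
  by field.
rewrite -leNgt le_eqVlt (negbTE c0)/= => c_lt0.
rewrite !lebesgue_measure_itv/= !lte_fin ltr_nM2r ?invr_lt0// ltrD2r.
case: ifP => _; last by rewrite mule0.
rewrite -!EFinB -EFinM; congr EFin; rewrite ltr0_norm//.
by field.
Qed.

Lemma ge0_integral_affine (c v : R) (f : measurableTypeR R -> \bar R) :
  c != 0%R -> measurable_fun setT f -> (forall x, 0 <= f x) ->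
  \int[mu]_x f x = (`|c|)%:E * \int[mu]_x f (c * x + v)%R.
Proof.
move=> c0 mf f0; have c_ge0 : (0 <= `|c|)%R by [].
have maff := measurable_affine c v.
have h := @ge0_integral_pushforward _ _ _ _ _ _ maff mu setT f measurableT mf
  (fun x _ => f0 x).
rewrite [X in _ = _ * X](_ : _ = \int[pushforward mu
  (fun x : measurableTypeR R => c * x + v : measurableTypeR R)%R]_y f y)//.
have := @ge0_integral_mscale _ _ _ (pushforward mu
  (fun x : measurableTypeR R => c * x + v : measurableTypeR R)%R) setT
  measurableT (NngNum c_ge0) f mf (fun x _ => f0 x).
move=> /= <-; apply: eq_measure_integral => A mA _.
exact: lebesgue_measure_affine.
Qed.

End affine1.

(** * The Fourier transform on the line *)

Section poisson.
Context {R : realType}.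
Local Notation mu := (@lebesgue_measure R).
Implicit Types eps t y : R.

Lemma is_derive_linear (k y : R) : is_derive y 1 (fun z => k * z : R) k.
Proof.
by apply: is_derive_eq; rewrite /GRing.scale/= mulr1.
Qed.

Lemma is_derive_expR_linear (k y : R) :
  is_derive y 1 (fun z => expR (k * z)) (k * expR (k * y)).
Proof.
have h := is_derive_linear k y.
by have := is_derive1_comp (is_derive_expR (k * y)) h; rewrite mulrC; exact.
Qed.

Lemma is_derive_sin_linear (k y : R) :
  is_derive y 1 (fun z => sin (k * z)) (k * cos (k * y)).
Proof.
have h := is_derive_linear k y.
by have := is_derive1_comp (is_derive_sin (k * y)) h; rewrite mulrC; exact.
Qed.

Lemma is_derive_cos_linear (k y : R) :
  is_derive y 1 (fun z => cos (k * z)) (- (k * sin (k * y))).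
Proof.
have h := is_derive_linear k y.
by have := is_derive1_comp (is_derive_cos (k * y)) h; rewrite mulNr mulrC; exact.
Qed.

(** The usual primitive of $e^{-\varepsilon z}\cos(tz)$, cleared of its denominator
    $\varepsilon^2+t^2$. *)
Lemma is_derive_poisson_primitive eps t y : 0 < eps ->
  is_derive y 1 (fun z => expR (- eps * z) * (t * sin (t * z) - eps * cos (t * z)))
    ((eps ^+ 2 + t ^+ 2) * (expR (- eps * y) * cos (t * y))).
Proof.
move=> e0.
have h1 := is_derive_expR_linear (- eps) y.
have h2 := is_derive_sin_linear t y; have h3 := is_derive_cos_linear t y.
apply: is_derive_eq; rewrite /GRing.scale/=; ring.
Qed.

Lemma cvg_expR_linear eps : 0 < eps -> expR (- eps * y) @[y --> +oo] --> (0 : R).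
Proof.
move=> e0; rewrite (_ : (fun y => expR (- eps * y)) =
  (fun z => expR (- z)) \o (fun z => eps * z)); last first.
  by apply/funext => y /=; rewrite mulNr.
by apply: (@cvg_comp _ _ _ _ _ _ (pinfty_nbhs R)); [exact: gt0_cvgMry|exact: cvgr_expR].
Qed.

Lemma is_derive_continuous (f f' : R -> R) :
  (forall y, is_derive y 1 f (f' y)) -> continuous f.
Proof.
move=> df y; apply: differentiable_continuous; apply/derivable1_diffP.
exact: ex_derive.
Qed.

Lemma continuous_expR_cos eps t :
  continuous (fun y => expR (- eps * y) * (1 + cos (t * y))).
Proof.
have c1 := is_derive_continuous (is_derive_expR_linear (- eps)).
have c2 := is_derive_continuous (is_derive_cos_linear t).
move=> y; apply: cvgM; first exact: c1.
by apply: cvgD; [exact: cvg_cst|exact: c2].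
Qed.

(** Adding 1 to the cosine makes the integrand nonnegative, as the fundamental theorem on a
    half-line used here requires; the contribution of the 1 is subtracted in [cintegral_poisson]. *)
Lemma integral_expR_cos eps t : 0 < eps ->
  (\int[mu]_(y in `[0%R, +oo[) (expR (- eps * y) * (1 + cos (t * y)))%:E =
   (eps^-1 + eps / (eps ^+ 2 + t ^+ 2))%:E)%E.
Proof.
move=> e0; have D0 : eps ^+ 2 + t ^+ 2 != 0.
  by rewrite gt_eqF// ltr_wpDr ?sqr_ge0// exprn_gt0.
pose D := eps ^+ 2 + t ^+ 2.
pose F y := - eps^-1 * expR (- eps * y) +
  D^-1 * (expR (- eps * y) * (t * sin (t * y) - eps * cos (t * y))).
have dF y : is_derive y 1 F (expR (- eps * y) * (1 + cos (t * y))).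
  have h1 := is_derive_expR_linear (- eps) y.
  have h2 := is_derive_poisson_primitive t y e0.
  apply: is_derive_eq; rewrite /GRing.scale/= -/D.
  by rewrite /D; field; rewrite D0 gt_eqF.
have cF : continuous F by exact: is_derive_continuous dF.
have cvgF : F y @[y --> +oo] --> (0 : R).
  have he := cvg_expR_linear e0.
  rewrite -[X in _ --> X]addr0; apply: cvgD.
    by rewrite -[X in _ --> X](mulr0 (- eps^-1)); apply: cvgM => //; exact: cvg_cst.
  rewrite -[X in _ --> X](mulr0 D^-1); apply: cvgM; first exact: cvg_cst.
  pose K := `|t| + eps.
  have bd y : `|t * sin (t * y) - eps * cos (t * y)| <= K.
    apply: (le_trans (ler_normB _ _)); rewrite !normrM (gtr0_norm e0).
    have s1 : `|sin (t * y)| <= 1 by rewrite ler_norml sin_geN1 sin_le1.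
    have c1 : `|cos (t * y)| <= 1 by rewrite ler_norml cos_geN1 cos_le1.
    by apply: lerD; [exact: ler_piMr|apply: ler_piMr => //; exact: ltW].
  have he' : expR (- eps * y) * K @[y --> +oo] --> (0 : R).
    by rewrite -[X in _ --> X](mul0r K); apply: cvgM => //; exact: cvg_cst.
  apply: (@squeeze_cvgr _ _ _ _ (fun y => - (expR (- eps * y) * K))
    (fun y => expR (- eps * y) * K)) => //.
    apply: nearW => y; rewrite -ler_norml normrM ger0_norm ?expR_ge0//.
    by rewrite ler_wpM2l ?expR_ge0.
  by rewrite -[X in _ --> X]oppr0; exact: cvgN.
rewrite (@ge0_continuous_FTC2y _ _ F _ 0).
- rewrite -EFinB; congr EFin; rewrite /F !mulr0 expR0 sin0 cos0 -/D.
  by rewrite mulr0 !mulr1 mul1r sub0r; ring.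
- move=> y _; apply: mulr_ge0; first exact: expR_ge0.
  by have := cos_geN1 (t * y); lra.
- by apply: continuous_subspaceT; exact: continuous_expR_cos.
- exact: cvgF.
- by move=> y _; exact: ex_derive.
- by apply: cvg_at_right_filter; exact: cF.
- by move=> y _; rewrite derive1E; exact: derive_val.
Qed.

Definition poisson_weight eps y : R := expR (- eps * `|y|).

Lemma poisson_weight_ge0 eps y : 0 <= poisson_weight eps y.
Proof. exact: expR_ge0. Qed.

Lemma continuous_poisson_weight eps : continuous (poisson_weight eps).
Proof.
have c1 := is_derive_continuous (is_derive_expR_linear (- eps)).
move=> y; apply: (@continuous_comp _ _ _ (fun y => `|y|) (fun y => expR (- eps * y))).
  exact: norm_continuous.
exact: c1.
Qed.

Lemma integral_poisson_cos1 eps t : 0 < eps ->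
  (\int[mu]_y (poisson_weight eps y * (1 + cos (t * y)))%:E =
   (2 * (eps^-1 + eps / (eps ^+ 2 + t ^+ 2)))%:E)%E.
Proof.
move=> e0; rewrite ge0_symfun_integralT.
- rewrite [RHS]EFinM -(integral_expR_cos t e0) set_itvcy; congr (_ * _)%E.
  by apply: eq_integral => y; rewrite inE/= => y0; rewrite /poisson_weight ger0_norm.
- move=> y; apply: mulr_ge0; first exact: poisson_weight_ge0.
  by have := cos_geN1 (t * y); lra.
- have c2 := is_derive_continuous (is_derive_cos_linear t).
  move=> y; apply: cvgM; first exact: continuous_poisson_weight.
  by apply: cvgD; [exact: cvg_cst|exact: c2].
- by move=> y; rewrite /= /poisson_weight normrN mulrN cosN.
Qed.

Lemma measurable_poisson_weight eps : measurable_fun setT (poisson_weight eps).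
Proof. by apply: continuous_measurable_fun; exact: continuous_poisson_weight. Qed.

(** The case [t = 0] of [integral_poisson_cos1], where the integrand is twice the weight. *)
Lemma integral_poisson_weight eps : 0 < eps ->
  (\int[mu]_y (poisson_weight eps y)%:E = (2 / eps)%:E)%E.
Proof.
move=> e0; have := integral_poisson_cos1 0 e0.
under eq_integral do rewrite mul0r cos0 mulrC EFinM.
rewrite ge0_integralZl_EFin//; last 2 first.
- by move=> y _; rewrite lee_fin poisson_weight_ge0.
- by apply/measurable_EFinP; exact: measurable_poisson_weight.
move=> /(congr1 (fun x => 2^-1%:E * x)%E); rewrite muleA -!EFinM.
rewrite (_ : 2^-1 * (1 + 1) = 1) ?mul1e; last by rewrite -[1 + 1]/(2%:R) mulVf.
move=> ->; congr EFin; field; rewrite gt_eqF//=.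
Qed.

Lemma integrable_poisson_weight eps : 0 < eps ->
  mu.-integrable setT (fun y => (poisson_weight eps y)%:E).
Proof.
move=> e0; apply/integrableP; split.
  by apply/measurable_EFinP; exact: measurable_poisson_weight.
under eq_integral do rewrite gee0_abs ?lee_fin ?poisson_weight_ge0//.
by rewrite integral_poisson_weight// ltry.
Qed.

Lemma measurable_cos_linear t : measurable_fun setT (fun y : measurableTypeR R => cos (t * y)).
Proof.
apply: continuous_measurable_fun.
exact: is_derive_continuous (is_derive_cos_linear t).
Qed.

Lemma measurable_sin_linear t : measurable_fun setT (fun y : measurableTypeR R => sin (t * y)).
Proof.
apply: continuous_measurable_fun.
exact: is_derive_continuous (is_derive_sin_linear t).
Qed.

Lemma cintegrable_poisson eps t : 0 < eps ->
  cintegrable mu (fun y => real_complex_def (Phant R) (poisson_weight eps y) * expi (t * y)).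
Proof.
move=> e0; have mw := measurable_poisson_weight eps.
have bd (g : R -> R) : measurable_fun setT (g : measurableTypeR R -> R) ->
    (forall y, `|g y| <= 1) ->
    mu.-integrable setT (fun y => (poisson_weight eps y * g y)%:E).
  move=> mg g1; apply: le_integrable (integrable_poisson_weight e0) => //.
    by apply/measurable_EFinP; exact: measurable_funM.
  by move=> y _; rewrite /= lee_fin normrM ler_piMr.
split.
- under eq_fun do rewrite ReImE /= mul0r subr0.
  apply: bd; first exact: measurable_cos_linear.
  by move=> y; rewrite ler_norml cos_geN1 cos_le1.
- under eq_fun do rewrite ReImE /= mul0r addr0.
  apply: bd; first exact: measurable_sin_linear.
  by move=> y; rewrite ler_norml sin_geN1 sin_le1.
Qed.

(** The real part is [integral_poisson_cos1] minus the mass of the weight; the imaginary part has an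
    odd integrand, so reflection shows that it equals its opposite. *)
Lemma cintegral_poisson eps t : 0 < eps ->
  cintegral mu (fun y => real_complex_def (Phant R) (poisson_weight eps y) * expi (t * y)) =
  real_complex_def (Phant R) (2 * eps / (eps ^+ 2 + t ^+ 2)).
Proof.
move=> e0; have [i1 i2] := cintegrable_poisson t e0.
have iw := integrable_poisson_weight e0.
rewrite /cintegral /real_complex_def; congr Complex.
  under eq_Rintegral do rewrite ReImE /= mul0r subr0.
  have i1' : mu.-integrable setT (fun y => (poisson_weight eps y * cos (t * y))%:E).
    by move: i1; under eq_fun do rewrite ReImE /= mul0r subr0.
  have : \int[mu]_y (poisson_weight eps y + poisson_weight eps y * cos (t * y)) =
      2 * (eps^-1 + eps / (eps ^+ 2 + t ^+ 2)).
    rewrite /Rintegral (_ : 2 * (eps^-1 + _) =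
      fine (2 * (eps^-1 + eps / (eps ^+ 2 + t ^+ 2)))%:E)//.
    rewrite -integral_poisson_cos1//; congr fine; apply: eq_integral => y _.
    by rewrite mulrDr mulr1.
  rewrite RintegralD// {1}/Rintegral integral_poisson_weight//= => /eqP.
  rewrite addrC eq_sym -subr_eq => /eqP <-; field.
  by rewrite !gt_eqF// ltr_wpDr ?sqr_ge0// exprn_gt0.
under eq_Rintegral do rewrite ReImE /= mul0r addr0.
have i2' : mu.-integrable setT (fun y => (poisson_weight eps y * sin (t * y))%:E).
  by move: i2; under eq_fun do rewrite ReImE /= mul0r addr0.
set I := (X in X = 0); have : I = - I.
  rewrite -[RHS]mulN1r -RintegralZl//.
  have mN : measurable_fun setT (-%R : measurableTypeR R -> measurableTypeR R) by [].
  rewrite {1}/I /Rintegral; congr fine.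
  rewrite (@integral_transport _ _ _ _ _ mu mu _ mN).
  + apply: eq_integral => y _; rewrite /poisson_weight normrN mulrN sinN.
    by rewrite mulrN mulN1r.
  + by move=> A mA; exact/esym/lebesgue_measureN.
  + by apply: (measurable_int mu).
by move=> /eqP; rewrite -subr_eq0 opprK -mulr2n mulrn_eq0 => /= /eqP.
Qed.

Lemma continuous_poisson_kernel eps (x : R) : 0 < eps ->
  continuous (fun z : R => 2 * eps / (eps ^+ 2 + (z - x) ^+ 2)).
Proof.
move=> e0 z; apply: cvgM; first exact: cvg_cst.
apply: cvgV; first by rewrite gt_eqF// ltr_wpDr ?sqr_ge0// exprn_gt0.
apply: cvgD; first exact: cvg_cst.
under eq_fun do rewrite expr2; rewrite expr2.
by apply: cvgM; apply: cvgB => //; exact: cvg_cst.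
Qed.

(** The substitution $x'=\varepsilon u+x$ removes both parameters and leaves $2\int
    du/(1+u^2)=2\pi$. *)
Lemma integral_poisson_kernel eps x : 0 < eps ->
  (\int[mu]_x' (2 * eps / (eps ^+ 2 + (x' - x) ^+ 2))%:E = (2 * pi)%:E)%E.
Proof.
move=> e0; have D0 z : 0 < eps ^+ 2 + z ^+ 2.
  by rewrite ltr_wpDr ?sqr_ge0// exprn_gt0.
rewrite (@ge0_integral_affine _ eps x) ?gt_eqF//.
- rewrite (gtr0_norm e0).
  have E u : ((2 * eps / (eps ^+ 2 + (eps * u + x - x) ^+ 2))%:E =
      (2 / eps)%:E * (oneDsqr u)^-1%:E)%E.
    rewrite addrK -EFinM /oneDsqr; congr EFin.
    have := D0 (eps * u); rewrite exprMn => h2; have := sqr_ge0 u => h1.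
    by field; rewrite !gt_eqF//= ltr_wpDr.
  under eq_integral do rewrite E.
  rewrite ge0_integralZl_EFin//.
  + rewrite ge0_symfun_integralT.
    * rewrite -set_itvcy integral0y_oneDsqr -!EFinM; congr EFin; field.
      by rewrite gt_eqF.
    * by move=> u; rewrite invr_ge0.
    * by move=> u; exact: continuous_oneDsqrV.
    * by move=> u; rewrite /= /oneDsqr sqrrN.
  + apply/measurable_EFinP; apply: continuous_measurable_fun.
    by move=> u; exact: continuous_oneDsqrV.
  + by rewrite divr_ge0// ltW.
- apply/measurable_EFinP; apply: continuous_measurable_fun.
  exact: continuous_poisson_kernel.
- by move=> u; rewrite lee_fin divr_ge0 ?mulr_ge0// ltW.
Qed.

End poisson.

Section ae_lemmas.
Context {R : realType} d (T : measurableType d) (mu : {measure set T -> \bar R}).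

Lemma ae_imp (P Q : T -> Prop) : (forall x, P x -> Q x) ->
  {ae mu, forall x, P x} -> {ae mu, forall x, Q x}.
Proof. by move=> PQ; exact: filterS. Qed.

Lemma ae_and (P Q : T -> Prop) : {ae mu, forall x, P x} ->
  {ae mu, forall x, Q x} -> {ae mu, forall x, P x /\ Q x}.
Proof. by move=> p q; apply: filterS2 p q. Qed.

End ae_lemmas.

Section fourier1.
Context {R : realType}.
Local Notation mu := (@lebesgue_measure R).
Implicit Types eps a b : R.
Local Notation real := (real_complex_def (Phant R)).

Lemma integral_poisson_itv eps (x : R) a b : 0 < eps -> a < b ->
  (\int[mu]_(z in `]a, b]) (2 * eps / (eps ^+ 2 + (z - x) ^+ 2))%:E =
   (2 * (atan ((b - x) / eps) - atan ((a - x) / eps)))%:E)%E.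
Proof.
move=> e0 ab.
have ck := @continuous_poisson_kernel R eps x e0.
have D0 z : 0 < eps ^+ 2 + z ^+ 2 by rewrite ltr_wpDr ?sqr_ge0// exprn_gt0.
pose F z := 2 * atan ((z - x) / eps).
have dF (z : R) : is_derive z 1 F (2 * eps / (eps ^+ 2 + (z - x) ^+ 2)).
  have h : is_derive z 1 (fun z : R => (z - x) / eps) eps^-1.
    rewrite (_ : (fun z => _) = fun z : R => eps^-1 * (z - x)); last first.
      by apply/funext => u; rewrite mulrC.
    by apply: is_derive_eq; rewrite /GRing.scale/= subr0 mulr1.
  have h2 := @is_derive1_comp R (@atan R) (fun z => (z - x) / eps) z _ _
    (is_derive1_atan _) h.
  have h3 := @is_deriveZ R _ _ (@atan R \o (fun z => (z - x) / eps)) 2 z 1 _ h2.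
  rewrite [X in is_derive _ _ _ X](_ : _ =
    2 *: ((1 + ((z - x) / eps) ^+ 2)^-1 * eps^-1)); first exact: h3.
  rewrite /GRing.scale/=; have := D0 (z - x) => h5; have := sqr_ge0 (z - x) => h4.
  have e1 : 0 < 1 + ((z - x) / eps) ^+ 2 by rewrite ltr_wpDr ?sqr_ge0.
  have e2 : 1 + ((z - x) / eps) ^+ 2 = (eps ^+ 2 + (z - x) ^+ 2) / eps ^+ 2.
    by field; rewrite gt_eqF.
  rewrite e2; field; by rewrite !gt_eqF.
have cF := is_derive_continuous dF.
rewrite integral_itv_obnd_cbnd; last first.
  apply/measurable_EFinP; apply: measurable_funS (continuous_measurable_fun ck) => //.
rewrite (@continuous_FTC2 _ _ F)//.
- by rewrite -EFinB; congr EFin; rewrite /F mulrBr.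
- exact: continuous_subspaceT.
- split; first by move=> z _; exact: ex_derive.
  + by apply: cvg_at_right_filter; exact: cF.
  + by apply: cvg_at_left_filter; exact: cF.
- by move=> z _; rewrite derive1E; exact: derive_val.
Qed.

Definition fker : measurableTypeR R -> measurableTypeR R -> R[i] :=
  fun y x => expi (- (y * x)).

Lemma sqnorm_expi (t : R) : sqnorm (expi t) = 1.
Proof. by rewrite /sqnorm /= cos2Dsin2. Qed.

Lemma expiD (s t : R) : expi (s + t) = expi s * expi t.
Proof. by apply: eq_ReIm; rewrite !ReImE /= ?cosD ?sinD//; ring. Qed.

Lemma expiN (t : R) : expi (- t) = conjc (expi t).
Proof. by apply: eq_ReIm; rewrite !ReImE /= ?cosN ?sinN. Qed.

Lemma cmeasurable_expi d (T : measurableType d) (f : T -> R) :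
  measurable_fun setT f -> cmeasurable (fun p => expi (f p)).
Proof.
move=> mf; split => /=.
  have mc : measurable_fun setT (@cos R : measurableTypeR R -> measurableTypeR R).
    by apply: continuous_measurable_fun; exact: continuous_cos.
  exact: (measurableT_comp mc mf).
have ms : measurable_fun setT (@sin R : measurableTypeR R -> measurableTypeR R).
  by apply: continuous_measurable_fun; exact: continuous_sin.
exact: (measurableT_comp ms mf).
Qed.

Lemma phase_fker : phase fker.
Proof.
split; last by move=> y x; exact: sqnorm_expi.
apply: cmeasurable_expi; apply: measurable_funN; apply: measurable_funM.
  exact: measurable_fst.
exact: measurable_snd.
Qed.

Definition pweight (n : nat) : measurableTypeR R -> R :=
  poisson_weight (n.+1%:R)^-1.

(** The two phases combine into [expi (y * (x' - x))], so this is [cintegral_poisson] at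
    [t = x' - x]. *)
Lemma sumk_poisson n x x' : sumk mu fker pweight n x x' =
  real (2 * (n.+1%:R)^-1 / ((n.+1%:R)^-1 ^+ 2 + (x' - x) ^+ 2)).
Proof.
rewrite -cintegral_poisson ?invr_gt0//; apply: eq_cintegral => y.
congr (_ * _); rewrite /fker -expiN opprK -expiD; congr expi; ring.
Qed.

Lemma cvg_atan_scale s : 0 < s ->
  atan (s * n.+1%:R) @[n --> \oo] --> (pi / 2 : R).
Proof.
move=> s0; apply: (@cvg_comp _ _ _ (fun n : nat => s * n.+1%:R) (@atan R) _ (pinfty_nbhs R)).
  apply/cvgryPge => A; near=> n; rewrite mulrC -ler_pdivrMr//.
  apply: (@le_trans _ _ n%:R); last by rewrite ler_nat.
  by near: n; exact: nbhs_infty_ger.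
exact: cvgy_atan.
Unshelve. all: by end_near. Qed.

Lemma cvg_atan_scale_sg s : s != 0 ->
  atan (s * n.+1%:R) @[n --> \oo] --> (Num.sg s * (pi / 2) : R).
Proof.
rewrite neq_lt => /orP[s0|s0].
  rewrite ltr0_sg// mulN1r.
  rewrite (_ : (fun n => _) = fun n => - atan (- s * n.+1%:R)); last first.
    by apply/funext => n; rewrite mulNr atanN opprK.
  by apply: cvgN; apply: cvg_atan_scale; rewrite oppr_gt0.
by rewrite gtr0_sg// mul1r; exact: cvg_atan_scale.
Qed.

Definition fcst : R := (2 * pi) `^ (- (1 / 2)).

Lemma fcst_sqr : fcst ^+ 2 = (2 * pi)^-1.
Proof.
rewrite /fcst -powR_mulrn ?powR_ge0// -powRrM.
rewrite (_ : - (1 / 2) * 2%:R = - 1); last by field.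
by rewrite powR_inv1// mulr_ge0// pi_ge0.
Qed.

(** Integrating the Poisson kernel over the interval gives two arctangents, whose limits depend only
    on the signs of [b - x] and [a - x]. At an endpoint the limit would be 1/2, hence the exclusion
    of [a] and [b]. *)
Lemma cvg_poisson_itv (x : R) a b : a < b -> x != a -> x != b ->
  ccvg (fun n => real (fcst ^+ 2) * cintegral mu
     (fun x' => sumk mu fker pweight n x' x * cindic `]a, b] x'))
    (cindic `]a, b] x).
Proof.
move=> ab xa xb.
pose k n z : R := 2 * (n.+1%:R)^-1 / ((n.+1%:R)^-1 ^+ 2 + (z - x) ^+ 2).
have kE n : cintegral mu (fun x' => sumk mu fker pweight n x' x * cindic `]a, b] x') =
    real (2 * (atan ((b - x) * n.+1%:R) - atan ((a - x) * n.+1%:R))).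
  rewrite /cintegral; congr Complex; last first.
    rewrite (_ : (fun x0 => _) = cst 0) ?Rintegral_cst ?mul0r//.
    by apply/funext => z; rewrite sumk_poisson /cindic -rmorphM.
  rewrite /Rintegral -[RHS]/(fine (_%:E)).
  rewrite -[n.+1%:R]invrK -integral_poisson_itv ?invr_gt0//; congr fine.
  rewrite [RHS]integral_mkcond; apply: eq_integral => z _.
  rewrite sumk_poisson /cindic -rmorphM/= patchE indicE.
  rewrite -(opprB z x) sqrrN.
  by case: ifP => _; rewrite ?mulr1 ?mulr0.
split; last first.
  rewrite (_ : (fun n => _) = cst 0); first exact: cvg_cst.
  by apply/funext => n; rewrite kE -rmorphM.
rewrite (_ : (fun n => _) = fun n => (2 * pi)^-1 *
    (2 * (atan ((b - x) * n.+1%:R) - atan ((a - x) * n.+1%:R)))); last first.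
  by apply/funext => n; rewrite kE -rmorphM fcst_sqr.
rewrite (_ : complex.Re _ = (2 * pi)^-1 *
    (2 * (Num.sg (b - x) * (pi / 2) - Num.sg (a - x) * (pi / 2)))).
  apply: cvgM; first exact: cvg_cst.
  apply: cvgM; first exact: cvg_cst.
  by apply: cvgB; apply: cvg_atan_scale_sg; rewrite subr_eq0 eq_sym.
have pi0 := @pi_gt0 R; rewrite /cindic /= indicE.
move: xa xb; rewrite !neq_lt => /orP[xa|xa] /orP[xb|xb].
- rewrite memNset/=; last by rewrite in_itv/= => /andP[]; rewrite ltNge (ltW xa).
  by rewrite !gtr0_sg ?subr_gt0// subrr !mulr0.
- by have := lt_trans (lt_trans xa ab) xb; rewrite ltxx.
- rewrite mem_set/= ?in_itv/= ?xa ?(ltW xb)// gtr0_sg ?subr_gt0//.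
  rewrite ltr0_sg ?subr_lt0// -[_%:R]/1; move: pi pi0 => p p0; field; rewrite gt_eqF//.
- rewrite memNset/=; last by rewrite in_itv/= => /andP[_]; rewrite leNgt xb.
  by rewrite !ltr0_sg ?subr_lt0// subrr !mulr0.
Qed.

Lemma ae_neq2 a b : {ae mu, forall x, x != a /\ x != b}.
Proof.
have ne (c : R) : {ae mu, forall x, x != c}.
  exists [set c]; split; [exact: measurable_set1|exact: lebesgue_measure_set1|].
  by move=> x /= /negP; rewrite negbK => /eqP.
exact: ae_and (ne a) (ne b).
Qed.

Lemma pweight_cvg y : pweight n y @[n --> \oo] --> (1 : R).
Proof.
rewrite -expR0.
have h : (- (n.+1%:R)^-1 * `|y|) @[n --> \oo] --> (0 : R).
  rewrite -(mul0r `|y|); apply: cvgM; last exact: cvg_cst.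
  by rewrite -oppr0; apply: cvgN; exact: cvg_harmonic.
exact: (cvg_comp _ _ h (@continuous_expR R 0)).
Qed.

(** The Poisson kernel is positive, so the integral of its modulus is its mass, the same for all [n]
    and [x]. *)
Lemma sumk_pweight_le n x :
  (\int[mu]_x' (Normc.normc (sumk mu fker pweight n x x'))%:E <= (2 * pi)%:E)%E.
Proof.
have e_gt0 : 0 < (n.+1%:R : R)^-1 by rewrite invr_gt0.
rewrite -(integral_poisson_kernel x e_gt0).
rewrite le_eqVlt; apply/orP; left; apply/eqP; apply: eq_integral => z _.
rewrite sumk_poisson normc_sqrt sqnorm_real sqrtr_sqr ger0_norm//.
by rewrite divr_ge0 ?mulr_ge0 ?addr_ge0 ?sqr_ge0// ltW.
Qed.

Lemma lebesgue_itv_lty a b : (mu `]a, b]%classic < +oo)%E.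
Proof. by rewrite lebesgue_measure_itv/=; case: ifP => _; rewrite ?ltry. Qed.

Lemma ocitv_inv I r : ocitv I -> 0 < r -> exists w, [/\ cL12 mu w,
   (L2sq mu (w \- ft mu fcst fker (cindic I))%R < r%:E)%E &
   (L2sq mu (ft mu fcst (conjk fker) w \- cindic I)%R < r%:E)%E].
Proof.
move=> [[a b] _ <-] r0 /=.
have e_gt0 n : 0 < (n.+1%:R : R)^-1 by rewrite invr_gt0.
apply: (@summable_inv R _ _ mu fcst (2 * pi) fker pweight phase_fker _ _ _ _ _ _ _).
- by move=> y x; rewrite /fker mulrC.
- by rewrite mulr_gt0// pi_gt0.
- by move=> n; exact: integrable_poisson_weight.
- by move=> n y; exact: poisson_weight_ge0.
- move=> n y; rewrite /pweight /poisson_weight -expR0 ler_expR mulNr oppr_le0.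
  by rewrite mulr_ge0// ltW.
- exact: pweight_cvg.
- exact: sumk_pweight_le.
- exact: r0.
- apply: cL12_cindic; first exact: measurable_itv.
  exact: lebesgue_itv_lty.
(* If [b <= a] the interval is empty and every term vanishes. *)
- have [ab|ba] := ltP a b.
    by apply: ae_imp (ae_neq2 a b) => x [xa xb]; exact: cvg_poisson_itv.
  apply: aeW => x; rewrite set_itv_ge ?bnd_simp -?leNgt//.
  rewrite (_ : (fun n => _) = cst (0 : R[i])).
    by rewrite /cindic indic0; split; exact: cvg_cst.
  apply/funext => n; rewrite (_ : (fun x' => _) = cst (0 : R[i])).
    by rewrite /cintegral !Rintegral_cst// !mul0r mulr0.
  by apply/funext => z; rewrite /cindic indic0 mulr0.
Qed.

(** Schur's bound with [M = 2 * pi]; the constant evaluates to 4, against 1 in Plancherel's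
    identity. *)
Lemma fourier_pair1 : fourier_pair mu fcst fker (fcst ^+ 2 * (4 * (2 * pi))).
Proof.
have e_gt0 n : 0 < (n.+1%:R : R)^-1 by rewrite invr_gt0.
have ocK n : ocitv `](- n%:R : R), n%:R]%classic by exists (- n%:R, n%:R).
apply: (@fourier_pair_dense R _ (measurableTypeR R) (@lebesgue_measure R) fcst fker
  (fcst ^+ 2 * (4 * (2 * pi))) (@ocitv R) (fun n => `](- n%:R), n%:R]%classic)).
- exact: phase_fker.
- by rewrite fcst_sqr mulr_gt0 ?invr_gt0 ?mulr_gt0 ?pi_gt0.
- move=> f; apply: (@schur_le R _ _ mu fcst (2 * pi) fker pweight phase_fker).
  + by rewrite mulr_gt0// pi_gt0.
  + by move=> n; exact: integrable_poisson_weight.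
  + by move=> n y; exact: poisson_weight_ge0.
  + exact: pweight_cvg.
  + exact: sumk_pweight_le.
- by [].
- exact: ocitvI.
- by move=> n; exact: measurable_itv.
- move=> m n mn; apply/subsetPset => x; rewrite /= !in_itv/= => /andP[h1 h2].
  have mnR : m%:R <= n%:R :> R by rewrite ler_nat.
  by apply/andP; split; [apply: le_lt_trans h1; rewrite lerN2|exact: le_trans h2 mnR].
- apply/seteqP; split => // x _.
  have [n _ /(_ n (leqnn n)) xn] := nbhs_infty_ger (`|x| + 1).
  exists n => //; rewrite /= in_itv/=.
  have := ler_norm x; have := ler_norm (- x); rewrite normrN.
  move: xn => /= xn h1 h2; apply/andP; split; lra.
- by move=> n; exact: lebesgue_itv_lty.
- move=> X n r [XG|->] r0; apply: ocitv_inv => //; first exact: ocitvI.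
  by rewrite setTI.
Qed.

End fourier1.

(** * The Fourier transform on n-space *)

Section tuple_space.
Context {R : realType}.
Local Notation leb d := (@lebesgue R d).
Local Notation real := (real_complex_def (Phant R)).

Lemma measurable_mktuple d (T : measurableType d) n (f : 'I_n -> T -> R) :
  (forall i, measurable_fun setT (f i : T -> measurableTypeR R)) ->
  measurable_fun setT (fun x => [tuple f i x | i < n] : RR R n).
Proof.
move=> mf; apply/measurable_fun_tnthP => i; rewrite (_ : _ \o _ = f i)//.
by apply/funext => x; rewrite /= tnth_mktuple.
Qed.

Lemma measurable_coord n (i : 'I_n) :
  measurable_fun setT (fun x : RR R n => tnth x i : measurableTypeR R).
Proof. exact: measurable_tnth. Qed.

Lemma measurable_tadd d (T : measurableType d) n (f g : T -> RR R n) :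
  measurable_fun setT f -> measurable_fun setT g ->
  measurable_fun setT (fun x => tadd (f x) (g x)).
Proof.
move=> mf mg; apply: measurable_mktuple => i.
by apply: measurable_funD; [exact: (measurableT_comp (measurable_coord i) mf)|
                            exact: (measurableT_comp (measurable_coord i) mg)].
Qed.

Lemma measurable_tscale d (T : measurableType d) n (c : R) (f : T -> RR R n) :
  measurable_fun setT f -> measurable_fun setT (fun x => tscale c (f x)).
Proof.
move=> mf; apply: measurable_mktuple => i; apply: measurable_funM => //.
exact: (measurableT_comp (measurable_coord i) mf).
Qed.

Lemma measurable_topp n : measurable_fun setT (@topp R n).
Proof.
apply: measurable_mktuple => i; apply: measurable_funN.
exact: measurable_coord.
Qed.

Lemma measurable_dotp d (T : measurableType d) n (f g : T -> RR R n) :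
  measurable_fun setT f -> measurable_fun setT g ->
  measurable_fun setT (fun x => dotp (f x) (g x)).
Proof.
move=> mf mg; apply: measurable_sum => i; apply: measurable_funM.
  exact: (measurableT_comp (measurable_coord i) mf).
exact: (measurableT_comp (measurable_coord i) mg).
Qed.

Definition uncons n (t : RR R n.+1) : measurableTypeR R * RR R n :=
  (thead t, [tuple of behead t]).

Lemma measurable_uncons n : measurable_fun setT (@uncons n).
Proof.
apply: measurable_fun_pair; last exact: measurable_behead.
exact: measurable_tnth.
Qed.

Lemma tuple_consK n : cancel (@tuple_cons R n) (@uncons n).
Proof.
by move=> [x t]; rewrite /uncons theadE; congr pair; exact: val_inj.
Qed.

Lemma lebesgueS n (A : set (RR R n.+1)) : measurable A ->
  leb n.+1 A = prod_measure (@lebesgue_measure R) (leb n) (@tuple_cons R n @^-1` A).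
Proof. by []. Qed.

Definition kerd n (y x : RR R n) : R[i] := expi (- dotp y x).

Definition fcstd (n : nat) : R := (2 * pi) `^ (- (n%:R / 2)).

Lemma phase_kerd n : phase (@kerd n).
Proof.
split; last by move=> y x; exact: sqnorm_expi.
by apply: cmeasurable_expi; apply: measurable_funN; exact: measurable_dotp.
Qed.

(** The scalar product splits off its first term, so the exponential factors. *)
Lemma kerdS n (y x : RR R n.+1) :
  kerd y x = tensork (@fker R) (@kerd n) (uncons y) (uncons x).
Proof.
rewrite /kerd /tensork /fker /uncons /= -expiD -opprD /dotp; congr (expi (- _)).
rewrite big_ord_recl; congr (_ + _); apply: eq_bigr => i _.
rewrite !tnth_behead (_ : lift ord0 i = inord i.+1)//.
by apply: val_inj; rewrite /= inordK ?ltnS.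
Qed.

Lemma fcstdS n : fcstd n.+1 = @fcst R * fcstd n.
Proof.
rewrite /fcstd /fcst -powRD; last first.
  by apply/implyP => _; rewrite gt_eqF// mulr_gt0// pi_gt0.
by congr (_ `^ _); rewrite -natr1; field.
Qed.

Lemma cintegral_dirac0 (f : RR R 0 -> R[i]) : cmeasurable f ->
  cintegral (leb 0) f = f [tuple].
Proof.
move=> [m1 m2]; apply: eq_ReIm; rewrite /= /Rintegral integral_dirac ?diracT ?mul1e//;
  exact/measurable_EFinP.
Qed.

(** On the one-point space the kernel and the normalisation are 1, and the transform is the
    identity. *)
Lemma fourier_pair0 : fourier_pair (leb 0) (fcstd 0) (@kerd 0) 1.
Proof.
have ftE k (f : RR R 0 -> R[i]) : cmeasurable f -> phase k -> (forall y x, k y x = 1) ->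
    ft (leb 0) (fcstd 0) k f = f.
  move=> mf pk k1; apply/funext => y; rewrite /ft cintegral_dirac0; last first.
    by apply: cmeasurableM => //; exact: cmeasurable_phase.
  by rewrite k1 mul1r /fcstd mul0r oppr0 powRr0 mul1r (tuple0 y).
have k1 (y x : RR R 0) : kerd y x = 1.
  by rewrite /kerd /dotp big_ord0 oppr0; apply: eq_ReIm; rewrite /= ?cos0 ?sin0.
have pk := phase_kerd 0.
split => //.
- move=> f fi; rewrite ftE// ?mul1e//; exact: cintegrable_measurable fi.
- move=> f fL r r0; exists f; have mf := fL.2.1.
  rewrite !ftE//; last 2 first.
  + exact: phase_conj.
  + by move=> y x; rewrite /conjk k1 conjc1.
  split => //; rewrite (_ : (f \- f) = cst 0) ?L2sq_cst0 ?lte_fin//;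
    by apply/funext => x /=; rewrite subrr.
Qed.

(** Induction on the dimension: a product with the line, then transport along [tuple_cons], through
    which [lebesgue] is defined. *)
Lemma fourier_pair_RR n : exists C, fourier_pair (leb n) (fcstd n) (@kerd n) C.
Proof.
elim: n => [|n [C IH]]; first by exists 1; exact: fourier_pair0.
have h := fourier_pair_tensor (@fourier_pair1 R) IH.
exists (@fcst R ^+ 2 * (4 * (2 * pi)) * C); rewrite fcstdS.
have := fourier_pair_transport (mu := prod_measure (@lebesgue_measure R) (leb n))
  (nu := leb n.+1) (@measurable_tuple_cons R n) (@lebesgueS n)
  (@measurable_uncons n) (@tuple_consK n) h.
by congr fourier_pair; apply/funext => y; apply/funext => x; rewrite kerdS.
Qed.

Local Open Scope ereal_scope.

Lemma ge0_integralS n (f : RR R n.+1 -> \bar R) : measurable_fun setT f ->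
  (forall x, 0 <= f x) ->
  \int[leb n.+1]_x f x =
  \int[@lebesgue_measure R]_t \int[leb n]_x f (tuple_cons (t, x)).
Proof.
move=> mf f0.
rewrite (integral_transport (mu := prod_measure (@lebesgue_measure R) (leb n))
  (@measurable_tuple_cons R n) (@lebesgueS n))//.
rewrite -[LHS]/(\int[@lebesgue_measure R \x leb n]_p f (tuple_cons p)) fubini_tonelli1//.
exact: (measurableT_comp mf (@measurable_tuple_cons R n)).
Qed.

(** One induction serves dilations and translations; each step splits off the first coordinate by
    Tonelli and contributes a factor $|c|$. *)
Lemma ge0_integral_affineRR n (c : R) (v : RR R n) (f : RR R n -> \bar R) :
  c != 0%R -> measurable_fun setT f -> (forall x, 0 <= f x) ->
  \int[leb n]_x f x = (`|c| ^+ n)%:E * \int[leb n]_x f (tadd (tscale c x) v).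
Proof.
move=> c0; elim: n v f => [|n IH] v f mf f0.
  by rewrite expr0 mul1e; apply: eq_integral => x _; congr f; apply: eq_from_tnth => -[].
have maff : measurable_fun setT (fun x : RR R n.+1 => tadd (tscale c x) v).
  by apply: measurable_tadd => //; exact: measurable_tscale.
rewrite !ge0_integralS//; last exact: (measurableT_comp mf maff).
have consE t x : tadd (tscale c (tuple_cons (t, x))) v =
    tuple_cons ((c * t + thead v)%R, tadd (tscale c x) [tuple of behead v]).
  apply: eq_from_tnth => i; rewrite !tnth_mktuple.
  case: (unliftP ord0 i) => [j|] ->.
    rewrite /tuple_cons !tnthS !tnth_mktuple tnth_behead.
    by rewrite (_ : inord j.+1 = lift ord0 j)//; apply: val_inj; rewrite /= inordK ?ltnS.
  by [].
under [in RHS]eq_integral do under eq_integral do rewrite consE.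
have mf' : measurable_fun setT (fun p : measurableTypeR R * RR R n => f (tuple_cons p)).
  exact: (measurableT_comp mf (@measurable_tuple_cons R n)).
pose g (t : measurableTypeR R) := \int[leb n]_x f (tuple_cons (t, x)).
have mg : measurable_fun setT g.
  exact: (measurable_fun_fubini_tonelli_F (m2 := leb n) _ mf').
have g0 t : 0 <= g t by apply: integral_ge0.
rewrite -/(g _) (ge0_integral_affine (thead v) c0 mg g0).
have mh : measurable_fun setT (fun p : measurableTypeR R * RR R n =>
    f (tuple_cons ((c * p.1 + thead v)%R, tadd (tscale c p.2) [tuple of behead v]))).
  apply: (measurableT_comp mf').
  apply: measurable_fun_pair.
    exact: (measurableT_comp (measurable_affine c (thead v)) measurable_fst).
  apply: measurable_tadd => //; apply: measurable_tscale; exact: measurable_snd.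
rewrite exprS EFinM -muleA; congr (_ * _).
rewrite -ge0_integralZl_EFin//.
- apply: eq_integral => t _.
  rewrite /g (IH [tuple of behead v])//.
  exact: (measurableT_comp mf' (measurable_pair1 (c * t + thead v)%R)).
- by move=> t _; apply: integral_ge0.
- exact: (measurable_fun_fubini_tonelli_F (m2 := leb n) _ mh).
Qed.

Lemma ge0_integral_tscale n (c : R) (f : RR R n -> \bar R) :
  c != 0%R -> measurable_fun setT f -> (forall x, 0 <= f x) ->
  \int[leb n]_x f x = (`|c| ^+ n)%:E * \int[leb n]_x f (tscale c x).
Proof.
move=> c0 mf f0.
rewrite (ge0_integral_affineRR [tuple 0%R | i < n] c0 mf f0); congr (_ * _).
apply: eq_integral => x _; congr f; apply: eq_from_tnth => i.
by rewrite !tnth_mktuple addr0.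
Qed.

Lemma ge0_integral_tadd n (v : RR R n) (f : RR R n -> \bar R) :
  measurable_fun setT f -> (forall x, 0 <= f x) ->
  \int[leb n]_x f x = \int[leb n]_x f (tadd x v).
Proof.
move=> mf f0.
rewrite (ge0_integral_affineRR v (@oner_neq0 R) mf f0) normr1 expr1n mul1e.
apply: eq_integral => x _; congr f; apply: eq_from_tnth => i.
by rewrite !tnth_mktuple mul1r.
Qed.

Lemma measurable_tscale1 n (c : R) : measurable_fun setT (@tscale R n c).
Proof. exact: measurable_tscale. Qed.

Lemma L2sq_tscale n (c : R) (f : RR R n -> R[i]) : c != 0%R -> cmeasurable f ->
  L2sq (leb n) f = (`|c| ^+ n)%:E * L2sq (leb n) (fun x => f (tscale c x)).
Proof.
move=> c0 mf; rewrite /L2sq (ge0_integral_tscale c0)//.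
  exact: measurable_sqnormE.
by move=> x; rewrite lee_fin sqnorm_ge0.
Qed.

Lemma cmeasurable_tscale n (c : R) (f : RR R n -> R[i]) : cmeasurable f ->
  cmeasurable (fun x => f (tscale c x)).
Proof. by move=> mf; apply: cmeasurable_comp => //; exact: measurable_tscale1. Qed.

Lemma pos_muleB (r : R) (x y : \bar R) : (0 < r)%R ->
  r%:E * (x - y) = r%:E * x - r%:E * y.
Proof.
move=> r0; case: x y => [x| |] [y| |]/=;
  rewrite ?(gt0_muley, gt0_muleNy)//= -?EFinM -?EFinB ?mulrBr//.
Qed.

Lemma integral_tscale n (c : R) (f : RR R n -> \bar R) :
  c != 0%R -> measurable_fun setT f ->
  \int[leb n]_x f x = (`|c| ^+ n)%:E * \int[leb n]_x f (tscale c x).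
Proof.
move=> c0 mf.
rewrite integralE (ge0_integral_tscale c0 (measurable_funepos mf) (funepos_ge0 f)).
rewrite (ge0_integral_tscale c0 (measurable_funeneg mf) (funeneg_ge0 f)).
rewrite [in RHS]integralE -pos_muleB ?exprn_gt0 ?normr_gt0//.
  by congr (_ * (_ - _)); apply: eq_integral => x _; rewrite ?funeposE ?funenegE.
Qed.

(** [fine] sends both infinities to 0, and a positive factor keeps them infinite, so scaling
    commutes with [fine] in every case. *)
Lemma fine_posZ (r : R) (x : \bar R) : (0 < r)%R ->
  fine (r%:E * x) = (r * fine x)%R.
Proof.
move=> r0; case: x => [s| |]//=; first by rewrite mulr0 gt0_muley.
by rewrite mulr0 gt0_muleNy.
Qed.

(** By [pos_muleB] and [fine_posZ] the conventions for divergent integrals scale as well. This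
    generality is used for the integrand of [Opw], of which only measurability is established. *)
Lemma cintegral_tscale n (c : R) (f : RR R n -> R[i]) :
  c != 0%R -> cmeasurable f ->
  cintegral (leb n) f =
  (real (`|c| ^+ n) * cintegral (leb n) (fun x => f (tscale c x)))%R.
Proof.
move=> c0 [m1 m2]; have c_gt0 : (0 < `|c| ^+ n)%R by rewrite exprn_gt0// normr_gt0.
apply: eq_ReIm; rewrite ReImE /= mul0r ?subr0 ?addr0 /Rintegral.
  by rewrite (integral_tscale c0) ?fine_posZ//; exact/measurable_EFinP.
by rewrite (integral_tscale c0) ?fine_posZ//; exact/measurable_EFinP.
Qed.

End tuple_space.

(** * Duality *)

Section pullback.
Context {R : realType} d d' d'' (S : measurableType d) (T : measurableType d')
  (U : measurableType d'').
Variables (mu : {measure set S -> \bar R}) (nu : {measure set T -> \bar R})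
  (rho : {measure set U -> \bar R}) (phi : S -> T) (k : R).
Hypothesis mphi : measurable_fun setT phi.
Hypothesis k0 : 0 <= k.
Local Open Scope ereal_scope.
Hypothesis L2phi : forall f : T -> R[i], cmeasurable f ->
  L2sq mu (fun x => f (phi x)) = k%:E * L2sq nu f.

(** [L2phi] at the indicator of a null set says that its preimage is null. *)
Lemma ae_pullback (P : T -> Prop) :
  {ae nu, forall y, P y} -> {ae mu, forall x, P (phi x)}.
Proof.
move=> [N [mN N0 PN]].
have mN' : measurable (phi @^-1` N).
  by rewrite -[X in measurable X]setTI; exact: mphi.
exists (phi @^-1` N); split => //; last by move=> x nP; exact: PN.
have := L2phi (cmeasurable_cindic mN); rewrite L2sq_cindic// N0 mule0 => <-.
by rewrite -L2sq_cindic//.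
Qed.

Lemma bounded_op_pullback (c : R[i]) (C : R) F : bounded_op rho nu C F ->
  bounded_op rho mu (sqnorm c * (k * C))%R (fun f x => c * F f (phi x))%R.
Proof.
move=> bF; have C0 := bop_ge0 bF.
have mF f : cL12 rho f -> cmeasurable (fun x => F f (phi x)).
  by move=> fL; apply: cmeasurable_comp => //; exact: (bop_measurable bF).
split.
- by rewrite !mulr_ge0// sqnorm_ge0.
- by move=> f fL; apply: cmeasurableZ; exact: mF.
- move=> f g fL gL; apply: ae_imp (ae_pullback (bopD bF fL gL)) => x ->.
  by rewrite mulrDr.
- move=> z f fL; apply: ae_imp (ae_pullback (bopZ bF z fL)) => x ->.
  by rewrite mulrCA.
- move=> f fL; rewrite L2sqZ; last exact: mF.
  rewrite L2phi; last exact: (bop_measurable bF).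
  rewrite 2!EFinM -!muleA; apply: lee_wpmul2l; first by rewrite lee_fin sqnorm_ge0.
  by apply: lee_wpmul2l; [rewrite lee_fin|exact: (bop_le bF)].
Qed.

End pullback.

Section product_ae.
Context {R : realType} d d' (S : measurableType d) (T : measurableType d').
Variables (mu : {sigma_finite_measure set S -> \bar R})
          (nu : {sigma_finite_measure set T -> \bar R}).
Local Open Scope ereal_scope.

Lemma ae_fst (P : S -> Prop) :
  {ae mu, forall x, P x} -> {ae mu \x nu, forall p, P p.1}.
Proof.
move=> [N [mN N0 PN]]; exists (N `*` setT); split.
- exact: measurableX.
- transitivity (mu N * nu setT); first exact: product_measure1E.
  by rewrite (_ : mu N = 0) ?mul0e.
- by move=> p nP; split => //; exact: PN.
Qed.

(** Tonelli for the indicator of a null set: almost every slice of it has measure 0. *)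
Lemma ae_slice (P : S * T -> Prop) : {ae mu \x nu, forall p, P p} ->
  {ae mu, forall x, {ae nu, forall y, P (x, y)}}.
Proof.
move=> [N [mN N0 PN]]; have mI := cmeasurable_cindic (R := R) mN.
have mF := measurable_L2sq_slice nu mI.
have I0 : \int[mu]_x `|L2sq nu (fun y => cindic N (x, y))| = 0.
  rewrite -[RHS]N0 -L2sq_cindic// L2sq_prod1//.
  by apply: eq_integral => x _; rewrite gee0_abs ?L2sq_ge0.
have := (ae_eq_integral_abs mu measurableT mF).1 I0.
apply: ae_imp => x /(_ I) /(L2sq_eq0 (cmeasurable_slice x mI)).
apply: ae_imp => y Ny; apply: contrapT => nP.
have Nxy : N (x, y) by exact: PN.
move: Ny; rewrite /cindic indicE mem_set//=.
by move=> [] /eqP; rewrite oner_eq0.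
Qed.

End product_ae.

Section phase_space.
Context {R : realType} {n : nat}.
Local Notation leb := (@lebesgue R n).
Local Notation m2 := (prod_measure leb leb).
Local Notation c := (@fcstd R n).
Local Notation k := (@kerd R n).
Local Notation real := (real_complex_def (Phant R)).
Local Open Scope ereal_scope.

(** With parameters [2] and [- 2] this is the argument of $\mathcal Fa$ in [dual_symbol]; with
    [- 2^-1] and [- 2] it is the map $L(x,y)=(-y/2,-2x)$. *)
Definition swap_scale (r s : R) (p : RR R n * RR R n) : RR R n * RR R n :=
  (tscale r p.2, tscale s p.1).

Lemma measurable_swap_scale r s : measurable_fun setT (swap_scale r s).
Proof.
apply: measurable_fun_pair; apply: measurable_tscale.
  exact: measurable_snd.
exact: measurable_fst.
Qed.

(** The inverse of the absolute Jacobian determinant of [swap_scale r s]: the factor by which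
    pullback changes [L2sq]. *)
Definition swap_jacobian (r s : R) : R := ((`|r| ^+ n)^-1 * (`|s| ^+ n)^-1)%R.

Lemma swap_jacobian_ge0 r s : (0 <= swap_jacobian r s)%R.
Proof. by rewrite mulr_ge0// invr_ge0 exprn_ge0. Qed.

Lemma L2sq_tscaleV (r : R) (f : RR R n -> R[i]) : r != 0%R -> cmeasurable f ->
  L2sq leb (fun x => f (tscale r x)) = (`|r| ^+ n)^-1%:E * L2sq leb f.
Proof.
move=> r0 mf; rewrite [in RHS](L2sq_tscale r0 mf) muleA -EFinM mulVf ?mul1e//.
by rewrite expf_neq0// normr_eq0.
Qed.

Lemma L2sq_swap_scale r s (f : RR R n * RR R n -> R[i]) : r != 0%R -> s != 0%R ->
  cmeasurable f ->
  L2sq m2 (fun p => f (swap_scale r s p)) = (swap_jacobian r s)%:E * L2sq m2 f.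
Proof.
move=> r0 s0 mf; have mf' := cmeasurable_comp mf (measurable_swap_scale r s).
rewrite L2sq_prod2// (_ : L2sq m2 f = \int[leb]_x L2sq leb (fun y => f (x, y)));
  last exact: L2sq_prod1.
rewrite /swap_jacobian EFinM -muleA.
pose g x := L2sq leb (fun y => f (x, y)).
have mg : measurable_fun setT g by exact: measurable_L2sq_slice.
have g0 x : 0 <= g x by exact: L2sq_ge0.
have r_gt0 : (0 < `|r| ^+ n)%R by rewrite exprn_gt0// normr_gt0.
have mgr : measurable_fun setT (fun x => g (tscale r x)).
  by apply: (measurableT_comp mg); exact: measurable_tscale1.
rewrite (ge0_integral_tscale r0 mg g0) [X in _ * X]muleCA muleA -EFinM.
rewrite mulVf ?gt_eqF// mul1e -ge0_integralZl_EFin ?invr_ge0 ?exprn_ge0//.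
apply: eq_integral => x _.
by rewrite /g -(L2sq_tscaleV s0)//; exact: cmeasurable_slice.
Qed.

(** $(2\pi)^{-n}$ is the square of [fcstd] and the phase is a product, so $\mathcal F$ is a tensor
    square. *)
Lemma fourierL1E : @fourierL1 R n = ft m2 (c * c)%R (tensork k k).
Proof.
apply/funext => a; apply/funext => p; rewrite /fourierL1 /ft; congr (_ * _)%R.
  congr (_ %:C)%C; rewrite /fcstd -powRD; last first.
    by apply/implyP => _; rewrite gt_eqF// mulr_gt0// pi_gt0.
  by rewrite -opprD -splitr powRN powR_mulrn// mulr_ge0// ltW// pi_gt0.
apply: eq_cintegral => q; congr (_ * _)%R.
by rewrite /tensork /kerd -expiD addrC.
Qed.

Lemma fourierL1_bounded : exists C, bounded_op m2 m2 C (@fourierL1 R n).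
Proof.
have [C hC] := @fourier_pair_RR R n; have h := fourier_pair_tensor hC hC.
exists (C * C)%R; rewrite fourierL1E; apply: (ft_bounded_op (mu := m2)).
- exact: fp_phase h.
- exact: fp_gt0 h.
- exact: fp_le h.
Qed.

(** A slice transform is additive and homogeneous where the slices are integrable, that is at almost
    every first coordinate; this is where the almost everywhere linearity of [bounded_op] is
    needed. *)
Lemma fourier2L1_bounded : exists C, bounded_op m2 m2 C (@fourier2L1 R n).
Proof.
have [C hC] := @fourier_pair_RR R n; exists C; split.
- exact/ltW/(fp_gt0 hC).
- move=> f [fi _]; have mf := cintegrable_measurable fi.
  exact: (partial_ft_le hC mf (cintegrable_slice fi)).1.
- move=> f g [fi _] [gi _].
  have h := ae_fst leb (ae_and (cintegrable_slice fi) (cintegrable_slice gi)).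
  apply: (@ae_imp _ _ _ m2 _ _ _ h) => p [fip gip].
  exact: (ftD c (@phase_kerd R n) p.2 fip gip).
- move=> z f [fi _]; have h := ae_fst leb (cintegrable_slice fi).
  apply: (@ae_imp _ _ _ m2 _ _ _ h) => p fip.
  exact: (ftZ c (@phase_kerd R n) z p.2 fip).
- move=> f [fi _]; have mf := cintegrable_measurable fi.
  exact: (partial_ft_le hC mf (cintegrable_slice fi)).2.
Qed.

End phase_space.

Section duality.
Context {R : realType} {n : nat}.
Local Notation leb := (@lebesgue R n).
Local Notation m2 := (prod_measure leb leb).
Local Notation c := (@fcstd R n).
Local Notation k := (@kerd R n).
Local Notation real := (real_complex_def (Phant R)).
Local Notation Phi := (ft leb c k).
Local Open Scope ereal_scope.
Implicit Types u v : RR R n -> R[i].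

Lemma cL2_tscale (r : R) u : r != 0%R -> cL2 leb u -> cL2 leb (fun x => u (tscale r x)).
Proof.
move=> r0 [mu u2]; split; first exact: cmeasurable_tscale.
by rewrite L2sq_tscaleV// lte_mul_pinfty// lee_fin invr_ge0 exprn_ge0.
Qed.

Lemma cintegrable_tscale (r : R) u : r != 0%R -> cintegrable leb u ->
  cintegrable leb (fun x => u (tscale r x)).
Proof.
move=> r0 ui; have mu := cintegrable_measurable ui.
have mu' := cmeasurable_tscale r mu; apply/cintegrableP => //.
have r_gt0 : (0 < `|r| ^+ n)%R by rewrite exprn_gt0// normr_gt0.
have := (cintegrableP _ mu).1 ui; rewrite (ge0_integral_tscale r0).
- by move: (\int[_]_x _) => [x| |]; rewrite ?ltry// gt0_muley.
- by apply/measurable_EFinP; exact: measurable_normc.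
- by move=> x; rewrite lee_fin normc_ge0.
Qed.

(** Substituting [2 * x] absorbs [2 ^+ n] as a Jacobian, which explains the factor $2^d$ of the dual
    symbol, and halves the frequency; the change of sign turns the transform into its adjoint. *)
Lemma ft_tscale2 (w : RR R n -> R[i]) y : cintegrable leb w ->
  Phi (fun x => real (2 ^+ n)%R * w (tscale 2%R x))%R y =
  ft leb c (conjk k) w (tscale (- 2^-1)%R y).
Proof.
move=> wi; have two0 : (2%R : R) != 0%R by [].
have pk := @phase_kerd R n; have wi2 := cintegrable_tscale two0 wi.
have iw := cintegrable_phase (phase_conj pk) (tscale (- 2^-1)%R y) wi.
rewrite /ft [in RHS](cintegral_tscale two0 (cintegrable_measurable iw)).
congr (_ * _)%R; rewrite ger0_norm// -cintegralZ; last first.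
  exact: (cintegrable_tscale two0 iw).
apply: eq_cintegral => x; rewrite mulrCA; congr (_ * (_ * _))%R.
rewrite /conjk /kerd -expiN opprK; congr expi; rewrite /dotp -sumrN.
apply: eq_bigr => i _; by rewrite !tnth_mktuple !mulNr mulrACA mulVf// mul1r.
Qed.

Lemma fourier2L1_tensor u v : cintegrable leb v ->
  fourier2L1 (tensor u v) = tensor u (Phi v).
Proof.
by move=> vi; apply/funext => p; exact: (ftZ c (@phase_kerd R n) (u p.1) p.2 vi).
Qed.

Lemma lte_pdivr_mull (q r : R) (x : \bar R) : (0 < q)%R ->
  x < (r / q)%:E -> q%:E * x < r%:E.
Proof.
move=> q0 xr; rewrite (_ : r%:E = q%:E * (r / q)%:E) ?lte_pmul2l//.
by rewrite -EFinM mulrCA divff ?mulr1// gt_eqF.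
Qed.

(** For $a=u\otimes v$ the dual symbol is [tensor U0 V1]. Formally the transform of [V1] at $y$ is
    the inverse transform of [Phi u] at $-y/2$, hence [V2], and [U0] times [V2] is $(\mathcal
    F_2a)\circ L$. Since [U0] and [V1] need not be integrable, [h] and [V] replace them; the [w] of
    Fourier inversion puts [V] near [V1] and its transform near [V2] at once. *)
Lemma duality_tensor u v e : cL12 leb u -> cL12 leb v -> (0 < e)%R -> exists w,
  [/\ cL12 m2 w,
     L2sq m2 (w \- (fun p => real (2 ^+ n)%R *
       fourierL1 (tensor u v) (swap_scale 2%R (- 2)%R p)))%R < e%:E &
     L2sq m2 (fourier2L1 w \- (fun p => 1 *
       fourier2L1 (tensor u v) (swap_scale (- 2^-1)%R (- 2)%R p)))%R < e%:E].
Proof.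
move=> uL vL e0; have [C hC] := @fourier_pair_RR R n.
have pk := @phase_kerd R n.
have bPhi : bounded_op leb leb C Phi.
  by apply: ft_bounded_op => //; [exact: fp_gt0 hC|exact: fp_le hC].
have bPhi' : bounded_op leb leb C (ft leb c (conjk k)).
  apply: ft_bounded_op; [exact: phase_conj|exact: fp_gt0 hC|].
  by apply: ft_conj_le => //; exact: fp_le hC.
have two0 : (2%R : R) != 0%R by [].
have twoN0 : (- 2%R : R)%R != 0%R by rewrite oppr_eq0.
have twoV0 : (- 2^-1 : R)%R != 0%R by rewrite oppr_eq0 invr_eq0.
pose U0 x := Phi v (tscale (- 2)%R x).
pose V1 x := (real (2 ^+ n)%R * Phi u (tscale 2%R x))%R.
pose V2 x := u (tscale (- 2^-1)%R x).
have U0L : cL2 leb U0 := (cL2_tscale twoN0 (bop_cL2 bPhi vL)).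
have V1L : cL2 leb V1.
  by apply: cL2Z; exact: (cL2_tscale two0 (bop_cL2 bPhi uL)).
have V2L : cL2 leb V2 := (cL2_tscale twoV0 uL.2).
have [r1 r10 H1] := tensor_continuous U0L V1L e0.
have [r2 r20 H2] := tensor_continuous U0L V2L e0.
pose r := Num.min r1 r2; have r0 : (0 < r)%R by rewrite lt_min r10.
have rr1 : r%:E <= r1%:E by rewrite lee_fin ge_min lexx.
have rr2 : r%:E <= r2%:E by rewrite lee_fin ge_min lexx orbT.
have q0 : (0 < (2%R : R) ^+ n)%R by rewrite exprn_gt0.
have [h hL hU0] := cL12_dense U0L r0.
(* Both uses of [w] multiply squared distances by [2 ^+ n]: for [V], the factor $4^n$ meets the
   Jacobian $2^{-n}$; for its transform, the factor comes from the dilation by $-1/2$. *)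
have [w [wL wu Bw]] := fp_inv hC uL (divr_gt0 r0 q0).
have mw := wL.2.1; have mPu := bop_measurable bPhi uL.
pose V x := (real (2 ^+ n)%R * w (tscale 2%R x))%R.
have VL : cL12 leb V.
  apply: cL12Z; split; first exact: (cintegrable_tscale two0 wL.1).
  exact: (cL2_tscale two0 wL.2).
exists (tensor h V); split; first exact: cL12_tensor.
- rewrite (_ : (fun p => _) = tensor U0 V1); last first.
    apply/funext => p; rewrite fourierL1E ft_tensor//; [|by case: uL|by case: vL].
    by rewrite /tensor /U0 /V1 /swap_scale/= mulrA mulrC.
  apply: H1; [by case: hL|by case: VL|exact: lt_le_trans hU0 rr1|].
  apply: lt_le_trans rr1; rewrite (_ : (V \- V1)%R =
      (fun x => real (2 ^+ n)%R * (fun x => (w \- Phi u) (tscale 2%R x)) x))%R; last first.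
    by apply/funext => x /=; rewrite mulrBr.
  have mwu := cmeasurableB mw mPu.
  rewrite L2sqZ; last exact: cmeasurable_tscale.
  rewrite L2sq_tscaleV// muleA -EFinM sqnorm_real ger0_norm// expr2 mulfK ?gt_eqF//.
  exact: lte_pdivr_mull.
- rewrite (fourier2L1_tensor h VL.1) fourier2L1_tensor; last by case: vL.
  rewrite (_ : (fun p => _) = tensor U0 V2); last first.
    by apply/funext => p; rewrite mul1r /tensor /U0 /V2 /swap_scale/= mulrC.
  have PhiV : Phi V = fun y => ft leb c (conjk k) w (tscale (- 2^-1)%R y).
    by apply/funext => y; exact: ft_tscale2 wL.1.
  rewrite PhiV.
  apply: H2; [by case: hL| |exact: lt_le_trans hU0 rr2|].
    exact: (cL2_tscale twoV0 (bop_cL2 bPhi' wL)).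
  apply: lt_le_trans rr2.
  have mB := cmeasurableB (bop_measurable bPhi' wL) uL.2.1.
  rewrite [X in X < _](L2sq_tscaleV twoV0 mB) normrN ger0_norm ?invr_ge0//.
  by rewrite exprVn invrK; exact: lte_pdivr_mull.
Qed.

(** [bop_approx] gives [h] near [a], and [w] near the dual symbol formula at [h] with $\mathcal
    F_2w$ near $(\mathcal F_2h)\circ L$; the bounds of [L2_extensionP] then pass from [h] and [w] to
    [a] and its dual symbol. *)
Lemma fourier2_dual_symbol (a : RR R n * RR R n -> R[i]) : cL2 m2 a ->
  [/\ cL2 m2 (fourier2 a), cL2 m2 (fourier2 (dual_symbol a)) &
   {ae m2, forall p, fourier2 (dual_symbol a) p =
     fourier2 a (swap_scale (- 2^-1)%R (- 2)%R p)}].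
Proof.
move=> aL; have two0 : (2%R : R) != 0%R by [].
have twoN0 : (- 2%R : R)%R != 0%R by rewrite oppr_eq0.
have twoV0 : (- 2^-1 : R)%R != 0%R by rewrite oppr_eq0 invr_eq0.
have [C1 b1] := @fourierL1_bounded R n.
have [C2 b2] := @fourier2L1_bounded R n.
have Lsw r s (r0 : r != 0%R) (s0 : s != 0%R) :
  forall f, cmeasurable f -> L2sq m2 (fun p => f (swap_scale r s p)) =
    (@swap_jacobian R n r s)%:E * L2sq m2 f.
  by move=> f; exact: L2sq_swap_scale.
(* On $L^1\cap L^2$, [bA] is the formation of the dual symbol and [bD] is $\mathcal F_2$ followed by
   composition with $L$. *)
have bA := bounded_op_pullback (measurable_swap_scale _ _) (swap_jacobian_ge0 _ _)
  (Lsw _ _ two0 twoN0) (real (2 ^+ n)%R) b1.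
have bD := bounded_op_pullback (measurable_swap_scale _ _) (swap_jacobian_ge0 _ _)
  (Lsw _ _ twoV0 twoN0) 1%R b2.
set CA := (_ * (_ * C1))%R in bA; set CD := (_ * (_ * C2))%R in bD.
have [E1L E1P] := L2_extensionP b1 aL.
have [E2L E2P] := L2_extensionP b2 aL.
rewrite -/(fourier a) in E1L E1P; rewrite -/(fourier2 a) in E2L E2P.
have pullL r s (r0 : r != 0%R) (s0 : s != 0%R) f : cL2 m2 f ->
    cL2 m2 (fun p => f (swap_scale r s p)).
  move=> [mf f2]; split.
    by apply: cmeasurable_comp => //; exact: measurable_swap_scale.
  by rewrite Lsw// lte_mul_pinfty// lee_fin swap_jacobian_ge0.
have sL : cL2 m2 (dual_symbol a).
  exact: (cL2Z (real (2 ^+ n)%R) (pullL _ _ two0 twoN0 _ E1L)).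
have [E3L E3P] := L2_extensionP b2 sL.
rewrite -/(fourier2 (dual_symbol a)) in E3L E3P; split => //.
pose D2 p := fourier2 a (swap_scale (- 2^-1)%R (- 2)%R p).
have D2L : cL2 m2 D2 := pullL _ _ twoV0 twoN0 _ E2L.
have [K [UK ndK Koo]] := (sigma_finiteP _ _).1 (sigma_finiteT leb).
have C1_0 := bop_ge0 b1; have C2_0 := bop_ge0 b2.
have CA0 := bop_ge0 bA; have CD0 := bop_ge0 bD.
have rect A i B j e : measurable A -> measurable B -> (0 < e)%R -> exists w,
    [/\ cL12 m2 w,
     L2sq m2 (w \- (fun p => real (2 ^+ n)%R * fourierL1
       (cindic ((A `&` K i) `*` (B `&` K j))) (swap_scale 2%R (- 2)%R p)))%R < e%:E &
     L2sq m2 (fourier2L1 w \- (fun p => 1 * fourier2L1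
       (cindic ((A `&` K i) `*` (B `&` K j)))
       (swap_scale (- 2^-1)%R (- 2)%R p)))%R < e%:E].
  move=> mA mB e0; rewrite cindic_setX; apply: duality_tensor => //.
    apply: cL12_cindic; first by apply: measurableI => //; exact: (Koo i).1.
    apply: le_lt_trans (Koo i).2; apply: le_measure; rewrite ?inE//.
      by apply: measurableI => //; exact: (Koo i).1.
    exact: (Koo i).1.
  apply: cL12_cindic; first by apply: measurableI => //; exact: (Koo j).1.
  apply: le_lt_trans (Koo j).2; apply: le_measure; rewrite ?inE//.
    by apply: measurableI => //; exact: (Koo j).1.
  exact: (Koo j).1.
have approx : forall e, (0 < e)%R -> exists h w,
    [/\ cL12 m2 h, cL12 m2 w, L2sq m2 (h \- a)%R < e%:E,
        L2sq m2 (w \- (fun p => real (2 ^+ n)%R *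
          fourierL1 h (swap_scale 2%R (- 2)%R p)))%R < e%:E &
        L2sq m2 (fourier2L1 w \- (fun p => 1 *
          fourier2L1 h (swap_scale (- 2^-1)%R (- 2)%R p)))%R < e%:E].
  apply: (bop_approx (G := [set A `*` B | A in measurable & B in measurable])
    (K := fun i => K i `*` K i) bA b2 bD) => //.
  - exact: measurable_prod_measurableType.
  - move=> _ _ [A1 mA1 [B1 mB1 <-]] [A2 mA2 [B2 mB2 <-]].
    exists (A1 `&` A2); first exact: measurableI.
    by exists (B1 `&` B2); [exact: measurableI|rewrite setXI].
  - by move=> i; apply: measurableX; exact: (Koo i).1.
  - move=> i j ij; apply/subsetPset => -[x y] [/= Kx Ky]; split => /=.
      by move: x Kx; exact/subsetPset/ndK.
    by move: y Ky; exact/subsetPset/ndK.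
  - rewrite -setXTT UK; apply/seteqP; split => -[x y].
      by move=> [i _ []/= ? ?]; split; exists i.
    move=> [/= [i _ Fix] [j _ Gjy]]; exists (maxn i j) => //; split.
    + by move: x Fix; exact/subsetPset/ndK/leq_maxl.
    + by move: y Gjy; exact/subsetPset/ndK/leq_maxr.
  - move=> i; rewrite [X in X < _](_ : _ = leb (K i) * leb (K i)); last first.
      by apply: product_measure1E; exact: (Koo i).1.
    by rewrite lte_mul_pinfty ?ge0_fin_numE//; exact: (Koo i).2.
  - move=> X i r [[A mA [B mB <-]]|->] r0.
      by rewrite -setXI; exact: rect.
    rewrite -setXTT -setXI; exact: rect.
apply: L2sq_eq; [by case: E3L|by case: D2L|].
(* Both factors are in fact 1: [jA] is $4^n\cdot4^{-n}$ and [jD] is $2^n\cdot2^{-n}$. *)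
set jA := (sqnorm (real (2 ^+ n)%R) * @swap_jacobian R n 2%R (- 2)%R)%R.
set jD := @swap_jacobian R n (- 2^-1)%R (- 2)%R.
have jA0 : (0 <= jA)%R by rewrite mulr_ge0 ?sqnorm_ge0 ?swap_jacobian_ge0.
have jD0 : (0 <= jD)%R by exact: swap_jacobian_ge0.
(* The factors met along the triangle inequalities: the first summand bounds the distance of
   $\mathcal F_2w$ to the left side, the second its distance to the right side. *)
pose M := (2 * (4 * C2 * (2 + 2 * (jA * (4 * C1)))) +
  2 * (2 + 2 * (jD * (4 * C2))))%R.
have M0 : (0 < M)%R.
  have p1 : (0 <= jA * (4 * C1))%R by rewrite mulr_ge0// mulr_ge0.
  have p2 : (0 <= jD * (4 * C2))%R by rewrite mulr_ge0// mulr_ge0.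
  have p3 : (0 <= 4 * C2 * (2 + 2 * (jA * (4 * C1))))%R.
    apply: mulr_ge0; first by rewrite mulr_ge0.
    by rewrite addr_ge0// mulr_ge0.
  by move: p1 p2 p3; rewrite /M; clear; lra.
apply: eps_eq0; first exact: L2sq_ge0.
move=> e e0; have eM0 : (0 < e / M)%R by rewrite divr_gt0.
have [h [w [hL wL ha wA BD]]] := approx _ eM0.
have mE1 := E1L.1; have mE2 := E2L.1; have mE3 := E3L.1; have mD2 := D2L.1.
have mF1h := bop_measurable b1 hL; have mF2h := bop_measurable b2 hL.
have mw := wL.2.1; have mF2w := bop_measurable b2 wL.
have mAh := bop_measurable bA hL; have mDh := bop_measurable bD hL.
have h1 := E1P h hL; have h2 := E2P h hL; have h3 := E3P w wL.
have hA : L2sq m2 ((fun p => real (2 ^+ n)%R *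
      fourierL1 h (swap_scale 2%R (- 2)%R p)) \- dual_symbol a)%R =
    jA%:E * L2sq m2 (fourierL1 h \- fourier a)%R.
  have mB := cmeasurableB mF1h mE1.
  rewrite EFinM -muleA -(Lsw _ _ two0 twoN0 _ mB) -L2sqZ; last first.
    by apply: cmeasurable_comp => //; exact: measurable_swap_scale.
  by congr (L2sq m2 _); apply/funext => p /=; rewrite mulrBr.
have hD : L2sq m2 ((fun p => 1 *
      fourier2L1 h (swap_scale (- 2^-1)%R (- 2)%R p)) \- D2)%R =
    jD%:E * L2sq m2 (fourier2L1 h \- fourier2 a)%R.
  have mB := cmeasurableB mF2h mE2.
  rewrite -(Lsw _ _ twoV0 twoN0 _ mB).
  by congr (L2sq m2 _); apply/funext => p /=; rewrite mul1r.
have t1 := L2sqB m2 mw mAh sL.1.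
have t2 := L2sqB m2 mF2w mDh mD2.
have t3 := L2sqB m2 mE3 mF2w mD2.
move: h1 h2 h3 hA hD t1 t2 t3 wA BD ha.
rewrite (L2sqBC m2 (fourier2 (dual_symbol a)) (fourier2L1 w)).
have [a1 a10 ->] := cL2_fin (cL2B (bop_cL2 b1 hL) E1L).
have [a2 a20 ->] := cL2_fin (cL2B (bop_cL2 b2 hL) E2L).
have [a3 a30 ->] := cL2_fin (cL2B hL.2 aL).
have [a4 a40 ->] := cL2_fin (cL2B (bop_cL2 b2 wL) E3L).
have [a5 a50 ->] := cL2_fin (cL2B wL.2 sL).
have [a6 a60 ->] := cL2_fin (cL2B (bop_cL2 bA hL) sL).
have [a7 a70 ->] := cL2_fin (cL2B (bop_cL2 bD hL) D2L).
have [a8 a80 ->] := cL2_fin (cL2B wL.2 (bop_cL2 bA hL)).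
have [a9 a90 ->] := cL2_fin (cL2B (bop_cL2 b2 wL) (bop_cL2 bD hL)).
have [a10' a100 ->] := cL2_fin (cL2B (bop_cL2 b2 wL) D2L).
have [a11 a110 ->] := cL2_fin (cL2B E3L D2L).
rewrite -?EFinM -?EFinD ?lee_fin ?lte_fin.
move=> h1 h2 h3 [hA] [hD] t1 t2 t3 wA BD ha.
have -> : e = (M * (e / M))%R by rewrite mulrCA divff ?mulr1// gt_eqF.
move: (e / M)%R eM0 wA BD ha => x x0 wA BD ha.
have q1 : (a6 <= jA * (4 * C1) * x)%R.
  rewrite hA -mulrA; apply: ler_wpM2l => //; apply: le_trans h1 _.
  by apply: ler_wpM2l; [rewrite mulr_ge0|exact: ltW].
have q2 : (a7 <= jD * (4 * C2) * x)%R.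
  rewrite hD -mulrA; apply: ler_wpM2l => //; apply: le_trans h2 _.
  by apply: ler_wpM2l; [rewrite mulr_ge0|exact: ltW].
have q3 : (a4 <= 4 * C2 * ((2 + 2 * (jA * (4 * C1))) * x))%R.
  apply: le_trans h3 _; apply: ler_wpM2l; first by rewrite mulr_ge0.
  by move: t1 q1 wA; clear; rewrite mulrDl -mulrA; lra.
move: t2 t3 q2 q3 BD; rewrite /M; clear; lra.
Qed.

End duality.

(** * The Weyl kernel under duality *)

Section weyl_kernel.
Context {R : realType} {n : nat}.
Local Notation leb := (@lebesgue R n).
Local Notation m2 := (prod_measure leb leb).
Local Open Scope ereal_scope.
Implicit Types x y : RR R n.

(** The point at which [weyl_kernel] evaluates [fourier2 a]. *)
Definition weyl_coord (p : RR R n * RR R n) : RR R n * RR R n :=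
  (tscale 2^-1 (tadd p.1 p.2), tadd p.2 (topp p.1)).

Lemma measurable_weyl_coord : measurable_fun setT weyl_coord.
Proof.
apply: measurable_fun_pair.
  apply: measurable_tscale; apply: measurable_tadd; first exact: measurable_fst.
  exact: measurable_snd.
apply: measurable_tadd; first exact: measurable_snd.
exact: (measurableT_comp (@measurable_topp R n) measurable_fst).
Qed.

Lemma L2sq_tadd (v : RR R n) (f : RR R n -> R[i]) : cmeasurable f ->
  L2sq leb (fun x => f (tadd x v)) = L2sq leb f.
Proof.
move=> mf; rewrite [RHS](ge0_integral_tadd v)//; first exact: measurable_sqnormE.
by move=> x; rewrite lee_fin sqnorm_ge0.
Qed.

(** The map is a composition of two shears: the translation $y\mapsto y+x$ at fixed [x] reduces it
    to [g], and a translation of the first variable at fixed second one reduces [g] to [f]. The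
    factor [1%:E] fits the form of [L2phi]. *)
Lemma L2sq_weyl_coord (f : RR R n * RR R n -> R[i]) : cmeasurable f ->
  L2sq m2 (fun p => f (weyl_coord p)) = 1%:E * L2sq m2 f.
Proof.
move=> mf; have mfw := cmeasurable_comp mf measurable_weyl_coord.
pose g (p : RR R n * RR R n) := f (tadd p.1 (tscale 2^-1 p.2), p.2).
have mg : cmeasurable g.
  apply: (cmeasurable_comp mf); apply: measurable_fun_pair.
    apply: measurable_tadd; first exact: measurable_fst.
    by apply: measurable_tscale; exact: measurable_snd.
  exact: measurable_snd.
have mslice2 y : cmeasurable (fun x => f (x, y)).
  by apply: (cmeasurable_comp mf); exact: measurable_pair2.
rewrite mul1e; transitivity (L2sq m2 g); last first.
  rewrite (L2sq_prod2 leb leb mg) (L2sq_prod2 leb leb mf); apply: eq_integral => y _.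
  exact: (L2sq_tadd (tscale 2^-1 y) (mslice2 y)).
rewrite (L2sq_prod1 leb leb mfw) (L2sq_prod1 leb leb mg); apply: eq_integral => x _.
rewrite -(L2sq_tadd x)//; last exact: (cmeasurable_slice x mfw).
congr (L2sq _ _); apply/funext => z; congr (f (_, _)).
  apply: eq_from_tnth => i; rewrite !tnth_mktuple; lra.
apply: eq_from_tnth => i; rewrite !tnth_mktuple; lra.
Qed.

Lemma topp_tscale x : topp (tscale (-1) x) = x.
Proof. by apply: eq_from_tnth => i; rewrite !tnth_mktuple mulN1r opprK. Qed.

Lemma tscaleN1 x : tscale (-1) x = topp x.
Proof. by apply: eq_from_tnth => i; rewrite !tnth_mktuple mulN1r. Qed.

Lemma cmeasurable_weyl_kernel (a : RR R n * RR R n -> R[i]) x :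
  cmeasurable (fourier2 a) -> cmeasurable (weyl_kernel a x).
Proof.
move=> m2a; apply: cmeasurableZ.
exact: (cmeasurable_slice x (cmeasurable_comp m2a measurable_weyl_coord)).
Qed.

(** $L$ sends the Weyl coordinates of $(x,y)$ to $((x-y)/2,-y-x)$, which are those of $(x,-y)$. The
    exceptional null set is pulled back by [weyl_coord], then sliced at almost every [x]. *)
Lemma weyl_kernel_dual_symbol (a : RR R n * RR R n -> R[i]) : cL2 m2 a ->
  {ae leb, forall x, {ae leb, forall y,
    weyl_kernel (dual_symbol a) x y = weyl_kernel a x (topp y)}}.
Proof.
move=> aL; have [_ _ h] := fourier2_dual_symbol aL.
have := ae_slice (ae_pullback (mu := m2) (nu := m2) measurable_weyl_coord L2sq_weyl_coord h).
apply: ae_imp => x; apply: ae_imp => y; rewrite /weyl_kernel => ->.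
congr (_ * fourier2 a (_, _))%R; apply: eq_from_tnth => i;
  rewrite !tnth_mktuple; lra.
Qed.

End weyl_kernel.

Theorem theorem2p2 (R : realType) (d : nat) (hd : (1 <= d)%N)
  (a : RR R d * RR R d -> R[i]) (ha : cLfun lebesgue2 2 a) :
  L2_op_eq (lebesgue d) (Opw a \o reflection) (Opw (dual_symbol a)).
Proof.
move=> u /cLfun2P[mu _].
have aL : cL2 (prod_measure (lebesgue d) (lebesgue d)) a by apply/cLfun2P.
have [[m1 _] [m2 _] _] := fourier2_dual_symbol aL.
(* The exceptional set of [x] depends on the kernels alone and not on [u]. *)
apply: ae_imp (weyl_kernel_dual_symbol aL) => x kx.
have mk := cmeasurable_weyl_kernel x m1.
have mk' := cmeasurable_weyl_kernel x m2.
have mur : cmeasurable (reflection u).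
  by apply: (cmeasurable_comp mu); exact: measurable_topp.
have N10 : (-1 : R) != 0 by rewrite oppr_eq0.
(* The substitution $y\mapsto-y$, a dilation by -1 with Jacobian 1, moves the reflection from [u] to
   the kernel. *)
rewrite /Opw /= (cintegral_tscale N10 (cmeasurableM mk mur)).
rewrite normrN1 expr1n mul1r; apply: ae_eq_cintegral.
- exact: (cmeasurable_tscale (-1) (cmeasurableM mk mur)).
- exact: cmeasurableM.
- by apply: ae_imp kx => y ->; rewrite /reflection topp_tscale tscaleN1.
Qed.
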